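(* Let $X$ be a Banach space. Then the following statements hold: (i) If $X$ has property $(S)$, then it has the Gaussian average property $\mathrm{GAP}$. (ii) If $X$ has property $(S_p)$ (where $1\le p<\infty$), then $X$ is of cotype $\max(2,p)$. (iii) If $X$ has $\mathrm{GAP}$, then $X$ is of finite cotype. (iv) If $X$ is of finite cotype and has $\mathrm{GL}_2$, then $X$ has $(S)$ and hence also $\mathrm{GAP}$.
   Context: $B(X,Y)$ is the space of bounded linear operators from $X$ to $Y$. $\Pi_p(X,Y)$ ($1\le p<\infty$) is the space of $p$-summing operators, with $p$-summing norm $\pi_p$. $\ell_2\otimes X$ is identified with the finite rank operators from $\ell_2$ to $X$. $(g_n)$ is a sequence of independent standard Gaussian variables on a probability space $(\Omega,\mathcal{S},\mu)$ and $(e_n)$ is the unit vector basis of $\ell_2$. For $T\in \ell_2\otimes X$ the $\ell$-norm is $\ell(T)=\left(\int\|\sum_{n=1}^\infty g_n(t)Te_n\|^2d\mu(t)\right)^{1/2}$ (the series converges in $L_2(\mu,X)$). $\mathrm{GAP}$: $X$ has $\mathrm{GAP}$ if there is a constant $K$ so that $\ell(T)\le K\pi_1(T^* )$ for all $T\in\ell_2\otimes X$. Property $(S_p)$, $1\le p<\infty$: there is a constant $K$ so that if $T\in B(\ell_2,X)$ with $T^*\in\Pi_1(X^*,\ell_2)$, then $T\in\Pi_p(\ell_2,X)$ with $\pi_p(T)\le K\pi_1(T^* )$. $X$ has $(S)$ if it has $(S_p)$ for some $p$, $1\le p<\infty$. An operator $T\in B(X,Y)$ factors through $L_1$ if $T=BA$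 with $A\in B(X,L_1(\nu))$, $B\in B(L_1(\nu),Y)$ for some measure $\nu$. $X$ has $\mathrm{GL}_2$ if every 1-summing operator from $X$ to $\ell_2$ factors through $L_1$; equivalently, there is a constant $K$ with $\gamma_1(T)\le K\pi_1(T)$ for all finite rank $T:X\to\ell_2$, where $\gamma_1(T)=\inf\|A\|\|B\|$ over all such factorizations. *)

(* Defs.v *)
From HB Require Import structures.
From mathcomp Require Import all_boot all_order all_algebra finmap.
From mathcomp Require Import ring_quotient.
From mathcomp Require Import all_classical all_reals all_analysis.
From mathcomp Require Import ess_sup_inf measurable_realfun.

Set Implicit Arguments.
Unset Strict Implicit.
Unset Printing Implicit Defensive.

Import Order.TTheory GRing.Theory Num.Theory.
Import numFieldNormedType.Exports.

Local Open Scope classical_set_scope.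
Local Open Scope ring_scope.
Local Open Scope quotient_scope.

Section bounded_operators.
Context {R : realType} (X Y : normedModType R).

Definition bounded_operator : {pred X -> Y} :=
  [pred f : X -> Y | `[< linear f /\ exists M : R, forall x, `|f x| <= M * `|x| >]].

Record bop := Bop { bop_fun :> X -> Y ; _ : bop_fun \in bounded_operator }.

HB.instance Definition _ := [isSub for bop_fun].
HB.instance Definition _ := [Choice of bop by <:].

Lemma bounded_operator_submod_closed : submod_closed bounded_operator.
Proof.
split.
  apply/asboolP; split=> [a x y|]; first by rewrite scaler0 addr0.
  by exists 0 => x; rewrite normr0 mul0r.
move=> a f g /asboolP[lf [M fM]] /asboolP[lg [N gN]].
have afgE z : (a *: f + g) z = a *: f z + g z by [].
apply/asboolP; split=> [b x y|].
  by rewrite !afgE lf lg !scalerDr !scalerA [b * a]mulrC addrACA.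
exists (`|a| * M + N) => x; rewrite afgE mulrDl (le_trans (ler_normD _ _))//.
by rewrite lerD// normrZ -mulrA ler_wpM2l.
Qed.

HB.instance Definition _ := GRing.isSubmodClosed.Build R (X -> Y)
  bounded_operator bounded_operator_submod_closed.
HB.instance Definition _ := [SubChoice_isSubLmodule of bop by <:].

Lemma bop_linear (f : bop) : linear f.
Proof. by case: f => f /= /asboolP[]. Qed.

HB.instance Definition _ (f : bop) :=
  GRing.isLinear.Build R X Y *:%R (bop_fun f) (bop_linear f).

Lemma bop_bounded (f : bop) : exists M : R, forall x, `|f x| <= M * `|x|.
Proof. by case: f => f /= /asboolP[]. Qed.

Definition opnorm (f : bop) : R := sup [set `|f x| | x in [set x | `|x| <= 1]].

Lemma opnorm_has_sup (f : bop) :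
  has_sup [set `|f x| | x in [set x | `|x| <= 1]].
Proof.
split; first by exists `|f 0|, 0 => //=; rewrite normr0.
have [M fM] := bop_bounded f.
exists `|M| => _ [x /= x1 <-]; rewrite (le_trans (fM x))//.
rewrite (le_trans (ler_wpM2r _ (ler_norm M)))//.
by rewrite ler_piMr.
Qed.

Lemma opnorm_ge0 (f : bop) : 0 <= opnorm f.
Proof.
rewrite /opnorm -(normr0 Y) -(linear0 f).
apply: sup_upper_bound; first exact: opnorm_has_sup.
by exists 0 => //=; rewrite normr0.
Qed.

Lemma le_opnorm (f : bop) x : `|f x| <= opnorm f * `|x|.
Proof.
have [->|x0] := eqVneq x 0; first by rewrite linear0 !normr0 mulr0.
rewrite -ler_pdivrMr ?normr_gt0// mulrC.
have -> : `|x|^-1 * `|f x| = `|f (`|x|^-1 *: x)|.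
  by rewrite linearZ normrZ normfV normr_id.
apply: sup_upper_bound; first exact: opnorm_has_sup.
by exists (`|x|^-1 *: x) => //=; rewrite normrZ normfV normr_id mulVf ?normr_eq0.
Qed.

Lemma opnorm_le (f : bop) (M : R) :
  0 <= M -> (forall x, `|f x| <= M * `|x|) -> opnorm f <= M.
Proof.
move=> M0 fM; apply: ge_sup; first by have [] := opnorm_has_sup f.
by move=> _ [x /= x1 <-]; rewrite (le_trans (fM x))// ler_piMr.
Qed.

Lemma opnormD (f g : bop) : opnorm (f + g) <= opnorm f + opnorm g.
Proof.
apply: opnorm_le => [|x]; first by rewrite addr_ge0 ?opnorm_ge0.
by rewrite mulrDl (le_trans (ler_normD _ _))// lerD ?le_opnorm.
Qed.

Lemma opnormZ (a : R) (f : bop) : opnorm (a *: f) = `|a| * opnorm f.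
Proof.
apply/eqP; rewrite eq_le; apply/andP; split.
  apply: opnorm_le => [|x]; first by rewrite mulr_ge0 ?opnorm_ge0.
  have -> : (a *: f) x = a *: f x by [].
  by rewrite normrZ -mulrA ler_wpM2l ?le_opnorm.
have [->|a0] := eqVneq a 0; first by rewrite normr0 mul0r opnorm_ge0.
rewrite -ler_pdivlMl ?normr_gt0//; apply: opnorm_le => [|x].
  by rewrite mulr_ge0 ?invr_ge0 ?opnorm_ge0.
rewrite -mulrA ler_pdivlMl ?normr_gt0// -normrZ.
exact: (le_opnorm (a *: f) x).
Qed.

Lemma opnorm0_eq0 (f : bop) : opnorm f = 0 -> f = 0.
Proof.
move=> f0; apply/val_inj/funext => x; apply/eqP.
by rewrite -normr_le0 (le_trans (le_opnorm f x))// f0 mul0r.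
Qed.

HB.instance Definition _ :=
  Lmodule_isNormed.Build R bop opnormD opnormZ opnorm0_eq0.

End bounded_operators.
Arguments bounded_operator {R} X Y.

Section composition.
Context {R : realType}.

Lemma bop_comp_subproof (X Y Z : normedModType R) (g : bop Y Z) (f : bop X Y) :
  (g \o f : X -> Z) \in bounded_operator X Z.
Proof.
apply/asboolP; split=> [a x y /=|]; first by rewrite !linearP.
exists (opnorm g * opnorm f) => x; rewrite (le_trans (le_opnorm g _))//.
by rewrite -mulrA ler_wpM2l ?opnorm_ge0 ?le_opnorm.
Qed.

Definition bop_comp (X Y Z : normedModType R) (g : bop Y Z) (f : bop X Y) :
  bop X Z := Bop (bop_comp_subproof g f).

Local Notation dual X := (bop X R).

Lemma adjoint_subproof (X Y : normedModType R) (T : bop X Y) :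
  ((fun f => bop_comp f T) : dual Y -> dual X)
    \in bounded_operator (dual Y) (dual X).
Proof.
apply/asboolP; split=> [a f g|]; first exact/val_inj/funext.
exists (opnorm T) => f; apply: opnorm_le => [|x /=].
  by rewrite mulr_ge0 ?opnorm_ge0.
rewrite (le_trans (le_opnorm f _))// [opnorm T * _]mulrC -mulrA.
by rewrite ler_wpM2l ?opnorm_ge0 ?le_opnorm.
Qed.

Definition adjoint (X Y : normedModType R) (T : bop X Y) :
  bop (dual Y) (dual X) := Bop (adjoint_subproof T).

End composition.

(* The library's LspaceType carries no algebraic structure, so L_p(mu) is the
   quotient of the module of p-integrable functions by the a.e. null ones. *)
Section Lp_space.
Context d (T : measurableType d) (R : realType).
Variables (mu : {measure set T -> \bar R}) (p : \bar R) (p1 : (1 <= p)%E).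

Definition ae_null : {pred LfunType mu p1} :=
  [pred f : LfunType mu p1 | `[< (f : T -> R) = cst 0 %[ae mu] >]].

Lemma ae_null_submod_closed : submod_closed ae_null.
Proof.
split; first by apply/asboolP; exact: ae_eq_refl.
move=> a f g /asboolP f0 /asboolP g0; apply/asboolP.
apply: filterS2 f0 g0 => x fx gx _.
have -> : (a *: f + g : LfunType mu p1) x = a * f x + g x by [].
by rewrite fx// gx// mulr0 addr0.
Qed.

HB.instance Definition _ := GRing.isSubmodClosed.Build R (LfunType mu p1)
  ae_null ae_null_submod_closed.

Definition Lp : Type := Quotient.quot ae_null.

HB.instance Definition _ := Choice.on Lp.
HB.instance Definition _ := GRing.Zmodule.on Lp.
HB.instance Definition _ : EqQuotient _ _ Lp := EqQuotient.on Lp.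

Definition Lp_class (f : LfunType mu p1) : Lp := \pi_Lp f.

Lemma Lp_classP (f g : LfunType mu p1) :
  Lp_class f = Lp_class g <-> (f : T -> R) = g %[ae mu].
Proof.
have E : (f - g \in ae_null) = (Lp_class f == Lp_class g).
  exact: Quotient.idealrBE.
split=> [/eqP|fg]; last apply/eqP; rewrite -E.
  move=> /asboolP; apply: filterS => x fg _.
  by apply/eqP; rewrite -subr_eq0; apply/eqP/fg.
apply/asboolP; apply: filterS fg => x fg _.
have -> : (f - g : LfunType mu p1) x = f x - g x by [].
by rewrite fg// subrr.
Qed.

Lemma repr_Lp_class (f : LfunType mu p1) :
  (repr (Lp_class f) : T -> R) = f %[ae mu].
Proof. by apply/Lp_classP; rewrite /Lp_class reprK. Qed.

Lemma Lp_classD : {morph Lp_class : f g / f + g}.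
Proof. exact: Quotient.pi_add. Qed.

Definition Lp_scale (a : R) (x : Lp) : Lp := Lp_class (a *: repr x).

Lemma Lp_scale_class (a : R) f : Lp_scale a (Lp_class f) = Lp_class (a *: f).
Proof.
apply/Lp_classP; apply: filterS (repr_Lp_class f) => x fx _.
have E (h : LfunType mu p1) : (a *: h) x = a * h x by [].
by rewrite !E fx.
Qed.

Lemma Lp_ind (P : Lp -> Prop) : (forall f, P (Lp_class f)) -> forall x, P x.
Proof. by move=> Pf x; rewrite -[x]reprK; exact: Pf. Qed.

Lemma Lp_scaleA a b x : Lp_scale a (Lp_scale b x) = Lp_scale (a * b) x.
Proof. by elim/Lp_ind: x => f; rewrite !Lp_scale_class scalerA. Qed.

Lemma Lp_scale1 : left_id 1 Lp_scale.
Proof. by elim/Lp_ind => f; rewrite Lp_scale_class scale1r. Qed.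

Lemma Lp_scaleDr : right_distributive Lp_scale +%R.
Proof.
move=> a; elim/Lp_ind => f; elim/Lp_ind => g.
by rewrite -Lp_classD !Lp_scale_class scalerDr Lp_classD.
Qed.

Lemma Lp_scaleDl x : {morph Lp_scale^~ x : a b / a + b}.
Proof.
by elim/Lp_ind: x => f a b; rewrite !Lp_scale_class scalerDl Lp_classD.
Qed.

HB.instance Definition _ := GRing.Zmodule_isLmodule.Build R Lp
  Lp_scaleA Lp_scale1 Lp_scaleDr Lp_scaleDl.

Definition Lp_norm (x : Lp) : R := fine 'N[mu]_p[EFin \o repr x].

Lemma Lp_norm_class (f : LfunType mu p1) :
  Lp_norm (Lp_class f) = fine 'N[mu]_p[EFin \o f].
Proof.
rewrite /Lp_norm; have := repr_Lp_class f.
move: (repr _) => g gf; congr fine; rewrite unlock.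
case: p p1 f g gf => [r|//|//] r1 f g gf; last first.
  case: ifPn => // _; apply: eq_ess_sup.
  by apply: filterS gf => x /= gfx; rewrite gfx.
congr (_ `^ _)%E; apply: ge0_ae_eq_integral => //.
1,2: apply/measurable_EFinP;
  apply: (@measurableT_comp _ _ _ _ _ _ (@powR R ^~ r)) => //;
  exact: measurableT_comp.
1,2: by move=> x _; rewrite poweR_ge0.
by apply: filterS gf => x gfx _ /=; rewrite gfx.
Qed.

Lemma Lp_normD x y : Lp_norm (x + y) <= Lp_norm x + Lp_norm y.
Proof.
elim/Lp_ind: x => f; elim/Lp_ind: y => g.
by rewrite -Lp_classD !Lp_norm_class; exact: ler_LnormD.
Qed.

Lemma Lp_normZ (a : R) x : Lp_norm (a *: x) = `|a| * Lp_norm x.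
Proof.
elim/Lp_ind: x => f.
rewrite [_ *: _]Lp_scale_class !Lp_norm_class; apply: EFin_inj.
by rewrite EFinM !finite_norm_fine; exact: LnormZ.
Qed.

Lemma Lp_norm0_eq0 x : Lp_norm x = 0 -> x = 0.
Proof.
elim/Lp_ind: x => f; rewrite Lp_norm_class => /fine_Lnormr_eq0 f0.
have -> : 0 = Lp_class 0.
  by apply: (addrI (Lp_class 0)); rewrite addr0 -Lp_classD addr0.
by apply/Lp_classP.
Qed.

HB.instance Definition _ :=
  Lmodule_isNormed.Build R Lp Lp_normD Lp_normZ Lp_norm0_eq0.

End Lp_space.

Definition L1 d (T : measurableType d) (R : realType)
    (nu : {measure set T -> \bar R}) : normedModType R :=
  Lp nu (@lexx _ _ 1%E).

Section ell2.
Context (R : realType).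

Local Notation count := (@counting nat R).

Definition ell2 : normedModType R := Lp count (lee1n 2).

Lemma Lfun_indic1 (n : nat) : \1_[set n] \in Lfun count 2%:E.
Proof.
rewrite inE; apply/andP; split; rewrite inE //=.
rewrite /finite_norm unlock poweR_lty//.
under eq_integral => k _.
  rewrite /= ger0_norm// indicE.
  have -> : ((k \in [set n])%:R `^ 2 : R) = \1_[set n] k.
    by rewrite indicE; case: (k \in _); rewrite ?powR1 ?powR0.
  over.
rewrite integral_indic// setIT.
by rewrite /= /counting asboolT ?ltry.
Qed.

Definition ell2_basis (n : nat) : ell2 :=
  Lp_class (Lfun_Sub (lee1n 2) (Lfun_indic1 n)).

End ell2.

Section summing.
Context {R : realType}.

Definition weak_norm (p : R) (X : normedModType R) n (x : 'I_n -> X) : R :=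
  sup [set (\sum_(i < n) `|f (x i)| `^ p) `^ p^-1
      | f in [set f : bop X R | `|f| <= 1]].

Definition summing_constant (p : R) (X Y : normedModType R) (T : bop X Y) :
    set R :=
  [set C | 0 <= C /\ forall n (x : 'I_n -> X),
    (\sum_(i < n) `|T (x i)| `^ p) `^ p^-1 <= C * weak_norm p x].

Definition summing (p : R) (X Y : normedModType R) (T : bop X Y) : Prop :=
  exists C, summing_constant p T C.

(* +oo when T is not p-summing *)
Definition summing_norm (p : R) (X Y : normedModType R) (T : bop X Y) :
    \bar R :=
  ereal_inf [set C%:E | C in summing_constant p T].

Definition finite_rank (X Y : normedModType R) (T : bop X Y) : Prop :=
  exists n (y : 'I_n -> Y), forall x, exists c : 'I_n -> R,
    T x = \sum_(i < n) c i *: y i.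

Definition factors_through_L1 (X Y : normedModType R) (T : bop X Y) : Prop :=
  exists (d : measure_display) (M : measurableType d)
    (nu : {measure set M -> \bar R}) (A : bop X (L1 nu)) (B : bop (L1 nu) Y),
    T = bop_comp B A.

End summing.

Section vector_valued_L2.
Context d (Omega : measurableType d) (R : realType).
Variables (mu : {measure set Omega -> \bar R}) (X : normedModType R).

Definition simple_function (s : Omega -> X) : Prop :=
  finite_set (range s) /\ forall x, measurable (s @^-1` [set x]).

Definition strongly_measurable (S : Omega -> X) : Prop :=
  exists s : nat -> Omega -> X,
    (forall n, simple_function (s n)) /\ forall t, s n t @[n --> \oo] --> S t.

Definition L2_norm (S : Omega -> X) : \bar R :=
  'N[mu]_2%:E[EFin \o (Num.norm \o S)].

Definition L2_cvg (u : nat -> Omega -> X) (S : Omega -> X) : Prop :=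
  strongly_measurable S /\
  L2_norm (fun t => u n t - S t) @[n --> \oo] --> 0%E.

(* An L_2(mu, X)-limit of u, unique up to a.e. equality; a junk value if u
   does not converge. *)
Definition L2_lim (u : nat -> Omega -> X) : Omega -> X :=
  get [set S | L2_cvg u S].

End vector_valued_L2.

Section gaussian.
Context d (Omega : measurableType d) (R : realType) (mu : probability Omega R).

Definition independent (g : nat -> {RV mu >-> R}) : Prop :=
  forall (J : {fset nat}) (A : nat -> set R), (forall i, measurable (A i)) ->
    mu (\bigcap_(i in [set` J]) (g i @^-1` A i)) =
    (\prod_(i <- J) mu (g i @^-1` A i))%E.

Definition standard_gaussian (g : {RV mu >-> R}) : Prop :=
  forall A : set R, measurable A -> distribution mu g A = normal_prob 0 1 A.

Definition gaussian_sequence (g : nat -> {RV mu >-> R}) : Prop :=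
  independent g /\ forall n, standard_gaussian (g n).

Definition ell_norm (g : nat -> {RV mu >-> R}) (X : normedModType R)
    (T : bop (ell2 R) X) : \bar R :=
  L2_norm mu (L2_lim mu (fun N t => \sum_(n < N) g n t *: T (ell2_basis R n))).

Definition GAP (g : nat -> {RV mu >-> R}) (X : normedModType R) : Prop :=
  exists K : R, forall T : bop (ell2 R) X, finite_rank T ->
    (ell_norm g T <= K%:E * summing_norm 1 (adjoint T))%E.

End gaussian.

Section properties.
Context {R : realType} (X : normedModType R).

(* The adjoint takes values in the dual of ell2, to which ell2 is canonically
   isometric; p-summing norms do not see the identification. *)
Definition property_Sp (p : R) : Prop :=
  exists K : R, forall T : bop (ell2 R) X, summing 1 (adjoint T) ->
    summing p T /\
    (summing_norm p T <= K%:E * summing_norm 1 (adjoint T))%E.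

Definition property_S : Prop := exists2 p : R, 1 <= p & property_Sp p.

Definition GL2 : Prop :=
  forall T : bop X (ell2 R), summing 1 T -> factors_through_L1 T.

(* Rademacher averages are taken over all choices of n signs. *)
Definition cotype (q : R) : Prop :=
  exists K : R, forall n (x : 'I_n -> X),
    (\sum_(i < n) `|x i| `^ q) `^ q^-1 <=
    K * Num.sqrt (2 ^- n * \sum_(e : {ffun 'I_n -> bool})
                            `|\sum_(i < n) (-1) ^+ e i *: x i| ^+ 2).

Definition finite_cotype : Prop := exists2 q : R, 2 <= q & cotype q.

End properties.

(* Main.v *)
Require Import Defs.
From HB Require Import structures.
From mathcomp Require Import all_boot all_order all_algebra finmap.
From mathcomp Require Import all_classical all_reals all_analysis.
From mathcomp Require Import measurable_realfun ring lra.
Set Implicit Arguments.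
Unset Strict Implicit.
Unset Printing Implicit Defensive.
Import Order.TTheory GRing.Theory Num.Theory.
Import numFieldNormedType.Exports.
Import HBSimple HBNNSimple.
Local Open Scope classical_set_scope.
Local Open Scope ring_scope.

(* (ii) For T = sum_i e_i (x) x_i Khinchine's inequality bounds pi_1(T^* ) by
   2 (E|sum_i eps_i x_i|^2)^(1/2), and pi_p(T) controls the norms of the
   T e_i = x_i.
   (iv) Let X have cotype q. By Pisier's argument an operator l_oo^n -> X obeys
   |w psi|^q <= delta + C lam(|psi|), |psi| <= 1, for a positive functional lam,
   hence is 2q-summing, with constants independent of n. GL_2 is made
   quantitative by a gliding hump, and approximating the factorisation by simple
   functions gives the trace duality |tr(v T)| <= K pi_1(v) pi_1(T^* ). Testing
   it on v = sum_i l_i f_i (x) x_i, with f_i norming T x_i, shows that T is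
   2q-summing.
   (i) The sums sum_n g_n f(e_n), |f| <= 1, have uniformly bounded moments, by
   the exponential moments of a Gaussian. A q-summing T transfers such bounds to
   sum_n g_n T e_n, by applying the definition of pi_q to simple functions.
   (iii) Let the Gaussian tail beyond the level s be about 1/n. On the event
   that g_i alone exceeds s, the norm of sum_j g_j x_j is on average at least
   s|x_i|, so its mean is at least (c s / n) sum_i |x_i|. GAP bounds it by
   C (E|sum_i eps_i x_i|^2)^(1/2), and for s large
   sum_i |x_i|^2 <= (n / 2) E|sum_i eps_i x_i|^2.
   Iterating over n^k vectors improves 1/2 to 2^(-k), which is finite cotype. *)

(** In (iv) the exponent doubles because Pisier's inequality is of weak type: it controls a power of
    [|w psi|] by the first power of [|psi|], and its sum over dyadic levels converges only against a
    larger power. [GL2] is qualitative, while the trace estimate needs one constant for all finite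
    families; so would-be counterexamples are stacked, with geometric weights, into a single
    operator into [ell2]. In (iii) [GAP] enters only as a bound of Gaussian averages by a fixed
    multiple of Rademacher averages; the level [s] is free, and taken large it beats that multiple.
    In (i) [ell_norm] has a meaning only once the Gaussian series is known to converge, since
    [L2_lim] is a choice; finite rank reduces convergence to scalar series. Summing norms are infima
    in the extended reals, so estimates are proved for each admissible constant, with a positive
    slack that disappears at the end. [X] carries no measurable structure, so vector-valued
    integrals pass through finite measurable partitions. *)

Section hahn_banach.
Context {R : realType} (X : normedModType R).

(** Partial linear functionals below the norm, encoded by their graphs for Zorn's lemma. The value
    at [x0] is prescribed for nonempty graphs only, because the union of the empty chain must
    qualify. *)
Definition dominated_graph (x0 : X) (G : set (X * R)) : Prop :=
  [/\ forall a u v, G u -> G v -> G (a *: u.1 + v.1, a * u.2 + v.2),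
      forall u, G u -> u.2 <= `|u.1| &
      G !=set0 -> G (x0, `|x0|)].

Lemma dominated_graph_fun x0 G x r s :
  dominated_graph x0 G -> G (x, r) -> G (x, s) -> r = s.
Proof.
move=> [lin dom _].
suff le a b : G (x, a) -> G (x, b) -> a <= b.
  by move=> xr xs; apply/eqP; rewrite eq_le !le.
move=> xa xb; have /dom /= := lin (-1) _ _ xb xa.
by rewrite scaleN1r addNr normr0 mulN1r; lra.
Qed.

(** The one-dimensional step of Hahn-Banach. By the triangle inequality each lower bound
    [u.2 - |u.1 - y|] for the value at [y] is below each upper bound [|v.1 + y| - v.2]; the supremum
    [c] of the former serves. *)
Lemma dominated_graph_extend x0 G y : dominated_graph x0 G -> G !=set0 ->
  (forall r, ~ G (y, r)) -> exists2 H, dominated_graph x0 H & G `<` H.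
Proof.
move=> Gd Gn0 Gy; have [lin dom base] := Gd.
have Gx0 := base Gn0.
have G0 : G (0, 0).
  by have := lin (-1) _ _ Gx0 Gx0; rewrite /= scaleN1r addNr mulN1r addNr.
pose low := [set u.2 - `|u.1 - y| | u in G].
have lowub v : G v -> ubound low (`|v.1 + y| - v.2).
  move=> Gv _ [u Gu <-]; rewrite lerBlDr addrAC lerBrDr.
  have /dom /= := lin 1 _ _ Gu Gv; rewrite scale1r mul1r => /le_trans; apply.
  rewrite (_ : u.1 + v.1 = (u.1 - y) + (v.1 + y)); last by rewrite addrACA addNr addr0.
  by rewrite (le_trans (ler_normD _ _))// addrC.
have lown0 : low !=set0 by exists (0 - `|0 - y|), (0, 0).
have hs : has_sup low by split=> //; exists (`|0 + y| - 0); exact: (lowub (0, 0)).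
pose c := sup low.
have cge u : G u -> u.2 - c <= `|u.1 - y|.
  by move=> Gu; rewrite lerBlDr -lerBlDl; apply: sup_upper_bound => //; exists u.
have cle v : G v -> v.2 + c <= `|v.1 + y|.
  by move=> Gv; rewrite addrC -lerBrDr; apply: ge_sup => //; exact: lowub.
have scl a u : G u -> G (a *: u.1, a * u.2).
  by move=> Gu; have := lin a _ _ Gu G0; rewrite /= !addr0.
pose H := [set w : X * R | exists u t, G u /\ w = (u.1 + t *: y, u.2 + t * c)].
have GH : G `<=` H.
  by move=> [x r] Gu; exists (x, r), 0; split=> //; rewrite scale0r mul0r !addr0.
exists H; last first.
  split=> // HG; apply: (Gy c); apply: HG; exists (0, 0), 1.
  by rewrite /= scale1r mul1r !add0r.
split=> [a _ _ [u [s [Gu ->]]] [v [t [Gv ->]]]|_ [u [t [Gu ->]]]|_].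
- exists (a *: u.1 + v.1, a * u.2 + v.2), (a * s + t); split; first exact: lin.
  by rewrite /= !scalerDr !scalerDl scalerA addrACA; congr (_, _); ring.
(* Division by [|t|] leaves only the coefficients [1] and [-1] of [y], which are [cle] and [cge]. *)
- rewrite /=; have [t0|t0|->] := ltgtP t 0; last first.
  + by rewrite scale0r mul0r !addr0; exact: dom.
  + have /cle /= := scl t^-1 _ Gu.
    rewrite -(ler_pM2l t0) mulrDr mulVKf ?gt_eqF//.
    rewrite -{2}(gtr0_norm t0) -normrZ scalerDr scalerA.
    by rewrite divff ?gt_eqF// scale1r.
  + have /cge /= := scl (- t^-1) _ Gu.
    have t0' : 0 < - t by rewrite oppr_gt0.
    rewrite -(ler_pM2l t0') -{2}(gtr0_norm t0') -normrZ scalerBr scalerA mulrNN.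
    rewrite divff ?lt_eqF// scale1r scaleNr opprK mulrBr mulrA mulrNN.
    by rewrite divff ?lt_eqF// mul1r mulNr opprK.
- by apply: GH.
Qed.

Lemma norming_functional (x0 : X) :
  exists f : bop X R, `|f| <= 1 /\ f x0 = `|x0|.
Proof.
have [|G [Gd Gmax]] := @Zorn_bigcup _ (dominated_graph x0).
- move=> F FP Ftot; split=> [a u v [A FA Au] [B FB Bv]|u [A FA Au]|].
  + have [AB|BA] := Ftot _ _ FA FB.
      exists B => //; have [lin _ _] := FP _ FB; apply: lin => //; exact: AB.
    exists A => //; have [lin _ _] := FP _ FA; apply: lin => //; exact: BA.
  + by have [_ dom _] := FP _ FA; exact: dom.
  + move=> [u [A FA Au]]; exists A => //; have [_ _ base] := FP _ FA.
    by apply: base; exists u.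
(* Maximality excludes the empty graph, since the line through [(x0, |x0|)] is a larger one. *)
have Gn0 : G !=set0.
  apply/set0P/eqP => G0; move: Gmax; rewrite G0.
  move=> /(_ [set u | exists a, u = (a *: x0, a * `|x0|)]); apply.
    split=> [u //|/(_ (x0, `|x0|))]; apply; exists 1.
    by rewrite scale1r mul1r.
  split=> [a _ _ [b ->] [b' ->]|_ [a ->]|_].
  + by exists (a * b + b'); rewrite /= scalerDl scalerA mulrDl mulrA.
  + by rewrite /= normrZ ler_wpM2r// ler_norm.
  + by exists 1; rewrite scale1r mul1r.
have tot y : exists r, G (y, r).
  apply: contrapT => /forallNP Gy.
  by have [H Hd GH] := dominated_graph_extend Gd Gn0 Gy; exact: Gmax GH Hd.
have [lin dom base] := Gd.
pose f y := sval (cid (tot y)).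
have Gf y : G (y, f y) by rewrite /f; case: cid.
have fE y r : G (y, r) -> f y = r by move=> yr; exact: (dominated_graph_fun Gd (Gf y) yr).
have fl : linear f.
  by move=> a u v; apply: fE; have := lin a _ _ (Gf u) (Gf v).
have fb y : `|f y| <= `|y|.
  rewrite ler_norml; apply/andP; split; last exact: (dom _ (Gf y)).
  have := dom _ (lin (-1) _ _ (Gf y) (Gf 0)).
  rewrite /= scaleN1r mulN1r (fE 0 0) ?addr0 ?normrN; first by rewrite lerNl.
  by have := lin (-1) _ _ (Gf 0) (Gf 0); rewrite /= scaleN1r addNr mulN1r addNr.
have fB : f \in bounded_operator X R.
  by apply/asboolP; split=> //; exists 1 => y; rewrite mul1r.
exists (Bop fB); split; last by apply: fE; exact: base.
by apply: opnorm_le => // y; rewrite mul1r; exact: fb.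
Qed.

End hahn_banach.

(** * Averages over signs, contraction and Khinchine's inequality *)

Section rademacher.
Context {R : realType}.
Implicit Types I J : finType.

Definition rmean I (F : {ffun I -> bool} -> R) : R := 2 ^- #|I| * \sum_e F e.

(** Multiplication of sign vectors, written on exponents. Invariance of the mean under it replaces
    independence of the signs. *)
Definition flip I (h e : {ffun I -> bool}) : {ffun I -> bool} :=
  [ffun i => h i (+) e i].

Lemma flipK I (h : {ffun I -> bool}) : involutive (flip h).
Proof. by move=> e; apply/ffunP => i; rewrite !ffunE addKb. Qed.

Lemma rmean_flip I h (F : {ffun I -> bool} -> R) :
  rmean (fun e => F (flip h e)) = rmean F.
Proof.
rewrite /rmean; congr (_ * _).
by rewrite [RHS](reindex_inj (can_inj (flipK h))).
Qed.

Lemma rmean_cst I (c : R) : rmean (fun _ : {ffun I -> bool} => c) = c.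
Proof.
rewrite /rmean sumr_const card_ffun card_bool -[c *+ _]mulr_natr natrX mulrCA.
by rewrite mulVf ?mulr1// expf_neq0.
Qed.

Lemma rmeanD I (F G : {ffun I -> bool} -> R) :
  rmean (fun e => F e + G e) = rmean F + rmean G.
Proof. by rewrite /rmean big_split mulrDr. Qed.

Lemma rmeanZ I c (F : {ffun I -> bool} -> R) :
  rmean (fun e => c * F e) = c * rmean F.
Proof. by rewrite /rmean -big_distrr mulrCA. Qed.

Lemma eq_rmean I (F G : {ffun I -> bool} -> R) : F =1 G -> rmean F = rmean G.
Proof. by move=> FG; rewrite /rmean; under eq_bigr do rewrite FG. Qed.

Lemma ler_rmean I (F G : {ffun I -> bool} -> R) :
  (forall e, F e <= G e) -> rmean F <= rmean G.
Proof.
by move=> FG; rewrite ler_wpM2l ?invr_ge0 ?exprn_ge0// ler_sum.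
Qed.

Lemma rmean_sum I (T : Type) (r : seq T) (F : T -> {ffun I -> bool} -> R) :
  rmean (fun e => \sum_(k <- r) F k e) = \sum_(k <- r) rmean (F k).
Proof. by rewrite /rmean exchange_big/= big_distrr. Qed.

Lemma rmean_ge0 I (F : {ffun I -> bool} -> R) :
  (forall e, 0 <= F e) -> 0 <= rmean F.
Proof. by move=> F0; rewrite -(rmean_cst I 0); exact: ler_rmean. Qed.

Lemma rmean_exchange I J (F : {ffun I -> bool} -> {ffun J -> bool} -> R) :
  rmean (fun e => rmean (F e)) = rmean (fun h => rmean (F ^~ h)).
Proof.
by rewrite /rmean -!big_distrr/= exchange_big/= mulrCA.
Qed.

(* Averaging over the sign changes that extend those of J leaves the mean
   over I invariant and turns the integrand into a constant. *)
Lemma rmean_restrict I J (s : J -> I) (F : {ffun J -> bool} -> R) :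
  injective s -> rmean (fun e : {ffun I -> bool} => F [ffun j => e (s j)]) =
  rmean F.
Proof.
move=> sI; set G := fun e => _.
pose ext (h : {ffun J -> bool}) : {ffun I -> bool} :=
  [ffun i => if [pick j | s j == i] is Some j then h j else false].
have extE h j : ext h (s j) = h j.
  rewrite ffunE; case: pickP => [k /eqP/sI->//|/(_ j)]; by rewrite eqxx.
rewrite -[LHS](rmean_cst J).
transitivity (rmean (fun h => rmean (fun e => G (flip (ext h) e)))).
  by apply: eq_rmean => h; rewrite rmean_flip.
rewrite rmean_exchange -[RHS](rmean_cst I); apply: eq_rmean => e.
rewrite -[RHS](rmean_flip [ffun j => e (s j)]); apply: eq_rmean => h.
rewrite /G; congr F; apply/ffunP => j.
rewrite [LHS]ffunE [LHS]ffunE extE [RHS]ffunE addbC; congr (_ (+) _).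
by rewrite ffunE.
Qed.

Definition flip1 I (i : I) : {ffun I -> bool} -> {ffun I -> bool} :=
  flip [ffun j => j == i].

(** Pairing [e] with its flip at [i] makes terms odd in the [i]-th sign cancel. *)
Lemma rmean_flip1 I (i : I) (F : {ffun I -> bool} -> R) :
  rmean F = 2^-1 * rmean (fun e => F e + F (flip1 i e)).
Proof. by rewrite rmeanD (rmean_flip _ F); field. Qed.

Section vectors.
Context (X : normedModType R).

Definition rsum I (x : I -> X) (e : {ffun I -> bool}) : X :=
  \sum_i (-1) ^+ e i *: x i.

Definition rad2 I (x : I -> X) : R := rmean (fun e => `|rsum x e| ^+ 2).

Lemma rad2_ge0 I (x : I -> X) : 0 <= rad2 x.
Proof. by apply: rmean_ge0 => e; rewrite exprn_ge0. Qed.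

Lemma rsum_flip1 I (x : I -> X) i e :
  rsum x (flip1 i e) = rsum x e - 2 *: ((-1) ^+ e i *: x i).
Proof.
rewrite /rsum (bigD1 i)//= [in RHS](bigD1 i)//= !ffunE eqxx.
rewrite addrAC; congr (_ + _); last first.
  by apply: eq_bigr => j /negPf ji; rewrite !ffunE ji.
by case: (e i); rewrite /= !(expr1, expr0) !scaleN1r !scale1r scaler_nat mulr2n
  ?opprD ?opprK ?addrA ?addNr ?subrr ?add0r.
Qed.

(** A flip at [i] moves the signed sum by [2 x_i] up to sign; the triangle inequality and convexity
    of the square conclude for each pair. *)
Lemma le_rad2 I (x : I -> X) i : `|x i| ^+ 2 <= rad2 x.
Proof.
rewrite /rad2 (rmean_flip1 i) -[leLHS](rmean_cst I) -rmeanZ.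
apply: ler_rmean => e; rewrite rsum_flip1.
set a := rsum x e; set b := _ *: x i.
have -> : `|x i| = `|b| by rewrite normrZ normrX normrN1 expr1n mul1r.
have : `|2 *: b| <= `|a| + `|a - 2 *: b|.
  have /le_trans := ler_normB a (a - 2 *: b).
  by rewrite subKr; apply.
rewrite normrZ ger0_norm//.
have := normr_ge0 a; have := normr_ge0 (a - 2 *: b); have := normr_ge0 b.
move: `|a| `|b| `|_ - _| => p q r q0 r0 p0 h.
have : (2 * q) ^+ 2 <= (p + r) ^+ 2 by rewrite lerXn2r ?nnegrE; lra.
have : 0 <= (p - r) ^+ 2 by rewrite sqr_ge0.
by rewrite !expr2; lra.
Qed.

(** Extra signs, constant on each row of [I * J], leave the mean unchanged. For fixed [e], [hI]
    applies to the signed row sums; then [hJ] applies to each row. The constants multiply, which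
    permits iteration. *)
Lemma rad2_prod I J (c d : R) : 0 <= c -> 0 <= d ->
  (forall x : I -> X, \sum_i `|x i| ^+ 2 <= c * rad2 x) ->
  (forall x : J -> X, \sum_j `|x j| ^+ 2 <= d * rad2 x) ->
  forall x : I * J -> X, \sum_k `|x k| ^+ 2 <= (c * d) * rad2 x.
Proof.
move=> c0 d0 hI hJ x.
pose y (e : {ffun I * J -> bool}) i := \sum_j (-1) ^+ e (i, j) *: x (i, j).
have yE e (h : {ffun I -> bool}) :
    rsum x (flip [ffun k : I * J => h k.1] e) = rsum (y e) h.
  rewrite /rsum; transitivity (\sum_i \sum_j
      (-1) ^+ (flip [ffun k : I * J => h k.1] e) (i, j) *: x (i, j)).
    by rewrite pair_bigA; apply: eq_bigr => -[].
  apply: eq_bigr => i _; rewrite /y scaler_sumr; apply: eq_bigr => j _.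
  by rewrite !ffunE/= scalerA -signr_addb.
have -> : rad2 x = rmean (fun e => rad2 (y e)).
  rewrite /rad2 -[LHS](rmean_cst I).
  transitivity (rmean (fun h : {ffun I -> bool} => rmean (fun e =>
    `|rsum x (flip [ffun k : I * J => h k.1] e)| ^+ 2))).
    apply: eq_rmean => h.
    exact: esym (rmean_flip _ (fun e => `|rsum x e| ^+ 2)).
  by rewrite rmean_exchange; apply: eq_rmean => e; apply: eq_rmean => h; rewrite yE.
rewrite mulrAC -rmeanZ.
apply: (@le_trans _ _ (rmean (fun e => \sum_i `|y e i| ^+ 2) * d)); last first.
  by rewrite ler_wpM2r//; apply: ler_rmean => e; exact: hI.
rewrite (_ : \sum_k _ = \sum_i \sum_j `|x (i, j)| ^+ 2); last first.
  by rewrite pair_bigA; apply: eq_bigr => -[].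
rewrite rmean_sum mulrC big_distrr/=.
apply: ler_sum => i _; apply: le_trans (hJ (fun j => x (i, j))) _.
rewrite ler_wpM2l// /rad2 -[leLHS](rmean_restrict (s := fun j => (i, j))).
  apply: ler_rmean => e; rewrite /rsum /y.
  by under eq_bigr do rewrite ffunE.
by move=> j k [].
Qed.

(** Flipping the signs on the range of [s] turns [a + b] into [b - a], where [a] is the partial sum;
    [2 |a| <= |a + b| + |b - a|] and convexity finish. *)
Lemma rad2_inj I J (s : J -> I) (x : I -> X) : injective s ->
  rad2 (x \o s) <= rad2 x.
Proof.
move=> sI; rewrite /rad2 -[leLHS](rmean_restrict _ sI).
pose h : {ffun I -> bool} := [ffun i => i \in codom s].
have -> : rmean (fun e => `|rsum x e| ^+ 2) =
    2^-1 * rmean (fun e => `|rsum x e| ^+ 2 + `|rsum x (flip h e)| ^+ 2).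
  by rewrite rmeanD (rmean_flip _ (fun e => `|rsum x e| ^+ 2)); field.
rewrite -rmeanZ; apply: ler_rmean => e.
set a := rsum _ _.
have aE : a = \sum_(i in codom s) (-1) ^+ e i *: x i.
  rewrite -big_uniq; last by rewrite /codom /image_mem map_inj_uniq ?enum_uniq.
  rewrite /codom big_image /a /rsum.
  by apply: eq_bigr => j _; rewrite ffunE.
pose b := \sum_(i | i \notin codom s) (-1) ^+ e i *: x i.
have -> : rsum x e = a + b by rewrite aE /rsum (bigID (mem (codom s))).
have -> : rsum x (flip h e) = b - a.
  rewrite /rsum (bigID (mem (codom s)))/= addrC; congr (_ + _).
    by apply: eq_bigr => i /negPf ic; rewrite !ffunE ic.
  rewrite aE -sumrN; apply: eq_bigr => i ic.
  by rewrite !ffunE ic addTb signrN scaleNr.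
have : 2 * `|a| <= `|a + b| + `|b - a|.
  rewrite -[X in X * _]ger0_norm// -normrZ distrC.
  rewrite (_ : 2 *: a = (a + b) + (a - b)) ?ler_normD//.
  by rewrite scaler_nat mulr2n addrACA subrr addr0.
have := normr_ge0 (a + b); have := normr_ge0 (b - a); have := normr_ge0 a.
move: `|a| `|a + b| `|b - a| => q p r q0 r0 p0 hq {aE}.
have : (2 * q) ^+ 2 <= (p + r) ^+ 2 by rewrite lerXn2r ?nnegrE; lra.
have : 0 <= (p - r) ^+ 2 by rewrite sqr_ge0.
by rewrite !expr2; lra.
Qed.

End vectors.

Section khinchine.
Context (I : finType) (a : I -> R).

Let S (r : seq I) (e : {ffun I -> bool}) := \sum_(i <- r) (-1) ^+ e i * a i.

Lemma rmean_sqr r : uniq r ->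
  rmean (fun e => S r e ^+ 2) = \sum_(i <- r) a i ^+ 2.
Proof.
elim: r => [_|i r IH /= /andP[ir ur]].
  by rewrite -[RHS](rmean_cst I) big_nil; apply: eq_rmean => e; rewrite /S big_nil expr0n.
rewrite big_cons -IH// (rmean_flip1 i) -[a i ^+ 2](rmean_cst I) -rmeanD -rmeanZ.
apply: eq_rmean => e; rewrite /S !big_cons.
rewrite [X in _ + (_ + X) ^+ 2](_ : _ = S r e); last first.
  rewrite /S big_seq [RHS]big_seq; apply: eq_bigr => j jr; rewrite !ffunE.
  by case: eqVneq jr ir => // -> ->.
rewrite !ffunE eqxx addTb signrN /S.
move: (\sum_(_ <- _) _) => t.
by case: (e i); rewrite /= ?expr1 ?expr0; field.
Qed.

(** Pairing kills the odd powers of the new sign and leaves [t^4 + 6 a_i^2 t^2 + a_i^4], whose cross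
    term is that of [3 (s + a_i^2)^2]. *)
Lemma rmean_pow4 r : uniq r ->
  rmean (fun e => S r e ^+ 4) <= 3 * (\sum_(i <- r) a i ^+ 2) ^+ 2.
Proof.
elim: r => [_|i r IH /= /andP[ir ur]].
  rewrite big_nil expr0n/= mulr0 -[leRHS](rmean_cst I).
  by apply: ler_rmean => e; rewrite /S big_nil expr0n.
have E : rmean (fun e => S (i :: r) e ^+ 4) =
    rmean (fun e => S r e ^+ 4) + 6 * a i ^+ 2 * rmean (fun e => S r e ^+ 2) + a i ^+ 4.
  rewrite (rmean_flip1 i) -[a i ^+ 4](rmean_cst I) -!rmeanZ -!rmeanD.
  apply: eq_rmean => e; rewrite /S !big_cons.
  rewrite [X in _ + (_ + X) ^+ 4](_ : _ = S r e); last first.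
    rewrite /S big_seq [RHS]big_seq; apply: eq_bigr => j jr; rewrite !ffunE.
    by case: eqVneq jr ir => // -> ->.
  rewrite !ffunE eqxx addTb signrN /S.
  move: (\sum_(_ <- _) _) => t.
  by case: (e i); rewrite /= ?expr1 ?expr0; field.
rewrite E rmean_sqr// big_cons; have := IH ur.
set s := \sum_(_ <- _) _; move: (rmean _) => m ms.
have -> : a i ^+ 4 = (a i ^+ 2) ^+ 2 by rewrite -exprM.
move: s (a i ^+ 2) ms => s b ms; have := sqr_ge0 b.
have -> : 3 * (b + s) ^+ 2 = 3 * s ^+ 2 + 6 * b * s + 3 * b ^+ 2 by ring.
lra.
Qed.

(* From [u >= u^2 - 4/27 u^4] and the bound on the fourth moment. *)
Lemma khinchine : Num.sqrt (\sum_i a i ^+ 2) <=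
  2 * rmean (fun e => `|\sum_i (-1) ^+ e i * a i|).
Proof.
pose v := \sum_i a i ^+ 2; pose s := Num.sqrt v.
have s2 : rmean (fun e => S (index_enum I) e ^+ 2) = v.
  exact: rmean_sqr (index_enum_uniq I).
have s4 : rmean (fun e => S (index_enum I) e ^+ 4) <= 3 * v ^+ 2.
  exact: rmean_pow4 (index_enum_uniq I).
rewrite -/v -/s.
have v0 : 0 <= v by apply: sumr_ge0 => j _; rewrite sqr_ge0.
have vs : v = s ^+ 2 by rewrite sqr_sqrtr.
have [->|sn0] := eqVneq s 0.
  by apply: mulr_ge0 => //; apply: rmean_ge0 => e.
have s0 : 0 < s by rewrite lt_def sn0 sqrtr_ge0.
have : s ^+ 2 * v <= s ^+ 3 * rmean (fun e => `|S (index_enum I) e|) + 4 / 27 * (3 * v ^+ 2).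
  apply: (@le_trans _ _ (s ^+ 3 * rmean (fun e => `|S (index_enum I) e|) +
     4 / 27 * rmean (fun e => S (index_enum I) e ^+ 4))); last by rewrite lerD2l ler_wpM2l.
  rewrite -[in leLHS]s2 -!rmeanZ -rmeanD; apply: ler_rmean => e.
  have := normr_ge0 (S (index_enum I) e).
  have -> : S (index_enum I) e ^+ 4 = (S (index_enum I) e ^+ 2) ^+ 2 by rewrite -exprM.
  rewrite -(real_normK (num_real (S _ e))).
  move: `|_| => u u0; rewrite -subr_ge0.
  (* The constant [4/27] produces the double root [u = 3 s / 2]; with the fourth moment it leaves
     [5/9 s <= m]. *)
  have -> : s ^+ 3 * u + 4 / 27 * (u ^+ 2) ^+ 2 - s ^+ 2 * u ^+ 2 =
     u / 27 * ((2 * u - 3 * s) ^+ 2 * (u + 3 * s)) by field.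
  apply: mulr_ge0; first by rewrite divr_ge0.
  apply: mulr_ge0; first exact: sqr_ge0.
  by rewrite addr_ge0// mulr_ge0// ltW.
rewrite -/S; move: (rmean _) => m; rewrite vs.
rewrite (_ : s ^+ 2 * s ^+ 2 = s ^+ 3 * s); last by ring.
rewrite (_ : 4 / 27 * (3 * (s ^+ 2) ^+ 2) = s ^+ 3 * (4 / 9 * s)); last by field.
by rewrite -mulrDr ler_pM2l ?exprn_gt0//; lra.
Qed.

End khinchine.

End rademacher.

Lemma functionalZ {R : realType} (X : normedModType R) (f : bop X R) a x :
  f (a *: x) = a * f x.
Proof. exact: linearZ. Qed.

(** * Coordinates in [ell2] *)

Section ell2_coordinates.
Context {R : realType}.
Local Notation ell2 := (ell2 R).
Local Notation count := (@counting nat R).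

(** Only the empty set is null for counting, so representatives of a class agree everywhere and
    [coord] depends on the class alone. *)
Lemma ae_counting (P : nat -> Prop) :
  (\forall x \ae count, P x) -> forall x, P x.
Proof.
move=> [A [_ A0 PA]] x; apply: contrapT => Px.
have Ax : A x by apply: PA.
move: A0; rewrite /= /counting; case: ifPn => [/asboolP finA|_ //].
move=> /eqP; rewrite eqe pnatr_eq0 cardfs_eq0 => /eqP A0.
have : x \in fset_set A by rewrite in_fset_set// inE.
by rewrite A0 inE.
Qed.

Definition coord (k : nat) (x : ell2) : R := repr x k.

Lemma coord_class k f : coord k (Lp_class f) = f k.
Proof.
by have /ae_counting/(_ k) := repr_Lp_class f; apply.
Qed.

Lemma coord_is_linear k : linear (coord k : ell2 -> R).
Proof.
move=> a x y; elim/Lp_ind: x => f; elim/Lp_ind: y => h.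
have -> : a *: Lp_class f + Lp_class h = Lp_class (a *: f + h) :> ell2.
  by rewrite Lp_classD -Lp_scale_class.
by rewrite !coord_class.
Qed.

HB.instance Definition _ k :=
  GRing.isLinear.Build R ell2 R *:%R (coord k) (coord_is_linear k).

Lemma coordZ k a x : coord k (a *: x) = a * coord k x.
Proof. exact: linearZ. Qed.

Lemma ell2_normE (x : ell2) :
  (`|x| ^+ 2)%:E = (\sum_(k <oo) (coord k x ^+ 2)%:E)%E.
Proof.
have xE : `|x|%:E = 'N[count]_2%:E[EFin \o repr x]%E.
  exact: finite_norm_fine.
rewrite Lnorm_counting// in xE.
transitivity (\sum_(k <oo) (`|(EFin \o repr x) k| `^ 2))%E; last first.
  apply: eq_eseriesr => k _ /=.
  by rewrite -[2]/(2%:R) powR_mulrn// real_normK// num_real.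
set s := (\sum_(k <oo) _)%E in xE *.
have : (0 <= s)%E by apply: nneseries_ge0 => k _ _; rewrite poweR_ge0.
case: s xE => [r||] xE //.
  rewrite lee_fin => r0.
  by move: xE; rewrite poweR_EFin powR12_sqrt// => -[->]; rewrite sqr_sqrtr.
by move: xE; rewrite poweRyr ?invr_eq0.
Qed.

Lemma sum_coord_le (x : ell2) n : \sum_(k < n) coord k x ^+ 2 <= `|x| ^+ 2.
Proof.
rewrite -lee_fin ell2_normE -sumEFin.
rewrite -(big_mkord predT (fun k => (coord k x ^+ 2)%:E)).
by apply: nneseries_lim_ge => k _; rewrite lee_fin sqr_ge0.
Qed.

Lemma sum_coord_cvg (x : ell2) (e : R) : 0 < e ->
  exists n, `|x| ^+ 2 - e < \sum_(k < n) coord k x ^+ 2.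
Proof.
move=> e0; apply: contrapT => /forallNP H.
have : (\sum_(k <oo) (coord k x ^+ 2)%:E <= (`|x| ^+ 2 - e)%:E)%E.
  apply: lime_le; first by apply: is_cvg_nneseries => k _ _; rewrite lee_fin sqr_ge0.
  apply: nearW => n; rewrite big_mkord sumEFin lee_fin.
  by have /negP := H n; rewrite -leNgt.
by rewrite -ell2_normE lee_fin lerBrDr; move: e0; lra.
Qed.

Lemma ell2_of_coord (c : nat -> R) (M : R) : 0 <= M ->
  (forall n, \sum_(k < n) c k ^+ 2 <= M ^+ 2) ->
  exists2 x : ell2, `|x| <= M & forall k, coord k x = c k.
Proof.
move=> M0 cM.
have le : (\sum_(k <oo) (c k ^+ 2)%:E <= (M ^+ 2)%:E)%E.
  apply: lime_le; first by apply: is_cvg_nneseries => k _ _; rewrite lee_fin sqr_ge0.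
  by apply: nearW => n; rewrite big_mkord sumEFin lee_fin.
have cL : c \in Lfun count 2%:E.
  rewrite inE; apply/andP; split; rewrite inE //=.
  rewrite /finite_norm Lnorm_counting// poweR_lty//.
  rewrite (le_lt_trans _ (ltry (M ^+ 2)))// (le_trans _ le)//.
  apply: lee_nneseries => [k _|k _]; first by rewrite poweR_ge0.
  by rewrite /= lee_fin -[2]/(2%:R) powR_mulrn// real_normK// num_real.
pose x : ell2 := Lp_class (Lfun_Sub (lee1n 2) cL).
have xc k : coord k x = c k by rewrite coord_class.
exists x => //; rewrite -(ler_pXn2r (n:=2))// ?nnegrE//.
rewrite -lee_fin ell2_normE (le_trans _ le)//.
by apply: lee_nneseries => [k _|k _]; rewrite xc ?lee_fin ?sqr_ge0.
Qed.

Lemma coord_basis k n : coord k (ell2_basis R n) = (k == n)%:R.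
Proof.
rewrite coord_class /= indicE; congr (_%:R).
by case: eqVneq => [->|kn]; [rewrite mem_set|rewrite memNset//= => /eqP; exact/negP].
Qed.

Lemma normr_coord k (x : ell2) : `|coord k x| <= `|x|.
Proof.
rewrite -(ler_pXn2r (n:=2))// ?nnegrE// real_normK ?num_real//.
apply: le_trans (sum_coord_le x k.+1); rewrite big_ord_recr/= lerDr.
by apply: sumr_ge0 => i _; rewrite sqr_ge0.
Qed.

Lemma coord_bounded k : coord k \in bounded_operator ell2 R.
Proof.
apply/asboolP; split; first exact: coord_is_linear.
by exists 1 => x; rewrite mul1r normr_coord.
Qed.

Definition coordf k : bop ell2 R := Bop (coord_bounded k).

Lemma coord_sum n (c : 'I_n -> R) k :
  coord k (\sum_(i < n) c i *: ell2_basis R i) =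
  if insub k is Some i then c i else 0.
Proof.
rewrite linear_sum/=; case: insubP => [i _ ik|kn].
  rewrite (bigD1 i)//= coordZ coord_basis -ik eqxx mulr1 big1 ?addr0//.
  by move=> j ji; rewrite coordZ coord_basis eq_sym -[X in X == _]/(val j) val_eqE (negPf ji) mulr0.
apply: big1 => j _; rewrite coordZ coord_basis.
by case: eqVneq kn => [->|]; rewrite ?ltn_ord ?mulr0.
Qed.

Lemma norm_sum_basis n (c : 'I_n -> R) :
  `|\sum_(i < n) c i *: ell2_basis R i| ^+ 2 = \sum_(i < n) c i ^+ 2.
Proof.
apply: EFin_inj; rewrite ell2_normE (nneseries_split 0 n); last first.
  by move=> k _; rewrite lee_fin sqr_ge0.
rewrite add0n [X in (_ + X)%E]eseries0 ?adde0.
  rewrite big_mkord -sumEFin; apply: eq_bigr => i _.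
  by rewrite coord_sum valK.
by move=> k nk _; rewrite coord_sum insubF ?expr0n//; apply/negbTE; rewrite -leqNgt.
Qed.

(** Bessel's inequality: testing [f] at the vector with coordinates [f e_k] gives [s <= |f| sqrt s].
    It stands in for the identification of the dual of [ell2]. *)
Lemma functional_basis_le (f : bop ell2 R) n :
  \sum_(k < n) f (ell2_basis R k) ^+ 2 <= `|f| ^+ 2.
Proof.
set s := \sum_(k < n) _; pose c (k : 'I_n) := f (ell2_basis R k).
have s0 : 0 <= s by apply: sumr_ge0 => i _; rewrite sqr_ge0.
have := le_opnorm f (\sum_(k < n) c k *: ell2_basis R k).
rewrite linear_sum/= (eq_bigr (fun k => c k ^+ 2)); last first.
  by move=> k _; rewrite linearZ.
rewrite -/s ger0_norm// => h.
have [->|sn0] := eqVneq s 0; first by rewrite exprn_ge0.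
have sp : 0 < s by rewrite lt_def sn0.
have : s ^+ 2 <= `|f| ^+ 2 * s.
  rewrite -[s in X in _ <= X]norm_sum_basis -exprMn lerXn2r ?nnegrE ?mulr_ge0//.
by rewrite expr2 ler_pM2r.
Qed.

Definition trunc n (x : ell2) : ell2 := \sum_(k < n) coord k x *: ell2_basis R k.

Lemma coord_trunc n x k : coord k (trunc n x) = if (k < n)%N then coord k x else 0.
Proof.
rewrite /trunc coord_sum; case: ifPn => kn.
  by rewrite insubT.
by rewrite insubF//; exact/negbTE.
Qed.

Lemma trunc_cvg x (e : R) : 0 < e -> exists n, `|x - trunc n x| < e.
Proof.
move=> e0; have [n xn] := sum_coord_cvg x (exprn_gt0 2 e0).
exists n; rewrite -(ltr_pXn2r (n:=2))// ?nnegrE ?(ltW e0)//.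
rewrite -lte_fin ell2_normE.
have cE k : true -> (coord k (x - trunc n x) ^+ 2)%:E =
    (if (k < n)%N then 0%E else (coord k x ^+ 2)%:E).
  rewrite linearB/= coord_trunc.
  by case: ifP => _; rewrite ?subrr ?expr0n// subr0.
have pos k : (0 <= (coord k x ^+ 2)%:E :> \bar R)%E by rewrite lee_fin sqr_ge0.
rewrite (eq_eseriesr (fun k => @cE k)) (nneseries_split 0 n); last by move=> k _; case: ifP.
rewrite add0n [X in (X + _)%E]big1_seq ?add0e; last first.
  by move=> k /andP[_]; rewrite mem_index_iota => /andP[_ ->].
have -> : (\sum_(n <= k <oo) (if (k < n)%N then 0 else (coord k x ^+ 2)%:E) =
    \sum_(n <= k <oo) (coord k x ^+ 2)%:E)%E.
  apply: congr_lim; apply/funext => m; apply: eq_big_nat => k /andP[nk _].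
  by rewrite ltnNge nk.
have := ell2_normE x; rewrite (nneseries_split 0 n)// add0n big_mkord sumEFin.
move: (\sum_(n <= k <oo) _)%E => [t||] tE //.
by move: tE xn; rewrite -EFinD lte_fin => -[] ->; lra.
Qed.

End ell2_coordinates.

(** * Cauchy-Schwarz and Young inequalities for finite sums *)

Section finite_sums.
Context {R : realType}.

(** Lagrange's identity: the defect is half the sum of the squares [(a_i b_j - a_j b_i)^2]. *)
Lemma sum_mul_sqr_le (I : finType) (a b : I -> R) :
  (\sum_i a i * b i) ^+ 2 <= (\sum_i a i ^+ 2) * (\sum_i b i ^+ 2).
Proof.
have : 0 <= \sum_i \sum_j (a i * b j - a j * b i) ^+ 2.
  by apply: sumr_ge0 => i _; apply: sumr_ge0 => j _; rewrite sqr_ge0.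
have -> : \sum_i \sum_j (a i * b j - a j * b i) ^+ 2 =
    \sum_i \sum_j (a i ^+ 2 * b j ^+ 2) + \sum_i \sum_j (b i ^+ 2 * a j ^+ 2) -
    2 * \sum_i \sum_j ((a i * b i) * (a j * b j)).
  rewrite big_distrr/= -!big_split/= -sumrN -big_split; apply: eq_bigr => i _.
  rewrite big_distrr/= -!big_split/= -sumrN -big_split; apply: eq_bigr => j _.
  by rewrite /=; ring.
rewrite -!big_distrlr/= expr2.
by move: (\sum_i a i * b i) (\sum_i a i ^+ 2) (\sum_i b i ^+ 2) => u v w; lra.
Qed.

Lemma normr_sum_mul_le (I : finType) (a b : I -> R) :
  `|\sum_i a i * b i| <= Num.sqrt (\sum_i a i ^+ 2) * Num.sqrt (\sum_i b i ^+ 2).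
Proof.
have s0 (c : I -> R) : 0 <= \sum_i c i ^+ 2.
  by apply: sumr_ge0 => i _; rewrite sqr_ge0.
rewrite -(ler_pXn2r (n:=2))// ?nnegrE ?mulr_ge0// real_normK ?num_real//.
by rewrite exprMn !sqr_sqrtr//; exact: sum_mul_sqr_le.
Qed.

Lemma rmean_normr_le (I : finType) (F : {ffun I -> bool} -> R) :
  (forall e, 0 <= F e) -> rmean F <= Num.sqrt (rmean (fun e => F e ^+ 2)).
Proof.
move=> F0; set m := rmean F.
have m0 : 0 <= m by exact: rmean_ge0.
suff : m ^+ 2 <= rmean (fun e => F e ^+ 2).
  by move=> /ler_wsqrtr; rewrite sqrtr_sqr ger0_norm.
rewrite -subr_ge0; have : 0 <= rmean (fun e => (F e - m) ^+ 2).
  by apply: rmean_ge0 => e; rewrite sqr_ge0.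
congr (_ <= _).
transitivity (rmean (fun e => F e ^+ 2) + (- 2 * m) * m + m ^+ 2); last by ring.
rewrite -[X in _ + X](rmean_cst I) -[X in _ * X]/(rmean F) -rmeanZ -!rmeanD.
by apply: eq_rmean => e; ring.
Qed.

Lemma powR_root_le (p a b : R) : 0 < p -> 0 <= a -> 0 <= b ->
  (a `^ p^-1 <= b) = (a <= b `^ p).
Proof.
move=> p0 a0 b0; apply/idP/idP => h.
  have := @ge0_ler_powR _ p (ltW p0) _ _ _ _ h.
  by rewrite !nnegrE powR_ge0 -powRrM mulVf ?gt_eqF// powRr1//; apply.
have pi0 : 0 <= p^-1 by rewrite invr_ge0 ltW.
have := @ge0_ler_powR _ p^-1 pi0 _ _ _ _ h.
by rewrite !nnegrE powR_ge0 -powRrM mulfV ?gt_eqF// powRr1//; apply.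
Qed.

Lemma sum_powR_ge0 (I : Type) (r : seq I) (P : pred I) (a : I -> R) p :
  0 <= \sum_(i <- r | P i) a i `^ p.
Proof. by apply: sumr_ge0 => i _; exact: powR_ge0. Qed.

(* A version of Young's inequality with worse constants but no conjugate
   exponents. *)
Lemma powR_mul_le_add (t a p q : R) : 0 <= t -> 0 <= a -> 0 < p -> p <= q ->
  t `^ (q - p) * a `^ p <= t `^ q + a `^ q.
Proof.
move=> t0 a0 p0 pq.
have E (x : R) : 0 <= x -> x `^ q = x `^ (q - p) * x `^ p.
  rewrite le_eqVlt => /predU1P[<-|x0].
    by rewrite (@powR0 _ p) ?gt_eqF// mulr0 powR0// gt_eqF// (lt_le_trans p0).
  by rewrite -powRD subrK// (gt_eqF x0) implybT.
have [at_|/ltW ta] := leP a t.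
  rewrite [t `^ q]E// -[leLHS]addr0 lerD ?powR_ge0// ler_wpM2l ?powR_ge0//.
  by apply: ge0_ler_powR; rewrite ?nnegrE// ltW.
rewrite [a `^ q]E// -[leLHS]add0r lerD ?powR_ge0// ler_wpM2r ?powR_ge0//.
by apply: ge0_ler_powR; rewrite ?nnegrE// subr_ge0.
Qed.

Lemma powR_rescale (q a b : R) : 0 <= a -> 0 < b ->
  a `^ q = b `^ q * (a / b) `^ q.
Proof.
by move=> a0 b0; rewrite -powRM ?divr_ge0 ?(ltW b0)// mulrC divfK// gt_eqF.
Qed.

Lemma powR_scale (t p q M : R) : 0 <= M -> 0 < p ->
  (2 * t `^ ((q - p) / p) * M) `^ p = 2 `^ p * t `^ (q - p) * M `^ p.
Proof.
move=> M0 p0; rewrite powRM ?mulr_ge0 ?powR_ge0//; congr (_ * _).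
by rewrite powRM ?powR_ge0// -powRrM divfK// gt_eqF.
Qed.

End finite_sums.

(** * Calculus of summing constants *)

Section summing_lemmas.
Context {R : realType}.
Implicit Types X Y : normedModType R.

Lemma weak_norm_has_sup (p : R) X n (x : 'I_n -> X) : 0 <= p ->
  has_sup [set (\sum_(i < n) `|f (x i)| `^ p) `^ p^-1
      | f in [set f : bop X R | `|f| <= 1]].
Proof.
move=> p0; split.
  by exists ((\sum_(i < n) `|(0 : bop X R) (x i)| `^ p) `^ p^-1), 0 => //=; rewrite normr0.
exists ((\sum_(i < n) `|x i| `^ p) `^ p^-1) => _ [f /= f1 <-].
rewrite ge0_ler_powR ?nnegrE ?invr_ge0 ?sum_powR_ge0//.
apply: ler_sum => i _; rewrite ge0_ler_powR ?nnegrE//.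
by rewrite (le_trans (le_opnorm f _))// ler_piMl.
Qed.

Lemma weak_norm_ub (p : R) X n (x : 'I_n -> X) (f : bop X R) : 0 <= p -> `|f| <= 1 ->
  (\sum_(i < n) `|f (x i)| `^ p) `^ p^-1 <= weak_norm p x.
Proof.
by move=> p0 f1; apply: sup_upper_bound; [exact: weak_norm_has_sup|exists f].
Qed.

Lemma weak_norm_le (p : R) X n (x : 'I_n -> X) (M : R) : 0 <= p ->
  (forall f : bop X R, `|f| <= 1 -> (\sum_(i < n) `|f (x i)| `^ p) `^ p^-1 <= M) ->
  weak_norm p x <= M.
Proof.
move=> p0 H; apply: ge_sup; first by case: (weak_norm_has_sup x p0).
by move=> _ [f /= f1 <-]; exact: H.
Qed.

Lemma weak_norm_ge0 (p : R) X n (x : 'I_n -> X) : 0 <= p -> 0 <= weak_norm p x.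
Proof.
move=> p0; apply: le_trans (weak_norm_ub x p0 (f := 0) _); first exact: powR_ge0.
by rewrite normr0.
Qed.

(** Removes the supremum and the roots from the definition. As [M] must be positive, the converse
    takes [M] above the weak norm, by [e / (C + 1)], which costs at most [e]. *)
Lemma summing_constantP (p : R) X Y (T : bop X Y) C : 0 < p -> 0 <= C ->
  summing_constant p T C <-> forall n (x : 'I_n -> X) (M : R), 0 < M ->
    (forall f : bop X R, `|f| <= 1 -> \sum_i `|f (x i)| `^ p <= M `^ p) ->
    \sum_i `|T (x i)| `^ p <= (C * M) `^ p.
Proof.
move=> p0 C0; split=> [[_ CT] n x M M0 H|H].
  have M0' := ltW M0.
  rewrite -powR_root_le ?sum_powR_ge0 ?mulr_ge0//.
  rewrite (le_trans (CT _ _))// ler_wpM2l// weak_norm_le// ?(ltW p0)// => f f1.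
  by rewrite powR_root_le ?sum_powR_ge0//; exact: H.
split=> // n x; apply/ler_addgt0Pr => e e0.
have w0 := weak_norm_ge0 x (ltW p0).
pose M := weak_norm p x + e / (C + 1).
have C1 : 0 < C + 1 by rewrite ltr_wpDl.
have d0 : 0 < e / (C + 1) by rewrite divr_gt0.
have M0 : 0 < M by rewrite ltr_wpDl.
apply: (@le_trans _ _ (C * M)).
  rewrite powR_root_le ?sum_powR_ge0 ?mulr_ge0 ?(ltW M0)//; apply: H => // f f1.
  rewrite -powR_root_le ?sum_powR_ge0 ?(ltW M0)//.
  by rewrite (le_trans (weak_norm_ub x (ltW p0) f1))// lerDl ltW.
rewrite mulrDr lerD2l mulrCA ger_pMr// ler_pdivrMr// mul1r; lra.
Qed.

Lemma summing_constant_fin (p : R) X Y (T : bop X Y) C (I : finType)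
    (x : I -> X) (M : R) : 0 < p -> summing_constant p T C -> 0 < M ->
  (forall f : bop X R, `|f| <= 1 -> \sum_i `|f (x i)| `^ p <= M `^ p) ->
  \sum_i `|T (x i)| `^ p <= (C * M) `^ p.
Proof.
move=> p0 CT M0 H; have C0 : 0 <= C by case: CT.
have := (summing_constantP T p0 C0).1 CT #|I| (x \o enum_val) M M0.
have E (F : I -> R) : \sum_i F i = \sum_(k < #|I|) F (enum_val k).
  by rewrite -big_enum_val; exact: eq_bigl.
rewrite E; apply=> f f1; rewrite -(E (fun i => `|f (x i)| `^ p)).
exact: H.
Qed.

Lemma summing_constant_le (p : R) X Y (T : bop X Y) C D :
  0 <= p -> C <= D -> summing_constant p T C -> summing_constant p T D.
Proof.
move=> p0 CD [C0 CT]; split; first exact: le_trans CD.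
by move=> n x; rewrite (le_trans (CT _ _))// ler_wpM2r// weak_norm_ge0.
Qed.

(** The hypothesis is applied to [la i *: x i] with [la i = |T x_i|^((q-p)/p)], so that its left
    side becomes the [q]-th power sum [tau]. The crude Young inequality bounds the weak norm of this
    family, and [th^(q-p)] cancels. *)
Lemma summing_constant_exponent (p q : R) X Y (T : bop X Y) C : 1 <= p -> p <= q ->
  summing_constant p T C -> summing_constant q T (2 * C).
Proof.
move=> p1 pq CT; have C0 : 0 <= C by case: CT.
have p0 : 0 < p by rewrite (lt_le_trans _ p1).
have q0 : 0 < q by rewrite (lt_le_trans p0).
apply/summing_constantP; rewrite ?mulr_ge0// => n x M M0 H.
set tau := \sum_i _; pose th := tau `^ q^-1.
have tau0 : 0 <= tau by exact: sum_powR_ge0.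
have th0 : 0 <= th by exact: powR_ge0.
have tauE : tau = th `^ q by rewrite -powRrM mulVf ?gt_eqF// powRr1.
rewrite tauE ge0_ler_powR ?nnegrE ?mulr_ge0 ?(ltW M0) ?(ltW q0)//.
have [->|thn0] := eqVneq th 0; first by rewrite !mulr_ge0// ltW.
have thp : 0 < th by rewrite lt_def thn0.
pose t i := `|T (x i)|; pose la i := t i `^ ((q - p) / p).
have laE i : la i `^ p = t i `^ (q - p).
  by rewrite -powRrM -mulrA mulVf ?gt_eqF// mulr1.
(* A bound for the weak norm of the weighted family; the factor [2] pays for the two terms of
   Young's inequality, as [2 <= 2^p]. *)
pose N := 2 * th `^ ((q - p) / p) * M.
have N0 : 0 < N by rewrite !mulr_gt0// powR_gt0.
have := (summing_constantP T p0 C0).1 CT n (fun i => la i *: x i) N N0.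
have -> : \sum_i `|T (la i *: x i)| `^ p = tau.
  apply: eq_bigr => i _; rewrite linearZ normrZ (ger0_norm (powR_ge0 _ _)).
  rewrite powRM ?powR_ge0// laE -/(t i).
  have : 0 <= t i by exact: normr_ge0.
  rewrite le_eqVlt => /predU1P[<-|ti0].
    by rewrite (@powR0 _ p) ?(@powR0 _ q) ?mulr0 ?gt_eqF.
  by rewrite -powRD subrK// (gt_eqF ti0) implybT.
have Np : N `^ p = 2 `^ p * th `^ (q - p) * M `^ p.
  exact: powR_scale (ltW M0) p0.
have bound (f : bop X R) : `|f| <= 1 -> \sum_i `|f (la i *: x i)| `^ p <= N `^ p.
  move=> f1; rewrite Np.
  apply: (@le_trans _ _ (\sum_i (th `^ (q - p) * M `^ p) *
     ((t i / th) `^ q + (`|f (x i)| / M) `^ q))).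
    apply: ler_sum => i _; rewrite linearZ normrZ (ger0_norm (powR_ge0 _ _)).
    rewrite powRM ?powR_ge0// laE.
    rewrite (powR_rescale (q - p) (normr_ge0 (T (x i))) thp).
    rewrite (powR_rescale p (normr_ge0 (f (x i))) M0) mulrACA.
    by rewrite ler_wpM2l ?mulr_ge0 ?powR_ge0// powR_mul_le_add// divr_ge0// ltW.
  rewrite -big_distrr/= big_split/=.
  have le1 (y : 'I_n -> R) D : 0 < D -> (forall i, 0 <= y i) ->
      \sum_i y i `^ q <= D `^ q -> \sum_i (y i / D) `^ q <= 1.
    move=> D0 y0 yD; rewrite -(ler_pM2l (powR_gt0 q D0)) mulr1 big_distrr/=.
    by apply: le_trans yD; apply: ler_sum => i _; rewrite -powR_rescale.
  apply: (@le_trans _ _ ((th `^ (q - p) * M `^ p) * 2)).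
    rewrite ler_wpM2l ?mulr_ge0 ?powR_ge0//.
    rewrite -[2]/(1 + 1) lerD//.
      by apply: (le1 t) => // [i|]; [exact: normr_ge0|rewrite -tauE].
    by apply: le1 => //; exact: H.
  rewrite mulrC -mulrA ler_wpM2r ?mulr_ge0 ?powR_ge0//.
  by rewrite -[leLHS]powRr1// ler_powR// ler1n.
move=> /(_ bound); rewrite powRM ?(ltW N0)// Np tauE.
have -> : th `^ q = th `^ (q - p) * th `^ p.
  by rewrite -powRD subrK// (gt_eqF thp) implybT.
rewrite (_ : C `^ p * _ = th `^ (q - p) * (2 * C * M) `^ p); last first.
  by rewrite !powRM ?mulr_ge0 ?(ltW M0)//; ring.
rewrite (ler_pM2l (powR_gt0 _ thp)) => h.
have M2 : 0 <= 2 * C * M by rewrite !mulr_ge0// ltW.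
move: h; rewrite -(powR_root_le p0 (powR_ge0 _ _) M2).
by rewrite -powRrM mulfV ?gt_eqF// powRr1.
Qed.

End summing_lemmas.

(** * Property (S_p) implies cotype *)

Section evaluation.
Context {R : realType} (X : normedModType R) (y : X).

Lemma evaluation_subproof :
  ((fun f => f y) : bop X R -> R) \in bounded_operator (bop X R) R.
Proof.
apply/asboolP; split=> //; exists `|y| => f.
by rewrite mulrC; exact: (le_opnorm f y).
Qed.

Definition evaluation : bop (bop X R) R := Bop evaluation_subproof.

Lemma norm_evaluation_le : `|evaluation| <= `|y|.
Proof. by apply: opnorm_le => // f; rewrite mulrC; exact: (le_opnorm f y). Qed.

End evaluation.

Section weakly_summable_duals.
Context {R : realType} (X : normedModType R).

(** Evaluation at [y / |y|] has norm at most one on the dual, so the weak summability of the [f i]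
    can be tested on it. *)
Lemma sum_functionals_le (I : finType) (f : I -> bop X R) (M : R) (y : X) :
  0 <= M ->
  (forall F : bop (bop X R) R, `|F| <= 1 -> \sum_i `|F (f i)| <= M) ->
  \sum_i `|f i y| <= M * `|y|.
Proof.
move=> M0 H; have [->|y0] := eqVneq y 0.
  by rewrite normr0 mulr0 big1// => i _; rewrite linear0 normr0.
have yp : 0 < `|y| by rewrite normr_gt0.
rewrite -ler_pdivrMr// mulrC big_distrr/=.
apply: le_trans (H (evaluation (`|y|^-1 *: y)) _).
  apply: ler_sum => i _; rewrite /= linearZ normrZ ger0_norm// invr_ge0//.
rewrite (le_trans (norm_evaluation_le _))// normrZ ger0_norm ?invr_ge0//.
by rewrite mulVf ?gt_eqF.
Qed.

End weakly_summable_duals.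

Section sum_of_rank_ones.
Context {R : realType} (X : normedModType R) (n : nat) (x : 'I_n -> X).

Lemma opsum_subproof :
  (fun u : ell2 R => \sum_(i < n) coord i u *: x i)
    \in bounded_operator (ell2 R) X.
Proof.
apply/asboolP; split.
  move=> a u v; rewrite scaler_sumr -big_split; apply: eq_bigr => i _.
  by rewrite linearP/= scalerDl scalerA.
exists (\sum_(i < n) `|x i|) => u; rewrite (le_trans (ler_norm_sum _ _ _))//.
rewrite big_distrl; apply: ler_sum => i _.
by rewrite normrZ mulrC ler_wpM2l// normr_coord.
Qed.

Definition opsum : bop (ell2 R) X := Bop opsum_subproof.

Lemma opsum_basis k :
  opsum (ell2_basis R k) = if insub k is Some i then x i else 0.
Proof.
rewrite /=; case: insubP => [i _ ik|kn].
  rewrite (bigD1 i)//= coord_basis -ik eqxx scale1r big1 ?addr0//.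
  move=> j ji; rewrite coord_basis (_ : (val j == val i) = false) ?scale0r//.
  exact/negbTE.
apply: big1 => j _; rewrite coord_basis.
by case: eqVneq kn => [<-|]; rewrite ?ltn_ord// scale0r.
Qed.

Lemma opsum_finite_rank : finite_rank opsum.
Proof. by exists n, x => u; exists (fun i => coord i u). Qed.

Lemma norm_adjoint_opsum_le (f : bop X R) :
  `|adjoint opsum f| <= Num.sqrt (\sum_i f (x i) ^+ 2).
Proof.
apply: opnorm_le => [|u]; first exact: sqrtr_ge0.
rewrite /= linear_sum/= (eq_bigr (fun i => f (x i) * coord i u)); last first.
  by move=> i _; rewrite functionalZ mulrC.
rewrite (le_trans (normr_sum_mul_le _ _))// ler_wpM2l//.
rewrite -[leRHS]ger0_norm// -sqrtr_sqr; exact/ler_wsqrtr/sum_coord_le.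
Qed.

(* By Khinchine's inequality the norm of the adjoint at f is at most
   2 E|f(sum_i eps_i x_i)|. *)
Lemma adjoint_opsum_summing :
  summing_constant 1 (adjoint opsum) (2 * Num.sqrt (rad2 x)).
Proof.
apply/summing_constantP => // m f M M0 H; rewrite powRr1 ?mulr_ge0 ?(ltW M0)//.
apply: (@le_trans _ _ (\sum_j 2 * rmean (fun e => `|f j (rsum x e)|))).
  apply: ler_sum => j _; rewrite powRr1//.
  rewrite (le_trans (norm_adjoint_opsum_le _))// (le_trans (khinchine _))//.
  rewrite ler_wpM2l//; apply: ler_rmean => e.
  have -> // : f j (rsum x e) = \sum_i (-1) ^+ e i * f j (x i).
  by rewrite /rsum linear_sum/=; apply: eq_bigr => i _; rewrite functionalZ.
rewrite -big_distrr/= -rmean_sum -mulrA ler_wpM2l//.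
apply: (@le_trans _ _ (rmean (fun e => M * `|rsum x e|))).
  apply: ler_rmean => e; apply: sum_functionals_le (ltW M0) _ => F F1.
  have := H F F1; rewrite powRr1 ?(ltW M0)//.
  by under eq_bigr do rewrite powRr1//.
by rewrite rmeanZ mulrC ler_wpM2r ?(ltW M0)// rmean_normr_le.
Qed.

End sum_of_rank_ones.

Section property_Sp.
Context {R : realType} (X : normedModType R).

Lemma summing_norm_lt (p : R) (Y Z : normedModType R) (T : bop Y Z) (C : R) :
  0 <= p -> (summing_norm p T < C%:E)%E -> summing_constant p T C.
Proof.
move=> p0 /ereal_inf_lt[_ [D DT <-]]; rewrite lte_fin => /ltW DC.
exact: summing_constant_le DC DT.
Qed.

(** Trades an inequality of extended reals for one between admissible constants. [D] lies strictly
    above [K * C] because the infimum may not be attained. *)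
Lemma property_SpP (p : R) : 0 <= p -> property_Sp X p -> exists2 K : R, 0 <= K &
  forall (T : bop (ell2 R) X) C D, summing_constant 1 (adjoint T) C ->
    K * C < D -> summing_constant p T D.
Proof.
move=> p0 [K HK]; exists `|K| => // T C D CT KCD.
have [_ h] := HK T (ex_intro _ C CT).
apply: summing_norm_lt => //; apply: le_lt_trans h _.
apply: le_lt_trans (_ : (`|K| * C)%:E < D%:E)%E; last by rewrite lte_fin.
have le : (summing_norm 1 (adjoint T) <= C%:E)%E by apply: ereal_inf_lbound; exists C.
have ge : (0 <= summing_norm 1 (adjoint T))%E.
  by apply: le_ereal_inf_tmp => _ [E [E0 _] <-]; rewrite lee_fin.
rewrite EFinM; apply: (@le_trans _ _ (`|K|%:E * summing_norm 1 (adjoint T))%E).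
  by apply: lee_wpmul2r => //; rewrite lee_fin ler_norm.
by apply: lee_wpmul2l.
Qed.

(** The unit vectors are weakly [q]-summable with constant one as soon as [q >= 2], whence the
    maximum. The factor [4] is a [2] from Khinchine times a [2] from raising the exponent from [p]
    to [q]. *)
Lemma property_Sp_cotype (p : R) : 1 <= p -> property_Sp X p ->
  cotype X (Num.max 2 p).
Proof.
move=> p1; have p0 : 0 <= p by rewrite (le_trans _ p1).
move=> /(property_SpP p0)[K K0 HK]; exists (4 * K) => n x.
set q := Num.max 2 p.
have q2 : 2 <= q by rewrite /q le_max lexx.
have pq : p <= q by rewrite /q le_max lexx orbT.
have q0 : 0 < q by rewrite (lt_le_trans _ q2).
have -> : 2 ^- n * \sum_(e : {ffun 'I_n -> bool})
    `|\sum_(i < n) (-1) ^+ e i *: x i| ^+ 2 = rad2 x.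
  by rewrite /rad2 /rmean card_ord.
apply/ler_addgt0Pr => e e0; set r := Num.sqrt _.
have r0 : 0 <= r := sqrtr_ge0 _.
pose D := K * (2 * r) + e / 2.
have D0 : 0 < D by rewrite ltr_wpDl ?mulr_ge0 ?divr_gt0.
have DT : summing_constant q (opsum x) (2 * D).
  apply: (@summing_constant_exponent _ p) => //.
  by apply: HK (adjoint_opsum_summing x) _; rewrite ltrDl divr_gt0.
rewrite (_ : _ + e = 2 * D); last by rewrite /D; field.
rewrite powR_root_le ?sum_powR_ge0 ?mulr_ge0 ?(ltW D0)//.
have := summing_constant_fin (I := 'I_n) (x := fun i => ell2_basis R i) q0 DT ltr01.
rewrite mulr1 (eq_bigr (fun i => `|x i| `^ q)); last first.
  by move=> i _; rewrite opsum_basis valK.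
apply=> f f1; rewrite powR1.
apply: (@le_trans _ _ (\sum_(k < n) f (ell2_basis R k) ^+ 2)); last first.
  by rewrite (le_trans (functional_basis_le f n))// exprn_ile1.
apply: ler_sum => k _; rewrite -real_normK ?num_real//.
have a1 : `|f (ell2_basis R k)| <= 1.
  rewrite -(ler_pXn2r (n:=2))// ?nnegrE// real_normK ?num_real// expr1n.
  have := functional_basis_le f k.+1; rewrite big_ord_recr/= => h.
  apply: (@le_trans _ _ (`|f| ^+ 2)); last by rewrite exprn_ile1.
  by rewrite (le_trans _ h)// lerDr; apply: sumr_ge0 => i _; rewrite sqr_ge0.
have [->|fk0] := eqVneq (f (ell2_basis R k)) 0.
  by rewrite normr0 powR0 ?gt_eqF// expr0n.
by rewrite -[leRHS]powR_mulrn// ger_powR// normr_gt0 fk0.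
Qed.

End property_Sp.

(** * Operators from l_oo^n into spaces of finite cotype *)

Lemma sum_option (V : zmodType) (I : finType) (F : option I -> V) :
  \sum_o F o = F None + \sum_i F (Some i).
Proof.
rewrite (bigD1 None)//=; congr (_ + _).
by rewrite (reindex_omap Some id)/=; [apply: eq_bigl => i; rewrite eqxx|case].
Qed.

Section operators_from_linfty.
Context {R : realType} (X : normedModType R).

(** Cotype in the form that suits Pisier's argument: a natural exponent, so that polynomial
    inequalities apply, and a bound over all signs in place of the mean. *)
Definition sign_bounded_power_sums (q : nat) (K : R) : Prop :=
  forall (I : finType) (x : I -> X) (S : R), 0 <= S ->
    (forall e, `|rsum x e| <= S) -> \sum_i `|x i| ^+ q <= (K * S) ^+ q.

(** The convex function [u ^+ q.+1] lies above its tangent at [t]. *)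
Lemma bernoulli_expr (q : nat) (u t : R) : 0 <= u -> 0 <= t ->
  t ^+ q.+1 + q.+1%:R * t ^+ q * (u - t) <= u ^+ q.+1.
Proof.
move=> u0 t0; elim: q => [|q IH]; first by rewrite !expr1 expr0; lra.
apply: (@le_trans _ _ (u * (t ^+ q.+1 + q.+1%:R * t ^+ q * (u - t)))); last first.
  by rewrite [u ^+ q.+2]exprS ler_wpM2l.
rewrite -subr_ge0.
have -> : u * (t ^+ q.+1 + q.+1%:R * t ^+ q * (u - t)) -
  (t ^+ q.+2 + q.+2%:R * t ^+ q.+1 * (u - t)) = q.+1%:R * t ^+ q * (u - t) ^+ 2.
  by rewrite -[q.+2%:R]natr1 !exprS; ring.
by rewrite mulr_ge0 ?sqr_ge0// mulr_ge0// exprn_ge0.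
Qed.

Section Pisier.
Variables (q : nat) (K : R) (J : finType) (y : J -> X).
Hypothesis cotX : sign_bounded_power_sums q.+1 K.
Hypothesis y1 : forall f : bop X R, `|f| <= 1 -> \sum_k `|f (y k)| <= 1.

(** The operator from [l_oo(J)] to [X] given by the weakly summable family [y]; [y1] says that its
    norm is at most one. *)
Let w (phi : J -> R) : X := \sum_k phi k *: y k.

Let functional_w (f : bop X R) phi : f (w phi) = \sum_k phi k * f (y k).
Proof. by rewrite linear_sum/=; apply: eq_bigr => k _; rewrite functionalZ. Qed.

Lemma norm_linfty_le phi M : 0 <= M -> (forall k, `|phi k| <= M) -> `|w phi| <= M.
Proof.
move=> M0 phiM; have [f [f1 <-]] := norming_functional (w phi).
rewrite functional_w (le_trans (ler_norm _))// (le_trans (ler_norm_sum _ _ _))//.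
apply: (@le_trans _ _ (\sum_k M * `|f (y k)|)).
  by apply: ler_sum => k _; rewrite normrM ler_wpM2r.
by rewrite -big_distrr/= ler_piMr// y1.
Qed.

(** Every signed sum of the [phi i] stays in the unit ball of [l_oo], so the signed sums of the
    [w (phi i)] have norm at most one. *)
Lemma sum_norm_disjoint_le (I : finType) (phi : I -> J -> R) :
  (forall k, \sum_i `|phi i k| <= 1) -> \sum_i `|w (phi i)| ^+ q.+1 <= K ^+ q.+1.
Proof.
move=> phi1; rewrite -[K]mulr1; apply: cotX => // e.
have -> : rsum (fun i => w (phi i)) e = w (fun k => \sum_i (-1) ^+ e i * phi i k).
  rewrite /rsum /w; under eq_bigr do rewrite scaler_sumr.
  rewrite exchange_big; apply: eq_bigr => k _; rewrite scaler_suml.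
  by apply: eq_bigr => i _; rewrite scalerA.
apply: norm_linfty_le => // k; rewrite (le_trans (ler_norm_sum _ _ _))//.
apply: le_trans (phi1 k); apply: ler_sum => i _.
by rewrite normrM normrX normrN1 expr1n mul1r.
Qed.

(* Take a family phi_i that nearly maximises sum_i |w phi_i|^q. Adding psi to
   the family (1 - |psi|) phi_i cannot exceed the maximum, and linearising
   |w((1 - |psi|) phi_i)|^q by norming functionals of w phi_i gives Lambda. *)
Lemma Pisier_domination (delta : R) : 0 < delta ->
  exists2 L : J -> R, (forall k, 0 <= L k) /\ \sum_k L k <= K ^+ q.+1 + delta &
    forall psi, (forall k, `|psi k| <= 1) ->
      `|w psi| ^+ q.+1 <= delta + q.+1%:R * \sum_k L k * `|psi k|.
Proof.
move=> d0.
pose A := [set s : R | exists n (phi : 'I_n -> J -> R),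
  (forall k, \sum_i `|phi i k| <= 1) /\ s = \sum_i `|w (phi i)| ^+ q.+1].
have Aub (I : finType) (phi : I -> J -> R) : (forall k, \sum_i `|phi i k| <= 1) ->
    A (\sum_i `|w (phi i)| ^+ q.+1).
  move=> phi1; exists #|I|, (phi \o enum_val); split=> [k|].
    apply: le_trans (phi1 k); rewrite le_eqVlt -(big_enum_val (fun i => `|phi i k|)).
    by apply/orP; left; apply/eqP; exact: eq_bigl.
  by rewrite -(big_enum_val (fun i => `|w (phi i)| ^+ q.+1)); exact: eq_bigl.
have sA : has_sup A.
  split.
    exists (\sum_(i < 0) `|w (fun=> 0)| ^+ q.+1); apply: (Aub _ (fun=> fun=> 0)) => k.
    by rewrite big_ord0.
  by exists (K ^+ q.+1) => _ [n [phi [phi1 ->]]]; exact: sum_norm_disjoint_le.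
have [_ [n [phi [phi1 ->]]] ssig] := sup_adherent d0 sA.
set sig := \sum_i _ in ssig.
have sigK : sig <= K ^+ q.+1 by exact: sum_norm_disjoint_le.
pose t i := `|w (phi i)|.
have /choice[f f_] : forall i : 'I_n, exists f : bop X R, `|f| <= 1 /\ f (w (phi i)) = t i.
  by move=> i; exact: norming_functional.
pose L0 k := \sum_i t i ^+ q * (phi i k * f i (y k)).
have L0E (h : J -> R) : \sum_k L0 k * h k = \sum_i t i ^+ q * f i (w (fun k => phi i k * h k)).
  under eq_bigr do rewrite big_distrl/=; rewrite exchange_big; apply: eq_bigr => i _.
  rewrite functional_w big_distrr/=; apply: eq_bigr => k _; by ring.
have main psi : (forall k, `|psi k| <= 1) ->
    `|w psi| ^+ q.+1 <= delta + q.+1%:R * \sum_k L0 k * `|psi k|.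
  move=> psi1.
  pose Phi (o : option 'I_n) k := if o is Some i then phi i k * (1 - `|psi k|) else psi k.
  have Phi1 k : \sum_o `|Phi o k| <= 1.
    rewrite sum_option/= (eq_bigr (fun i => (1 - `|psi k|) * `|phi i k|)); last first.
      by move=> i _; rewrite normrM mulrC; congr (_ * _); rewrite ger0_norm// subr_ge0.
    rewrite -big_distrr/= -lerBrDl.
    by rewrite ler_piMr// subr_ge0.
  have := sup_upper_bound sA (Aub _ Phi Phi1); rewrite sum_option/= => le_sup.
  have ge_sig : sig - q.+1%:R * \sum_k L0 k * `|psi k| <=
      \sum_i `|w (Phi (Some i))| ^+ q.+1.
    rewrite L0E big_distrr/= -sumrB; apply: ler_sum => i _ /=.
    apply: le_trans (bernoulli_expr q (normr_ge0 _) (normr_ge0 (w (phi i)))).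
    rewrite lerD2l -/(t i) -!mulrN -!mulrA ler_wpM2l// ler_wpM2l ?exprn_ge0 ?normr_ge0//.
    have [f1 fi] := f_ i; rewrite lerBrDr -fi.
    have -> : f i (w (phi i)) = f i (w (fun k => phi i k * (1 - `|psi k|))) +
        f i (w (fun k => phi i k * `|psi k|)).
      rewrite !functional_w -big_split; apply: eq_bigr => k _ /=; by ring.
    rewrite addrCA addNr addr0 (le_trans (ler_norm _))// (le_trans (le_opnorm _ _))// ler_piMl//.
  by move: le_sup ge_sig ssig; lra.
pose L k := Num.max (L0 k) 0.
exists L; last first.
  move=> psi psi1; apply: le_trans (main psi psi1) _; rewrite lerD2l ler_wpM2l//.
  by apply: ler_sum => k _; rewrite ler_wpM2r// le_max lexx.
split=> [k|]; first by rewrite le_max lexx orbT.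
(* [L0] may be negative somewhere. Testing [main] on the indicator of [L0 < 0] bounds the total
   negative mass by [delta], so the positive part costs no more than that. *)
pose h k : R := (L0 k < 0)%R%:R.
have h1 k : `|h k| <= 1 by rewrite /h; case: (_ < _); rewrite ?normr1 ?normr0.
have LE : \sum_k L k = \sum_k L0 k * 1 - \sum_k L0 k * `|h k|.
  rewrite -sumrB; apply: eq_bigr => k _; rewrite /L /h.
  case: ltP => L00; first by rewrite normr1 subrr.
  by rewrite normr0 mulr0 subr0 mulr1.
have sumL0 : \sum_k L0 k * 1 = sig.
  rewrite L0E; apply: eq_bigr => i _.
  rewrite (_ : w _ = w (phi i)).
    by rewrite (f_ i).2 -exprSr.
  by apply: eq_bigr => k _; rewrite mulr1.
have := main h h1; have : 0 <= `|w h| ^+ q.+1 by rewrite exprn_ge0.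
rewrite LE sumL0; move: (\sum_k _ * _) => s; move: sigK.
have : 1 <= q.+1%:R :> R by rewrite ler1n.
move: (q.+1%:R) (`|w h| ^+ q.+1) (K ^+ q.+1) => a b c.
move=> a1 sc b0 bd.
have [s0|s0] := leP 0 s; first by lra.
have : s * a <= s by rewrite ger_nMr//.
lra.
Qed.

Section dyadic_layers.
Variables (L : J -> R) (delta : R) (N : nat).
Hypothesis L0 : forall k, 0 <= L k.
Hypothesis Lw : forall psi, (forall k, `|psi k| <= 1) ->
  `|w psi| ^+ q.+1 <= delta + q.+1%:R * \sum_k L k * `|psi k|.
Hypothesis delta_le : delta <= 2 ^- (2 * q.+1 * N).

(** By Markov's inequality [L] gives the support of [phi] mass at most [2^(-2(q+1)j)]. Pisier's
    inequality for [phi / a] and a root of order [q+1] leave [2^(-2j)], and rescaling by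
    [a = 2^(j+1) tau] leaves [2^(-j)]. As [j <= N], the error [delta] is not larger than the main
    term. *)
Let norm_layer_le (tau : R) (j : nat) phi : 0 < tau -> (j <= N)%N ->
  (forall k, phi k != 0 -> 2 ^+ j * tau < `|phi k|) ->
  (forall k, `|phi k| <= 2 ^+ j.+1 * tau) ->
  \sum_k L k * `|phi k| ^+ (2 * q.+1) <= tau ^+ (2 * q.+1) ->
  `|w phi| <= 4 * q.+1%:R * tau * 2 ^- j.
Proof.
move=> tau0 jN lo hi mass; set a := 2 ^+ j.+1 * tau.
have a0 : 0 < a by rewrite mulr_gt0// exprn_gt0.
have Q1 : 1 <= q.+1%:R :> R by rewrite ler1n.
pose psi k := phi k / a.
have psi1 k : `|psi k| <= 1.
  by rewrite normrM normfV (gtr0_norm a0) ler_pdivrMr// mul1r hi.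
have wphi : w phi = a *: w psi.
  rewrite /w scaler_sumr; apply: eq_bigr => k _.
  by rewrite scalerA mulrC divfK// gt_eqF.
have b0 : 0 < 2 ^+ j * tau by rewrite mulr_gt0// exprn_gt0.
have Lpsi : \sum_k L k * `|psi k| <= 2 ^- (2 * q.+1 * j).
  apply: (@le_trans _ _ (\sum_k (2 ^+ j * tau) ^- (2 * q.+1) * (L k * `|phi k| ^+ (2 * q.+1)))).
    apply: ler_sum => k _; rewrite mulrCA ler_wpM2l//.
    have [phi0|phi0] := eqVneq (phi k) 0.
      by rewrite /psi phi0 mul0r !normr0 expr0n mulr0.
    rewrite (le_trans (psi1 k))// mulrC ler_pdivlMr ?exprn_gt0// mul1r.
    by rewrite lerXn2r ?nnegrE ?(ltW b0)// ltW// lo.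
  rewrite -big_distrr/=.
  apply: (@le_trans _ _ ((2 ^+ j * tau) ^- (2 * q.+1) * tau ^+ (2 * q.+1))).
    by rewrite ler_wpM2l// invr_ge0 exprn_ge0// ltW.
  by rewrite exprMn invfM -mulrA mulVf ?mulr1 ?expf_neq0 ?gt_eqF// -exprM mulnC.
rewrite -(ler_pXn2r (n:=q.+1))// ?nnegrE ?mulr_ge0 ?invr_ge0 ?exprn_ge0 ?(ltW tau0)//.
rewrite wphi normrZ (gtr0_norm a0) exprMn.
apply: (@le_trans _ _ (a ^+ q.+1 * (2 * q.+1%:R * 2 ^- (2 * q.+1 * j)))).
  rewrite ler_wpM2l ?exprn_ge0 ?(ltW a0)// (le_trans (Lw psi1))//.
  have dj : delta <= q.+1%:R * 2 ^- (2 * q.+1 * j).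
    rewrite (le_trans delta_le)// -[leLHS]mul1r ler_pM// ?invr_ge0 ?exprn_ge0//.
    by rewrite lef_pV2 ?posrE ?exprn_gt0// ler_eXn2l ?ltr1n// leq_mul2l jN orbT.
  have := ler_wpM2l (ler0n R q.+1) Lpsi.
  by move: (2 ^- _) (\sum_k _) dj => b s; lra.
have -> : 4 * q.+1%:R * tau * 2 ^- j = a * (2 * q.+1%:R * 2 ^- (2 * j)).
  rewrite /a exprS mul2n -addnn exprD invfM.
  have : 2 ^+ j != 0 :> R by rewrite expf_neq0.
  by move: (2 ^+ j) => z z0; field.
rewrite [leRHS]exprMn ler_wpM2l ?exprn_ge0 ?(ltW a0)// exprMn exprVn -exprM mulnAC.
rewrite ler_wpM2r ?invr_ge0 ?exprn_ge0// ler_eXnr//.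
by move: Q1; lra.
Qed.

(** Dyadic layers are peeled off from the top. They contribute a geometric series of total at most
    [8 (q+1) tau]; what lies below [tau] is estimated by the norm of [w]. *)
Lemma norm_linfty_to_Lp_le (tau : R) phi : 0 < tau ->
  (forall k, `|phi k| <= 2 ^+ N * tau) ->
  \sum_k L k * `|phi k| ^+ (2 * q.+1) <= tau ^+ (2 * q.+1) ->
  `|w phi| <= 9 * q.+1%:R * tau.
Proof.
move=> tau0 phiN mass; have Q1 : 1 <= q.+1%:R :> R by rewrite ler1n.
suff H m : (m <= N)%N -> forall psi, (forall k, `|psi k| <= 2 ^+ m * tau) ->
    \sum_k L k * `|psi k| ^+ (2 * q.+1) <= tau ^+ (2 * q.+1) ->
    `|w psi| <= tau + 8 * q.+1%:R * tau * (1 - 2 ^- m).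
  have := H N (leqnn N) phi phiN mass.
  have : 0 <= q.+1%:R * tau * 2 ^- N.
    by rewrite !mulr_ge0// ?invr_ge0 ?exprn_ge0// ltW.
  have : tau <= q.+1%:R * tau by rewrite ler_peMl// ltW.
  rewrite mulrBr mulr1 -!mulrA; lra.
elim: m => [_|m IH mN] psi hi massp.
  rewrite expr0 invr1 subrr mulr0 addr0; apply: norm_linfty_le; first exact: ltW.
  by move=> k; have := hi k; rewrite mul1r.
pose big k := 2 ^+ m * tau < `|psi k|.
pose psi1 k := if big k then psi k else 0; pose psi0 k := if big k then 0 else psi k.
have mass_le (h : J -> R) : (forall k, `|h k| <= `|psi k|) ->
    \sum_k L k * `|h k| ^+ (2 * q.+1) <= tau ^+ (2 * q.+1).
  move=> hpsi; apply: le_trans massp; apply: ler_sum => k _.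
  by rewrite ler_wpM2l// lerXn2r ?nnegrE.
have -> : w psi = w psi0 + w psi1.
  rewrite -big_split; apply: eq_bigr => k _ /=; rewrite /psi0 /psi1.
  by case: ifP => _; rewrite scale0r ?add0r ?addr0.
apply: le_trans (ler_normD _ _) _.
have h0 : `|w psi0| <= tau + 8 * q.+1%:R * tau * (1 - 2 ^- m).
  apply: IH; first exact: ltnW.
    move=> k; rewrite /psi0 /big; case: ltP => // _.
    by rewrite normr0 mulr_ge0 ?exprn_ge0 ?(ltW tau0).
  by apply: mass_le => k; rewrite /psi0; case: ifP => _; rewrite ?normr0.
have h1 : `|w psi1| <= 4 * q.+1%:R * tau * 2 ^- m.
  apply: norm_layer_le => //; first exact: ltnW.
  - by move=> k; rewrite /psi1; case: ifPn => //; rewrite eqxx.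
  - move=> k; rewrite /psi1; case: ifP => // _.
    by rewrite normr0 mulr_ge0 ?exprn_ge0 ?(ltW tau0).
  - by apply: mass_le => k; rewrite /psi1; case: ifP => _; rewrite ?normr0.
apply: le_trans (lerD h0 h1) _; rewrite exprS invfM.
by move: (2 ^- m) => z; lra.
Qed.

End dyadic_layers.

(** Each [phi i] is treated at its own scale [tau i], essentially its norm in the [L_(2(q+1))] space
    of the weight [L]; summing over [i] brings out the total mass of [L]. *)
Lemma sum_norm_linfty_le (I : finType) (phi : I -> J -> R) :
  (forall k, \sum_i `|phi i k| ^+ (2 * q.+1) <= 1) ->
  \sum_i `|w (phi i)| ^+ (2 * q.+1) <=
    (9 * q.+1%:R) ^+ (2 * q.+1) * (K ^+ q.+1 + 2).
Proof.
move=> phi1; pose N := #|I|.+1; pose delta : R := 2 ^- (2 * q.+1 * N).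
have d0 : 0 < delta by rewrite invr_gt0 exprn_gt0.
have d1 : delta <= 1 by rewrite invf_le1 ?exprn_gt0// exprn_ege1// ler1n.
have [L [L0 sumL] Lw] := Pisier_domination d0.
(* The term [eps] makes the scales positive and large enough for [N] layers to reach [1]; since [N]
   is [#|I| + 1], these terms add up to less than one. *)
pose eps : R := N%:R^-1.
have eps0 : 0 < eps by rewrite invr_gt0 ltr0n.
pose m i := \sum_k L k * `|phi i k| ^+ (2 * q.+1) + eps.
have m0 i : 0 < m i.
  rewrite ltr_wpDl//; apply: sumr_ge0 => k _.
  by rewrite mulr_ge0 ?exprn_ge0.
have [tau [tau0 tauE]] : exists tau : I -> R,
    (forall i, 0 < tau i) /\ forall i, tau i ^+ (2 * q.+1) = m i.
  exists (fun i => m i `^ (2 * q.+1)%:R^-1); split=> i; first exact: powR_gt0.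
  by rewrite -powR_mulrn ?powR_ge0// -powRrM mulVf ?pnatr_eq0// powRr1// ltW.
have phi_le1 i k : `|phi i k| <= 1.
  rewrite -(ler_pXn2r (n:=2 * q.+1))// ?nnegrE// expr1n.
  apply: le_trans (phi1 k); rewrite (bigD1 i)//= lerDl.
  by apply: sumr_ge0 => j _; rewrite exprn_ge0.
have tauN i : 1 <= 2 ^+ N * tau i.
  rewrite -(ler_pXn2r (n:=2 * q.+1))// ?nnegrE ?mulr_ge0 ?exprn_ge0 ?(ltW (tau0 i))//.
  rewrite expr1n exprMn tauE; apply: (@le_trans _ _ (N%:R * eps)).
    by rewrite mulfV// pnatr_eq0.
  apply: ler_pM => //; first exact: ltW; last first.
    rewrite lerDr; apply: sumr_ge0 => k _.
    by rewrite mulr_ge0 ?exprn_ge0.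
  apply: (@le_trans _ _ (2 ^+ N)); last by rewrite ler_eXnr// exprn_ege1// ler1n.
  by rewrite -natrX ler_nat ltnW// ltn_expl.
apply: (@le_trans _ _ (\sum_i (9 * q.+1%:R) ^+ (2 * q.+1) * m i)).
  apply: ler_sum => i _; rewrite -tauE -exprMn lerXn2r ?nnegrE ?mulr_ge0 ?(ltW (tau0 i))//.
  apply: (norm_linfty_to_Lp_le (N := N) L0 Lw) => //.
    by move=> k; exact: le_trans (tauN i).
  by rewrite tauE lerDl ltW.
rewrite -big_distrr/= ler_wpM2l ?exprn_ge0 ?mulr_ge0//.
rewrite big_split/= exchange_big/= sumr_const.
apply: (@le_trans _ _ (\sum_k L k + 1)); last by move: sumL d1; lra.
rewrite lerD//; last by rewrite -mulr_natl ler_pdivrMr ?ltr0n// mul1r ler_nat.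
by apply: ler_sum => k _; rewrite -big_distrr/= ler_piMr.
Qed.

End Pisier.

(** After division by [|K| * S] all norms are at most one, so raising the exponent to a natural
    number above [p] only decreases the power sum. If [|K| * S = 0], all the vectors vanish. *)
Lemma cotype_sign_bounded (p : R) : 0 < p -> cotype X p ->
  exists q K, 0 <= K /\ sign_bounded_power_sums q.+1 K.
Proof.
move=> p0 [K HK]; exists (Num.bound p), `|K|; split=> // I x S S0 xS.
have pq : p <= (Num.bound p).+1%:R.
  by rewrite (le_trans (ltW (archi_boundP (ltW p0))))// ler_nat.
move: pq; move: (Num.bound p) => q pq.
have KS0 : 0 <= `|K| * S by rewrite mulr_ge0.
pose xe (i : 'I_#|I|) := x (enum_val i).
have := HK #|I| xe.
have -> : 2 ^- #|I| * \sum_(e : {ffun 'I_#|I| -> bool})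
    `|\sum_(i < #|I|) (-1) ^+ e i *: xe i| ^+ 2 = rad2 xe.
  by rewrite /rad2 /rmean card_ord.
have rS : Num.sqrt (rad2 xe) <= S.
  rewrite -[leRHS]ger0_norm// -sqrtr_sqr ler_wsqrtr//.
  apply: le_trans (rad2_inj _ enum_val_inj) _.
  rewrite -[leRHS](rmean_cst I); apply: ler_rmean => e.
  by rewrite lerXn2r ?nnegrE ?xS.
have -> : \sum_(i < #|I|) `|xe i| `^ p = \sum_i `|x i| `^ p.
  by rewrite -(big_enum_val (fun i => `|x i| `^ p)); exact: eq_bigl.
move=> xK.
have {xK} : (\sum_i `|x i| `^ p) `^ p^-1 <= `|K| * S.
  by rewrite (le_trans xK)// (le_trans (ler_wpM2r _ (ler_norm K)))// ler_wpM2l.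
rewrite powR_root_le ?sum_powR_ge0// => xK.
have [KS|KS] := eqVneq (`|K| * S) 0.
  have x0 i : x i = 0.
    apply/eqP; rewrite -normr_eq0; apply/eqP/(@powR_eq0_eq0 _ _ p)/eqP.
    rewrite eq_le powR_ge0 andbT; move: xK; rewrite KS powR0 ?gt_eqF// => xK.
    apply: le_trans xK; rewrite (bigD1 i)//= lerDl; exact: sum_powR_ge0.
  by rewrite KS expr0n big1// => i _; rewrite x0 normr0 expr0n.
have KSp : 0 < `|K| * S by rewrite lt_def KS.
have le1 i : `|x i| / (`|K| * S) <= 1.
  rewrite ler_pdivrMr// mul1r.
  have : `|x i| `^ p <= (`|K| * S) `^ p.
    by apply: le_trans xK; rewrite (bigD1 i)//= lerDl; exact: sum_powR_ge0.
  by rewrite -powR_root_le ?powR_ge0// -powRrM mulfV ?gt_eqF// powRr1.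
rewrite -[leRHS]mulr1 -ler_pdivrMl ?exprn_gt0// big_distrr/=.
apply: (@le_trans _ _ (\sum_i (`|x i| / (`|K| * S)) `^ p)).
  apply: ler_sum => i _; rewrite mulrC -exprVn -exprMn.
  rewrite -powR_mulrn ?divr_ge0//.
  have [->|xi] := eqVneq (x i) 0.
    by rewrite normr0 mul0r powR0 ?pnatr_eq0// powR_ge0.
  by rewrite ger_powR// le1 andbT divr_gt0// normr_gt0.
rewrite -(ler_pM2l (powR_gt0 p KSp)) mulr1 big_distrr/= (le_trans _ xK)//.
by apply: ler_sum => i _; rewrite -powR_rescale.
Qed.

End operators_from_linfty.

(** * Approximation and traces in L1 *)

Lemma sum_integral_preimage d (M : measurableType d) (R : realType)
    (nu : {measure set M -> \bar R}) (P : finType) (kap : M -> P) (f : M -> \bar R) :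
  (forall p, measurable (kap @^-1` [set p])) -> measurable_fun setT f ->
  (forall x, 0 <= f x)%E ->
  (\sum_p \int[nu]_(x in kap @^-1` [set p]) f x = \int[nu]_x f x)%E.
Proof.
move=> mkap mf f0; under eq_bigr do rewrite integral_mkcond.
rewrite -ge0_integral_sum//; last first.
- by move=> p x _; rewrite patchE; case: ifP.
- by move=> p; apply/(measurable_restrictT _ (mkap p))/measurable_funTS.
apply: eq_integral => x _; rewrite (bigD1 (kap x))//= patchE mem_set//.
rewrite big1 ?adde0// => p px; rewrite patchE memNset//= => kx.
by rewrite kx eqxx in px.
Qed.


Section L1_space.
Context d (M : measurableType d) (R : realType) (nu : {measure set M -> \bar R}).
Local Notation L1 := (L1 nu).
Local Notation class f := (Lp_class (f : LfunType nu (@lexx _ _ 1%E))).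

Lemma L1_integrable D (a : L1) : measurable D ->
  nu.-integrable D (EFin \o repr a).
Proof.
move=> mD; apply: (integrableS measurableT) => //.
by apply/Lfun1_integrable; exact: LfunP.
Qed.

Lemma L1_normE (a : L1) : `|a| = \int[nu]_x `|repr a x|.
Proof.
rewrite /Num.norm/= /Lp_norm Lnorm1 /Rintegral; congr fine.
Qed.

Lemma Rintegral_class D f : measurable D ->
  \int[nu]_(x in D) repr (class f) x = \int[nu]_(x in D) f x.
Proof.
move=> mD; congr fine; apply: ae_eq_integral => //.
- exact/measurable_EFinP/measurable_funTS.
- exact/measurable_EFinP/measurable_funTS.
- apply: filterS (repr_Lp_class f) => x fx _ /=; by rewrite fx.
Qed.

Lemma Rintegral_norm_class D f : measurable D ->
  \int[nu]_(x in D) `|repr (class f) x| = \int[nu]_(x in D) `|f x|.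
Proof.
move=> mD; congr fine; apply: ae_eq_integral => //.
- by apply/measurable_EFinP/measurable_funTS; exact: measurableT_comp.
- by apply/measurable_EFinP/measurable_funTS; exact: measurableT_comp.
- apply: filterS (repr_Lp_class f) => x fx _ /=; by rewrite fx.
Qed.

Lemma L1_integral_subproof D : measurable D ->
  ((fun a => \int[nu]_(x in D) repr a x) : L1 -> R) \in bounded_operator L1 R.
Proof.
move=> mD; apply/asboolP; split.
  move=> a x y; elim/Lp_ind: x => f; elim/Lp_ind: y => h.
  have -> : a *: Lp_class f + Lp_class h = Lp_class (a *: f + h) :> L1.
    by rewrite Lp_classD -Lp_scale_class.
  have fi := L1_integrable (class f) mD; have hi := L1_integrable (class h) mD.
  have fi' : nu.-integrable D (EFin \o f).
    by apply: (integrableS measurableT) => //; apply/Lfun1_integrable; exact: LfunP.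
  have hi' : nu.-integrable D (EFin \o h).
    by apply: (integrableS measurableT) => //; apply/Lfun1_integrable; exact: LfunP.
  rewrite !Rintegral_class// RintegralD//; last first.
    rewrite (_ : _ \o _ = (fun x => a%:E * (EFin \o f) x)%E); first exact: integrableZl.
    by apply/funext => x /=; rewrite -EFinM.
  by congr (_ + _); rewrite RintegralZl.
exists 1 => a; rewrite mul1r (le_trans (le_normr_Rintegral _ _))//.
  exact: L1_integrable.
rewrite L1_normE /Rintegral fine_le//.
- by apply: integrable_fin_num => //; exact: integrable_norm (L1_integrable a mD).
- by apply: integrable_fin_num => //; exact: integrable_norm (L1_integrable a measurableT).
- apply: ge0_subset_integral => //.
  by apply/measurable_EFinP; exact: measurableT_comp.
Qed.

Definition L1_integral D (mD : measurable D) : bop L1 R :=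
  Bop (L1_integral_subproof mD).

(** A common partition for finitely many simple functions, indexed by tuples of values; some fibres
    may be empty. *)
Lemma sfun_partition n (g : 'I_n -> {sfun M >-> R}) :
  exists (P : finType) (kap : M -> P) (c : 'I_n -> P -> R),
    (forall p, measurable (kap @^-1` [set p])) /\
    forall j x, g j x = c j (kap x).
Proof.
have /choice[v vE] : forall j, exists s : seq R, range (g j) = [set` s].
  by move=> j; apply/finite_seqP; exact: fimfunP.
pose s := flatten [seq v j | j <- enum 'I_n].
have gs j x : g j x \in s.
  apply/flattenP; exists (v j); first by apply/map_f; rewrite mem_enum.
  by have : [set` v j] (g j x) by rewrite -vE; exists x.
exists {ffun 'I_n -> seq_sub s}, (fun x => [ffun j => SeqSub (gs j x)]),
  (fun j (p : {ffun 'I_n -> seq_sub s}) => ssval (p j)); split=> [p|j x]; last by rewrite ffunE.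
rewrite (_ : _ @^-1` _ = \bigcap_(j in [set: 'I_n]) (g j @^-1` [set ssval (p j)])).
  by apply: fin_bigcap_measurable => // j _; exact: measurable_sfunP.
apply/seteqP; split=> [x /= <- j _ /=|x /= H]; first by rewrite ffunE.
by apply/ffunP => j; apply/val_inj; rewrite ffunE /= H.
Qed.

(** The [b p] are indicators of a finite partition adapted to simple approximations of all the
    [a j], and [theta p] integrates over the [p]-th piece: coordinates on a finite-dimensional [l_1]
    inside [L1]. *)
Lemma L1_approx n (a : 'I_n -> L1) (e : R) : 0 < e ->
  exists (P : finType) (b : P -> L1) (theta : P -> bop L1 R) (c : 'I_n -> P -> R),
  [/\ forall j, `|a j - \sum_p c j p *: b p| <= e,
      forall p p', theta p (b p') = (p == p')%:R * `|b p| &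
      forall x, \sum_p `|theta p x| <= `|x| ].
Proof.
move=> e0.
have /choice[g gP] : forall j, exists g : {sfun M >-> R},
    nu.-integrable setT (EFin \o g) /\ \int[nu]_x `|repr (a j) x - g x| <= e.
  move=> j; have aI := L1_integrable (a j) measurableT.
  have [g [gI _ gcvg]] := approximation_sfun_integrable measurableT aI.
  have /fine_cvgP[_] := gcvg.
  move=> /cvgrPdist_le/(_ e e0)[N _ /(_ N (leqnn N))]; rewrite /= sub0r normrN.
  move=> h; exists (g N); split=> //; apply: le_trans h.
  apply: le_trans (ler_norm _); rewrite /Rintegral le_eqVlt; apply/orP; left; apply/eqP.
  by congr fine; apply: eq_integral => x _; rewrite /= -EFinB.
have gI j := (gP j).1; have ga j := (gP j).2.
have [P [kap [c [mkap gc]]]] := sfun_partition g.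
pose Ind p : M -> R := \1_(kap @^-1` [set p]).
have mInd p : measurable_fun setT (Ind p) by exact: measurable_indic.
(* A piece of infinite measure has no integrable indicator. There [b p] is zero, and [c j p]
   vanishes because [g j] is integrable. *)
pose b p : L1 := if pselect (Ind p \in Lfun nu 1) is left h
  then Lp_class (Lfun_Sub (@lexx _ _ 1%E) h) else 0.
pose bf p : LfunType nu (@lexx _ _ 1%E) := if pselect (Ind p \in Lfun nu 1) is left h
  then Lfun_Sub (@lexx _ _ 1%E) h else 0.
have bE p : b p = Lp_class (bf p).
  rewrite /b /bf; case: pselect => // _.
  by apply: (addrI (Lp_class 0)); rewrite addr0 -Lp_classD addr0.
have bfE j p x : c j p * bf p x = c j p * Ind p x.
  rewrite /bf; case: pselect => // h.
  have [->|c0] := eqVneq (c j p) 0; first by rewrite !mul0r.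
  exfalso; apply: h; apply/Lfun1_integrable.
  pose k y := c j p * Ind p y.
  have cI : nu.-integrable setT (EFin \o k).
    apply: le_integrable (gI j) => //.
      by apply/measurable_EFinP; exact: measurable_funM.
    move=> y _ /=; rewrite lee_fin /k normrM /Ind indicE.
    case: (boolP (y \in _)) => [|_]; last by rewrite normr0 mulr0.
    by rewrite inE /= normr1 mulr1 gc => ->.
  rewrite (_ : _ \o _ = (fun x => ((c j p)^-1)%:E * (EFin \o k) x)%E).
    exact: integrableZl.
  by apply/funext => y /=; rewrite -EFinM /k mulKf.
have bfi p p' x : kap x = p -> bf p' x = (p == p')%:R * bf p x.
  move=> kx; have [<-|pp'] := eqVneq; first by rewrite mul1r.
  rewrite mul0r /bf; case: pselect => // h /=.
  by rewrite /Ind indicE memNset// /= kx; exact/eqP.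
have bf0 p x : 0 <= bf p x.
  by rewrite /bf; case: pselect => // h /=; rewrite /Ind indicE.
have bfo p x : kap x != p -> bf p x = 0.
  move=> /eqP kx; rewrite /bf; case: pselect => // h /=.
  by rewrite /Ind indicE memNset.
exists P, b, (fun p => L1_integral (mkap p)), c; split.
- move=> j; pose h := repr (a j) - \sum_p c j p *: bf p.
  have -> : a j - \sum_p c j p *: b p = Lp_class h.
    have sumE : Lp_class (\sum_p c j p *: bf p) = \sum_p c j p *: b p :> L1.
      elim/big_ind2 : _ => [|x1 x2 y1 y2 <- <-|p _].
      + by apply: (addrI (Lp_class 0)); rewrite addr0 -Lp_classD addr0.
      + by rewrite Lp_classD.
      + by rewrite bE -Lp_scale_class.
    rewrite -sumE /h -[in LHS](reprK (a j)).
    apply: (addIr (Lp_class (\sum_p c j p *: bf p))).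
    by rewrite subrK -Lp_classD subrK.
  rewrite L1_normE Rintegral_norm_class//; apply: le_trans (ga j).
  rewrite le_eqVlt; apply/orP; left; apply/eqP; apply: eq_Rintegral => x _.
  congr `|_|; rewrite /h.
  have -> : (repr (a j) - \sum_p c j p *: bf p) x = repr (a j) x - (\sum_p c j p *: bf p) x by [].
  congr (_ - _).
  have -> : (\sum_p c j p *: bf p) x = \sum_p c j p * bf p x.
    by elim/big_ind2 : _ => // y1 y2 z1 z2 <- <-.
  rewrite (bigD1 (kap x))//= big1 ?addr0 ?bfE.
    by rewrite gc /Ind indicE mem_set// mulr1.
  by move=> p px; rewrite bfo ?mulr0// eq_sym.
- move=> p p' /=; rewrite bE Rintegral_class//.
  have -> : `|b p| = \int[nu]_(x in kap @^-1` [set p]) bf p x.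
    rewrite bE L1_normE Rintegral_norm_class// [RHS]Rintegral_mkcond.
    apply: eq_Rintegral => x _; rewrite ger0_norm// patchE.
    by case: ifPn => //; rewrite notin_setE /= => /eqP/bfo.
  have [<-|pp'] := eqVneq p p'; first by rewrite mul1r.
  rewrite mul0r -[RHS](mul0r (fine (nu (kap @^-1` [set p])))) -Rintegral_cst//.
  apply: eq_Rintegral => x; rewrite inE /= => kx.
  by rewrite (bfi p)// (negPf pp') mul0r.
- move=> x.
  have aI := L1_integrable x measurableT.
  apply: (@le_trans _ _ (\sum_p \int[nu]_(t in kap @^-1` [set p]) `|repr x t|)).
    by apply: ler_sum => p _; apply: le_normr_Rintegral => //; exact: L1_integrable.
  rewrite L1_normE -lee_fin -sumEFin.
  have mx : measurable_fun setT (fun t => `|repr x t|%:E : \bar R).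
    by apply/measurable_EFinP; exact: measurableT_comp.
  have fin D : measurable D ->
      (\int[nu]_(t in D) `|repr x t|)%:E = (\int[nu]_(t in D) `|repr x t|%:E)%E.
    move=> mD; rewrite fineK//; apply: integrable_fin_num => //.
    exact: integrable_norm (L1_integrable x mD).
  rewrite fin// (eq_bigr _ (fun p _ => fin _ (mkap p))).
  by rewrite sum_integral_preimage.
Qed.

End L1_space.

Section ell2_more.
Context {R : realType}.
Local Notation ell2 := (ell2 R).

Lemma le_norm_coord (x y : ell2) :
  (forall k, `|coord k x| <= `|coord k y|) -> `|x| <= `|y|.
Proof.
move=> xy; rewrite -(ler_pXn2r (n:=2))// ?nnegrE// -lee_fin !ell2_normE.
apply: lee_nneseries => [k _ _|k _]; first by rewrite lee_fin sqr_ge0.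
rewrite lee_fin -[leLHS]real_normK ?num_real// -[leRHS]real_normK ?num_real//.
by rewrite lerXn2r ?nnegrE.
Qed.

Lemma ell2_ext (x y : ell2) : (forall k, coord k x = coord k y) -> x = y.
Proof.
move=> xy; apply/eqP; rewrite -subr_eq0 -normr_le0 -[leRHS](@normr0 _ ell2).
by apply: le_norm_coord => k; rewrite linearB/= xy subrr linear0.
Qed.

Lemma norm_sub_trunc_le (x : ell2) m n : (m <= n)%N ->
  `|x - trunc n x| <= `|x - trunc m x|.
Proof.
move=> mn; apply: le_norm_coord => k; rewrite !linearB/= !coord_trunc.
case: ifPn => [_|kn]; first by rewrite subrr normr0.
by case: ifPn => // km; move: kn; rewrite (leq_trans km mn).
Qed.

Lemma trunc_cvg_fin (I : finType) (x : I -> ell2) (e : R) : 0 < e ->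
  exists n, forall i, `|x i - trunc n (x i)| < e.
Proof.
move=> e0; have /choice[n nP] := fun i => trunc_cvg (x i) e0.
exists (\max_i n i)%N => i; apply: le_lt_trans (nP i).
exact/norm_sub_trunc_le/leq_bigmax.
Qed.

(** Coordinates are read along an injection because the gliding hump stores its rows at coded
    positions. *)
Lemma sum_coord_inj_le n (s : 'I_n -> nat) (z : ell2) : injective s ->
  \sum_j coord (s j) z ^+ 2 <= `|z| ^+ 2.
Proof.
move=> sI; pose N := (\max_j s j).+1.
have sN j : (s j < N)%N by rewrite ltnS leq_bigmax.
pose s' j := Ordinal (sN j); have s'I : injective s'.
  by move=> i j /(congr1 val)/= /sI.
apply: le_trans (sum_coord_le z N).
rewrite (bigID (mem (codom s')))/= -[leLHS]addr0 lerD//; last first.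
  by apply: sumr_ge0 => i _; rewrite sqr_ge0.
rewrite -big_uniq; last by rewrite /codom /image_mem map_inj_uniq ?enum_uniq.
by rewrite /codom big_image.
Qed.

Lemma norm_sum_coordf_le n (xi : 'I_n -> R) : \sum_j xi j ^+ 2 <= 1 ->
  `|\sum_j xi j *: coordf (R := R) j : bop ell2 R| <= 1.
Proof.
move=> xi1; apply: opnorm_le => // z; rewrite mul1r.
have -> : (\sum_j xi j *: coordf j : bop ell2 R) z = \sum_j xi j * coord j z.
  by elim/big_ind2 : _ => // f a f' a' <- <-.
rewrite (le_trans (normr_sum_mul_le _ _))// -[leRHS]mul1r ler_pM ?sqrtr_ge0//.
  by rewrite -[leRHS](sqrtr1 R) ler_wsqrtr.
by rewrite -[leRHS]ger0_norm// -sqrtr_sqr; exact/ler_wsqrtr/sum_coord_le.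
Qed.

End ell2_more.

Section trace.
Context {R : realType} (X : normedModType R).
Local Notation ell2 := (ell2 R).

Lemma sqrt_sum_sqr_le_functional (f : bop ell2 R) n :
  Num.sqrt (\sum_(k < n) f (ell2_basis R k) ^+ 2) <= `|f|.
Proof.
rewrite -[leRHS]ger0_norm// -sqrtr_sqr; exact/ler_wsqrtr/functional_basis_le.
Qed.

Lemma sqrt_sum_sqr_le_add n (a b : 'I_n -> R) :
  Num.sqrt (\sum_j a j ^+ 2) <=
  Num.sqrt (\sum_j b j ^+ 2) + \sum_j `|a j - b j|.
Proof.
have E c : Num.sqrt (\sum_j c j ^+ 2) = `|\sum_(j < n) c j *: ell2_basis R j|.
  by rewrite -norm_sum_basis sqrtr_sqr ger0_norm.
rewrite !E -lerBlDl (le_trans (lerB_dist _ _))// -sumrB (le_trans (ler_norm_sum _ _ _))//.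
apply: ler_sum => j _; rewrite -scalerBl normrZ ler_piMr//.
have := norm_sum_basis (fun i : 'I_j.+1 => (val i == j)%:R : R).
rewrite big_ord_recr/= eqxx scale1r big1 ?add0r; last first.
  by move=> i _; rewrite (ltn_eqF (ltn_ord i)) scale0r.
rewrite big_ord_recr/= eqxx expr1n big1 ?add0r; last first.
  by move=> i _; rewrite (ltn_eqF (ltn_ord i)) expr0n.
by move=> /eqP; rewrite sqrp_eq1// => /eqP ->.
Qed.

(* On the span of indicator functions b_p of disjoint sets the trace of B A T
   is at most |B| sum_p |b_p| |c_p|, and |b_p| |c_p| is nearly the norm of the
   adjoint of T at theta_p A, where the theta_p are disjointly supported. *)
Lemma trace_factorization_le d (M : measurableType d) (nu : {measure set M -> \bar R})
    (A : bop X (L1 nu)) (B : bop (L1 nu) ell2) (T : bop ell2 X) C n (s : 'I_n -> nat) :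
  injective s -> summing_constant 1 (adjoint T) C ->
  `|\sum_j coord (s j) (B (A (T (ell2_basis R j))))| <= (`|A| + 1) * `|B| * C.
Proof.
move=> sI CT; have C0 : 0 <= C by case: CT.
apply/ler_addgt0Pr => e e0.
(* Replacing [a j] by [g j] costs [n * |B| * eta] twice, in the trace and in the adjoint norms; [D]
   absorbs both and is positive. *)
pose D := 2 * (n%:R * `|B|) + 1.
have D0 : 0 < D by rewrite ltr_wpDl ?mulr_ge0.
pose eta := e / D; have eta0 : 0 < eta by rewrite divr_gt0.
pose a (j : 'I_n) := A (T (ell2_basis R j)).
have [P [b [theta [c [ac thb th1]]]]] := L1_approx a eta0.
pose g j := \sum_p c j p *: b p.
have -> : \sum_j coord (s j) (B (a j)) =
    \sum_j coord (s j) (B (g j)) + \sum_j coord (s j) (B (a j - g j)).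
  by rewrite -big_split; apply: eq_bigr => j _; rewrite /= !linearB/= addrC subrK.
have small : `|\sum_j coord (s j) (B (a j - g j))| <= n%:R * `|B| * eta.
  rewrite (le_trans (ler_norm_sum _ _ _))//.
  rewrite -mulrA -[n in n%:R]card_ord mulr_natl -sumr_const; apply: ler_sum => j _.
  rewrite (le_trans (normr_coord _ _))// (le_trans (le_opnorm _ _))//.
  by rewrite ler_wpM2l ?opnorm_ge0 ?ac.
have thg p j : theta p (g j) = c j p * `|b p|.
  rewrite linear_sum/= (bigD1 p)//= functionalZ thb eqxx mul1r big1 ?addr0// => p' pp'.
  by rewrite functionalZ thb eq_sym (negPf pp') mul0r mulr0.
have main : `|\sum_j coord (s j) (B (g j))| <=
    `|B| * \sum_p Num.sqrt (\sum_j theta p (g j) ^+ 2).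
  have -> : \sum_j coord (s j) (B (g j)) =
      \sum_p \sum_j c j p * coord (s j) (B (b p)).
    rewrite exchange_big; apply: eq_bigr => j _ /=.
    by rewrite !linear_sum/=; apply: eq_bigr => p _; rewrite linearZ coordZ.
  rewrite (le_trans (ler_norm_sum _ _ _))// big_distrr/=; apply: ler_sum => p _.
  rewrite (le_trans (normr_sum_mul_le _ _))//.
  have -> : Num.sqrt (\sum_j theta p (g j) ^+ 2) = Num.sqrt (\sum_j c j p ^+ 2) * `|b p|.
    under eq_bigr do rewrite thg exprMn.
    by rewrite -big_distrl/= sqrtrM ?sumr_ge0// ?sqrtr_sqr ?normr_id// => i _; rewrite sqr_ge0.
  rewrite mulrCA ler_wpM2l ?sqrtr_ge0//; apply: le_trans (le_opnorm B (b p)).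
  by rewrite -[leRHS]ger0_norm// -sqrtr_sqr; exact/ler_wsqrtr/sum_coord_inj_le.
have key : \sum_p Num.sqrt (\sum_j theta p (g j) ^+ 2) <=
    C * (`|A| + 1) + n%:R * eta.
  apply: (@le_trans _ _ (\sum_p (`|adjoint T (bop_comp (theta p) A)| +
      \sum_j `|theta p (g j - a j)|))).
    apply: ler_sum => p _.
    rewrite (le_trans (sqrt_sum_sqr_le_add _ (fun j => theta p (a j))))// lerD//.
      exact: (sqrt_sum_sqr_le_functional (adjoint T (bop_comp (theta p) A))).
    by apply: ler_sum => j _; rewrite linearB.
  rewrite big_split lerD//=; last first.
    rewrite exchange_big -[n in n%:R]card_ord mulr_natl -sumr_const; apply: ler_sum => j _ /=.
    by rewrite (le_trans (th1 _))// distrC ac.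
  have A1 : 0 < `|A| + 1 by rewrite ltr_wpDl.
  have := summing_constant_fin (I := P) (x := fun p => bop_comp (theta p) A) ltr01 CT A1.
  have pow1 (F : P -> R) : \sum_p `|F p| `^ 1 = \sum_p `|F p|.
    by apply: eq_bigr => p _; rewrite powRr1.
  rewrite [(_ * _) `^ 1]powRr1 ?mulr_ge0 ?(ltW A1)//.
  rewrite (eq_bigr (fun p => `|adjoint T (bop_comp (theta p) A)|)); last first.
    by move=> p _; rewrite powRr1.
  apply=> F F1; rewrite (pow1 (fun p => F (bop_comp (theta p) A))) powRr1 ?(ltW A1)//.
  (* Signs turn the weak sum into the value of [F] at one functional, whose norm [th1] bounds by
     [|A|]. *)
  pose sg p := Num.sg (F (bop_comp (theta p) A)).
  have -> : \sum_p `|F (bop_comp (theta p) A)| = F (\sum_p sg p *: bop_comp (theta p) A).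
    by rewrite linear_sum/=; apply: eq_bigr => p _; rewrite functionalZ normrEsg.
  rewrite (le_trans (ler_norm _))// (le_trans (le_opnorm _ _))//.
  rewrite (le_trans (ler_wpM2r _ F1))// mul1r.
  apply: opnorm_le => [|x]; first exact: ltW.
  have -> : (\sum_p sg p *: bop_comp (theta p) A : bop X R) x =
      \sum_p sg p * theta p (A x).
    by elim/big_ind2 : _ => // f u f' u' <- <-.
  rewrite (le_trans (ler_norm_sum _ _ _))//.
  apply: (@le_trans _ _ (\sum_p `|theta p (A x)|)).
    apply: ler_sum => p _; rewrite normrM normr_sg ler_piMl//.
    by case: (_ != _).
  rewrite (le_trans (th1 _))// (le_trans (le_opnorm _ _))// ler_wpM2r//.
  by rewrite lerDl.
rewrite (le_trans (ler_normD _ _))//.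
apply: le_trans (lerD (le_trans main (ler_wpM2l _ key)) small) _; first exact: normr_ge0.
have : D * eta <= e by rewrite mulrC divfK// gt_eqF.
have : 0 <= eta by exact: ltW.
rewrite /D mulrDl mul1r mulrDr; lra.
Qed.

End trace.

(** * GL2 and finite cotype imply (S) *)

Section GL2_uniform.
Context {R : realType} (X : normedModType R).
Local Notation ell2 := (ell2 R).

(* The 1-summing norm of x |-> (h_j x)_j is at most D. *)
Definition rows_summing n (h : 'I_n -> bop X R) (D : R) : Prop :=
  forall (I : finType) (y : I -> X),
    (forall f : bop X R, `|f| <= 1 -> \sum_k `|f (y k)| <= 1) ->
    \sum_k Num.sqrt (\sum_j h j (y k) ^+ 2) <= D.

Lemma rows_summing_sum n (h : 'I_n -> bop X R) D (I : finType) (y : I -> X) M :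
  0 < M -> rows_summing h D ->
  (forall f : bop X R, `|f| <= 1 -> \sum_k `|f (y k)| <= M) ->
  \sum_k Num.sqrt (\sum_j h j (y k) ^+ 2) <= D * M.
Proof.
move=> M0 hD yM; have Mi : 0 <= M^-1 by rewrite invr_ge0 ltW.
have := hD I (fun k => M^-1 *: y k).
have -> : \sum_k Num.sqrt (\sum_j h j (M^-1 *: y k) ^+ 2) =
    M^-1 * \sum_k Num.sqrt (\sum_j h j (y k) ^+ 2).
  rewrite big_distrr/=; apply: eq_bigr => k _.
  under eq_bigr do rewrite functionalZ exprMn.
  by rewrite -big_distrr/= sqrtrM ?sqr_ge0// sqrtr_sqr ger0_norm.
rewrite ler_pdivrMl// mulrC; apply=> f f1.
under eq_bigr do rewrite functionalZ normrM (ger0_norm Mi).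
by rewrite -big_distrr/= ler_pdivrMl// mulr1 yM.
Qed.

Lemma rows_summing_norm n (h : 'I_n -> bop X R) D x :
  rows_summing h D -> Num.sqrt (\sum_j h j x ^+ 2) <= D * `|x|.
Proof.
move=> hD; have [->|x0] := eqVneq x 0.
  rewrite normr0 mulr0 big1 ?sqrtr0// => j _.
  by rewrite linear0 expr0n.
have xp : 0 < `|x| by rewrite normr_gt0.
have := rows_summing_sum (I := 'I_1) (y := fun=> x) xp hD.
rewrite big_ord1; apply=> f f1; rewrite big_ord1 (le_trans (le_opnorm _ _))//.
by rewrite ler_piMl.
Qed.

Lemma geometric_half_le m : \sum_(i < m) 2 ^- i <= 2 :> R.
Proof.
suff -> : \sum_(i < m) 2 ^- i = 2 - 2 * 2 ^- m :> R.
  by rewrite gerBl mulr_ge0 ?invr_ge0 ?exprn_ge0.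
elim: m => [|m IH]; first by rewrite big_ord0 expr0 invr1 mulr1 subrr.
by rewrite big_ord_recr/= IH exprS invfM; field; rewrite expf_neq0.
Qed.

Section gliding_hump.
Local Notation encode := (@choice.pickle (nat * nat)%type).
Local Notation decode := (@choice.pickle_inv (nat * nat)%type).
Variables (n : nat -> nat) (h : forall m, 'I_(n m) -> bop X R).
Hypothesis h1 : forall m, rows_summing (@h m) 1.

Let V m x := Num.sqrt (\sum_j @h m j x ^+ 2).

(** Coordinates of one operator [u] that contains all the families: row [i] of the [m]-th one sits
    at the code of [(m, i)] with weight [2^-m], so that the 1-summing constants add up to at most
    [2]. *)
Let F (l : nat) (x : X) : R :=
  if decode l is Some (m, j) then
    (if insub j is Some i then 2 ^- m * @h m i x else 0)
  else 0.

Let F_pickle m (i : 'I_(n m)) x : F (encode (m, val i)) x = 2 ^- m * @h m i x.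
Proof. by rewrite /F choice.pickleK_inv valK. Qed.

Let F_linear l a x y : F l (a *: x + y) = a * F l x + F l y.
Proof.
rewrite /F; case: pickle_inv => [[m j]|]; last by rewrite mulr0 addr0.
case: insubP => [i _ _|_]; last by rewrite mulr0 addr0.
by rewrite linearP/= mulrDr mulrCA.
Qed.

(** Finitely many coordinates meet finitely many blocks, and the Hilbert norm of the sequence of
    block norms is at most its sum. *)
Let sum_F_le N : exists L0, forall L, (L0 <= L)%N -> forall x,
  \sum_(l < N) F l x ^+ 2 <= (\sum_(m < L) 2 ^- m * V m x) ^+ 2.
Proof.
pose ix (l : nat) : nat := if decode l is Some (m, j) then m else 0%N.
exists (\max_(l < N) ix l).+1 => L L0 x.
have V0 m : 0 <= 2 ^- m * V m x.
  by rewrite mulr_ge0 ?invr_ge0 ?exprn_ge0 ?sqrtr_ge0.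
apply: (@le_trans _ _ (\sum_(m < L) (2 ^- m * V m x) ^+ 2)); last first.
  elim: L {L0} => [|L IH]; first by rewrite !big_ord0 expr0n.
  rewrite !big_ord_recr/=; set s := \sum_(m < L) 2 ^- m * V m x in IH *.
  have s0 : 0 <= s by exact: sumr_ge0.
  rewrite sqrrD lerD2r (le_trans IH)// lerDl mulrn_wge0// mulr_ge0//.
pose G m (i : 'I_(n m)) := (2 ^- m * @h m i x) ^+ 2.
have G0 m i : 0 <= G m i by exact: sqr_ge0.
have -> : \sum_(m < L) (2 ^- m * V m x) ^+ 2 = \sum_(m < L) \sum_(i < n m) G m i.
  apply: eq_bigr => m _; rewrite exprMn sqr_sqrtr; last first.
    by apply: sumr_ge0 => i _; exact: sqr_ge0.
  by rewrite big_distrr/=; apply: eq_bigr => i _; rewrite /G exprMn.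
apply: (@le_trans _ _ (\sum_(l < N) \sum_(m < L) \sum_(i < n m)
    (encode (val m, val i) == l)%:R * G m i)).
  apply: ler_sum => l _; rewrite /F; case El : (decode l) => [[m j]|]; last first.
    rewrite expr0n; apply: sumr_ge0 => m _; apply: sumr_ge0 => i _.
    by rewrite mulr_ge0// ler0n.
  case: insubP => [i _ ij|_]; last first.
    rewrite expr0n; apply: sumr_ge0 => m' _; apply: sumr_ge0 => i _.
    by rewrite mulr_ge0// ler0n.
  have mL : (m < L)%N.
    apply: leq_trans L0; rewrite ltnS (leq_trans _ (leq_bigmax l))//.
    by rewrite /ix El.
  have pk : encode (m, j) = l by have := @choice.pickle_invK (nat * nat)%type l; rewrite El.
  rewrite (bigD1 (Ordinal mL))//= (bigD1 i)//= ij pk eqxx mul1r -addrA lerDl.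
  apply: addr_ge0; first by apply: sumr_ge0 => i' _; rewrite mulr_ge0// ler0n.
  apply: sumr_ge0 => m' _; apply: sumr_ge0 => i' _.
  by rewrite mulr_ge0// ler0n.
rewrite exchange_big; apply: ler_sum => m _; rewrite exchange_big; apply: ler_sum => i _.
rewrite -big_distrl/= ler_piMl//.
have [pN|pN] := ltnP (encode (val m, val i)) N.
  rewrite (bigD1 (Ordinal pN))//= eqxx big1 ?addr0// => l lp.
  by rewrite eq_sym -[encode _]/(val (Ordinal pN)) val_eqE (negPf lp).
rewrite big1// => l _; rewrite gtn_eqF//.
exact: leq_trans (ltn_ord l) pN.
Qed.

Let sum_F_norm x N : \sum_(l < N) F l x ^+ 2 <= (2 * `|x|) ^+ 2.
Proof.
have [L HL] := sum_F_le N; apply: le_trans (HL L (leqnn L) x) _.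
have s0 : 0 <= \sum_(m < L) 2 ^- m * V m x.
  by apply: sumr_ge0 => m _; rewrite mulr_ge0 ?invr_ge0 ?exprn_ge0 ?sqrtr_ge0.
rewrite lerXn2r ?nnegrE ?mulr_ge0//.
apply: (@le_trans _ _ (\sum_(m < L) 2 ^- m * `|x|)).
  apply: ler_sum => m _; rewrite ler_wpM2l ?invr_ge0 ?exprn_ge0//.
  by have := rows_summing_norm x (h1 m); rewrite mul1r.
by rewrite -big_distrl/= ler_wpM2r// geometric_half_le.
Qed.

Let ufun x : ell2 :=
  s2val (cid2 (ell2_of_coord (c := F^~ x) (mulr_ge0 (ler0n R 2) (normr_ge0 x)) (sum_F_norm x))).

Let coord_u l x : coord l (ufun x) = F l x.
Proof. by rewrite /ufun; case: cid2. Qed.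

Let u_subproof : ufun \in bounded_operator X ell2.
Proof.
apply/asboolP; split.
  by move=> a x y; apply: ell2_ext => l; rewrite linearP/= !coord_u F_linear.
by exists 2 => x; rewrite /ufun; case: cid2.
Qed.

Let u : bop X ell2 := Bop u_subproof.

Let u_le x (eta : R) : 0 < eta -> exists L0, forall L, (L0 <= L)%N ->
  `|u x| <= \sum_(m < L) 2 ^- m * V m x + eta.
Proof.
move=> eta0; have [N uN] := trunc_cvg (u x) eta0.
have [L0 HL] := sum_F_le N; exists L0 => L LL.
have s0 : 0 <= \sum_(m < L) 2 ^- m * V m x.
  by apply: sumr_ge0 => m _; rewrite mulr_ge0 ?invr_ge0 ?exprn_ge0 ?sqrtr_ge0.
rewrite -[u x](subrK (trunc N (u x))) addrC (le_trans (ler_normD _ _))//.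
rewrite lerD ?(ltW uN)// -(ler_pXn2r (n:=2))// ?nnegrE// norm_sum_basis.
apply: le_trans (HL L LL x); apply: ler_sum => l _.
by rewrite /= coord_u.
Qed.

Let u_summing : summing 1 u.
Proof.
exists 2; apply/summing_constantP => // k y M M0 yM.
rewrite powRr1 ?mulr_ge0 ?(ltW M0)//.
rewrite (eq_bigr (fun i => `|u (y i)|)); last by move=> i _; rewrite powRr1.
have {}yM (f : bop X R) : `|f| <= 1 -> \sum_i `|f (y i)| <= M.
  move=> /yM; rewrite powRr1 ?(ltW M0)//.
  by rewrite (eq_bigr (fun i => `|f (y i)|))// => i _; rewrite powRr1.
apply/ler_addgt0Pr => e e0; pose eta := e / k.+1%:R.
have eta0 : 0 < eta by rewrite divr_gt0 ?ltr0n.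
have /choice[L0 HL] := fun i => u_le (y i) eta0.
pose L := (\max_i L0 i)%N.
apply: (@le_trans _ _ (\sum_(i < k) (\sum_(m < L) 2 ^- m * V m (y i) + eta))).
  by apply: ler_sum => i _; exact/HL/leq_bigmax.
rewrite big_split/= lerD//; last first.
  rewrite sumr_const card_ord -mulr_natl mulrA ler_pdivrMr ?ltr0n//.
  by rewrite mulrC ler_pM2l// ler_nat.
rewrite exchange_big/=.
apply: (@le_trans _ _ (\sum_(m < L) 2 ^- m * M)).
  apply: ler_sum => m _; rewrite -big_distrr/= ler_wpM2l ?invr_ge0 ?exprn_ge0//.
  by have := rows_summing_sum M0 (h1 m) yM; rewrite mul1r.
by rewrite -big_distrl/= ler_wpM2r ?(ltW M0)// geometric_half_le.
Qed.

(** The factorisation of [u] bounds the trace of each block: it is read off [u] at the injective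
    positions [s], and undoing its weight costs [2^m]. *)
Lemma GL2_gliding_hump : GL2 X -> exists c : R, 0 <= c /\ forall m (T : bop ell2 X),
  summing_constant 1 (adjoint T) 1 ->
  `|\sum_j @h m j (T (ell2_basis R j))| <= 2 ^+ m * c.
Proof.
move=> /(_ _ u_summing)[d [M [nu [A [B uE]]]]].
exists ((`|A| + 1) * `|B|); split=> [|m T T1].
  by rewrite mulr_ge0// addr_ge0.
pose s (j : 'I_(n m)) : nat := encode (m, val j).
have sI : injective s.
  by move=> i j /(pcan_inj (@choice.pickleK (nat * nat)%type))[] /val_inj.
have := trace_factorization_le A B sI T1.
have -> : \sum_j coord (s j) (B (A (T (ell2_basis R j)))) =
    2 ^- m * \sum_j @h m j (T (ell2_basis R j)).
  rewrite big_distrr/=; apply: eq_bigr => j _.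
  have -> : B (A (T (ell2_basis R j))) = u (T (ell2_basis R j)) by rewrite uE.
  by rewrite /= coord_u F_pickle.
rewrite normrM normfV (ger0_norm (exprn_ge0 m (ler0n R 2))) ler_pdivrMl ?exprn_gt0//.
by rewrite mulr1.
Qed.

End gliding_hump.

(** Otherwise, after normalisation, some families have traces above [4^m] for each [m]; stacked with
    weights [2^-m] they contradict the bound [2^m * c] once [2^m] exceeds [c]. *)
Lemma GL2_trace_le : GL2 X -> exists K : R, 0 <= K /\
  forall n (h : 'I_n -> bop X R) (T : bop ell2 X) D C, 0 < D -> 0 < C ->
    rows_summing h D -> summing_constant 1 (adjoint T) C ->
    `|\sum_j h j (T (ell2_basis R j))| <= K * D * C.
Proof.
move=> GL; suff [K [K0 HK]] : exists K : R, 0 <= K /\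
    forall n (h : 'I_n -> bop X R) (T : bop ell2 X),
    rows_summing h 1 -> summing_constant 1 (adjoint T) 1 ->
    `|\sum_j h j (T (ell2_basis R j))| <= K.
  exists K; split=> // n h T D C D0 C0 hD TC.
  have := HK n (fun j => D^-1 *: h j) (C^-1 *: T).
  have -> : \sum_j (D^-1 *: h j) ((C^-1 *: T) (ell2_basis R j)) =
      (C^-1 * D^-1) * \sum_j h j (T (ell2_basis R j)).
    rewrite big_distrr/=; apply: eq_bigr => j _.
    rewrite -[LHS]/(D^-1 * h j (C^-1 *: T (ell2_basis R j))) functionalZ.
    by ring.
  rewrite normrM ger0_norm ?mulr_ge0 ?invr_ge0 ?(ltW C0) ?(ltW D0)//.
  move=> H; rewrite (_ : K * D * C = D * (C * K)); last by ring.
  rewrite -ler_pdivrMl// -ler_pdivrMl// mulrA; apply: H.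
    move=> I y y1; have hy := hD I y y1.
    have -> : \sum_k Num.sqrt (\sum_j (D^-1 *: h j) (y k) ^+ 2) =
        D^-1 * \sum_k Num.sqrt (\sum_j h j (y k) ^+ 2).
      rewrite big_distrr/=; apply: eq_bigr => k _.
      have Di : 0 <= D^-1 by rewrite invr_ge0 ltW.
      rewrite -[in RHS](ger0_norm Di) -sqrtr_sqr -sqrtrM ?sqr_ge0// big_distrr/=.
      by congr Num.sqrt; apply: eq_bigr => j _; rewrite -exprMn.
    by rewrite ler_pdivrMl// mulr1.
  apply/summing_constantP => // k f M M0 fM.
  have := (summing_constantP (adjoint T) ltr01 (ltW C0)).1 TC k f M M0 fM.
  rewrite !powRr1 ?mulr_ge0 ?(ltW M0) ?(ltW C0)// mul1r.
  have -> : \sum_i `|adjoint (C^-1 *: T) (f i)| `^ 1 =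
      C^-1 * \sum_i `|adjoint T (f i)| `^ 1.
    rewrite big_distrr/=; apply: eq_bigr => i _; rewrite !powRr1//.
    have Ci : 0 <= C^-1 by rewrite invr_ge0 ltW.
    rewrite -[in RHS](ger0_norm Ci) -normrZ; congr `|_|.
    by apply/val_inj/funext => z /=; rewrite functionalZ.
  by rewrite ler_pdivrMl.
apply: contrapT => /forallNP H.
have {}H (m : nat) : exists n (h : 'I_n -> bop X R), rows_summing h 1 /\
    exists T : bop ell2 X, summing_constant 1 (adjoint T) 1 /\
      2 ^+ (2 * m) < `|\sum_j h j (T (ell2_basis R j))|.
  apply: contrapT => Hm; apply: (H (2 ^+ (2 * m))); split; first exact: exprn_ge0.
  move=> n h T h1 T1; rewrite leNgt; apply/negP => lt.
  by apply: Hm; exists n, h; split=> //; exists T.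
pose n m := sval (cid (H m)); pose h m := sval (cid (svalP (cid (H m)))).
have [h1 hT] := all_and2 (fun m => svalP (cid (svalP (cid (H m))))).
have [c [c0 hc]] := GL2_gliding_hump h1 GL.
pose m := Num.bound c.
have [T [T1]] := hT m; rewrite ltNge => /negP; apply.
rewrite (le_trans (hc m T T1))// mul2n -addnn exprD ler_wpM2l ?exprn_ge0//.
rewrite (le_trans (ltW (archi_boundP c0)))// -/m -natrX ler_nat ltnW//.
exact: ltn_expl.
Qed.

End GL2_uniform.

Section GL2_property_S.
Context {R : realType} (X : normedModType R).
Local Notation ell2 := (ell2 R).

Lemma expr_mul_le_add (t s : R) n : 0 <= t -> 0 <= s ->
  t ^+ n * s <= t ^+ n.+1 + s ^+ n.+1.
Proof.
move=> t0 s0; have [st|/ltW ts] := leP s t.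
  by rewrite exprSr -[leLHS]addr0 lerD ?exprn_ge0// ler_wpM2l ?exprn_ge0.
rewrite -[leLHS]add0r lerD ?exprn_ge0// exprSr ler_wpM2r//.
by rewrite lerXn2r ?nnegrE.
Qed.

(** Holder's inequality for the exponents [(n+1)/n] and [n+1], up to a factor [2]: both families are
    normalised and the elementary inequality is summed. *)
Lemma sum_expr_mul_le (I : finType) (t s : I -> R) n (th om : R) :
  (forall i, 0 <= t i) -> (forall i, 0 <= s i) -> 0 < th -> 0 < om ->
  \sum_i t i ^+ n.+1 <= th ^+ n.+1 -> \sum_i s i ^+ n.+1 <= om ^+ n.+1 ->
  \sum_i t i ^+ n * s i <= 2 * om * th ^+ n.
Proof.
move=> t0 s0 th0 om0 tth som.
have le1 (u : I -> R) a : 0 < a -> \sum_i u i ^+ n.+1 <= a ^+ n.+1 ->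
    \sum_i (u i / a) ^+ n.+1 <= 1.
  move=> a0 ua; rewrite (eq_bigr (fun i => a ^- n.+1 * u i ^+ n.+1)).
    by rewrite -big_distrr/= ler_pdivrMl ?exprn_gt0// mulr1.
  by move=> i _; rewrite exprMn exprVn mulrC.
have -> : \sum_i t i ^+ n * s i =
    (om * th ^+ n) * \sum_i (t i / th) ^+ n * (s i / om).
  rewrite big_distrr/=; apply: eq_bigr => i _; rewrite exprMn exprVn.
  have : th ^+ n != 0 by rewrite expf_neq0 ?gt_eqF.
  have : om != 0 by rewrite gt_eqF.
  by move: (th ^+ n) (t i ^+ n) => z v om_ z0; field; rewrite ?om_ ?z0.
rewrite -[leRHS]mulrA mulrC ler_wpM2r ?mulr_ge0 ?exprn_ge0 ?(ltW om0) ?(ltW th0)//.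
apply: (@le_trans _ _ (\sum_i ((t i / th) ^+ n.+1 + (s i / om) ^+ n.+1))).
  by apply: ler_sum => i _; rewrite expr_mul_le_add// divr_ge0// ltW.
by rewrite big_split/= -[leRHS]/(1 + 1) lerD ?le1.
Qed.

Section estimate.
Variables (q : nat) (K K1 : R) (T : bop ell2 X) (C : R).
Hypothesis K0 : 0 <= K.
Hypothesis cotX : sign_bounded_power_sums X q.+1 K.
Hypothesis K10 : 0 <= K1.
Hypothesis trK1 : forall n (h : 'I_n -> bop X R) (T : bop ell2 X) D C, 0 < D -> 0 < C ->
    rows_summing h D -> summing_constant 1 (adjoint T) C ->
    `|\sum_j h j (T (ell2_basis R j))| <= K1 * D * C.
Hypothesis C0 : 0 < C.
Hypothesis TC : summing_constant 1 (adjoint T) C.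

Let P := (2 * q.+1)%N.
Let Pm := (2 * q).+1.
Let PE : P = Pm.+1. Proof. by rewrite /P mulnS. Qed.
(** Exceeds the [P]-th power of the constant found for operators from [l_oo]; being at least one, it
    also exceeds that constant. *)
Let W : R := (9 * q.+1%:R) ^+ P * (K ^+ q.+1 + 2) + 1.

Let W1 : 1 <= W.
Proof. by rewrite lerDr mulr_ge0 ?exprn_ge0 ?mulr_ge0// addr_ge0 ?exprn_ge0. Qed.

(** The weights [t_i^(P-1)] make the trace equal to [th^P], while the test operator has 1-summing
    constant [2 W M th^(P-1)]; the quotient bounds [th]. Truncation leaves the test operator with
    finitely many rows. *)
Lemma sum_power_trunc_le (I : finType) (x : I -> ell2) (M : R) N : 0 < M ->
  (forall f : bop ell2 R, `|f| <= 1 -> \sum_i `|f (x i)| ^+ P <= M ^+ P) ->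
  \sum_i `|T (trunc N (x i))| ^+ P <= (2 * K1 * W * C * M) ^+ P.
Proof.
move=> M0 xM; set tau := \sum_i _; pose t i := `|T (trunc N (x i))|.
have W0 : 0 < W := lt_le_trans ltr01 W1.
have tau0 : 0 <= tau by apply: sumr_ge0 => i _; rewrite exprn_ge0.
pose th := tau `^ P%:R^-1.
have thE : th ^+ P = tau.
  by rewrite -powR_mulrn ?powR_ge0// -powRrM mulVf ?pnatr_eq0// powRr1.
have th0 : 0 <= th by exact: powR_ge0.
have R0 : 0 <= 2 * K1 * W * C * M by rewrite !mulr_ge0// ltW.
rewrite -thE lerXn2r ?nnegrE//.
have [->//|thn0] := eqVneq th 0.
have {thn0}thp : 0 < th by rewrite lt_def thn0.
have /choice[f fP] : forall i, exists f : bop X R, `|f| <= 1 /\ f (T (trunc N (x i))) = t i.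
  by move=> i; exact: norming_functional.
pose h (j : 'I_N) : bop X R := \sum_i (t i ^+ Pm * coord j (x i)) *: f i.
have hE j z : h j z = \sum_i (t i ^+ Pm * coord j (x i)) * f i z.
  by rewrite /h; elim/big_ind2 : _ => // g a g' a' <- <-.
have trE : \sum_j h j (T (ell2_basis R j)) = th ^+ P.
  under eq_bigr do rewrite hE; rewrite exchange_big thE; apply: eq_bigr => i _.
  rewrite -/(t i) PE exprSr -{3}(fP i).2 /trunc !linear_sum/= big_distrr/=.
  by apply: eq_bigr => j _; rewrite linearZ/= functionalZ mulrA.
have om0 : 0 < W * M by rewrite mulr_gt0.
have D0 : 0 < 2 * (W * M) * th ^+ Pm by rewrite !mulr_gt0// exprn_gt0.
suff rows : rows_summing h (2 * (W * M) * th ^+ Pm).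
  have := trK1 D0 C0 rows TC; rewrite trE ger0_norm ?exprn_ge0// PE exprSr.
  rewrite (_ : K1 * _ * C = th ^+ Pm * (2 * K1 * W * C * M)); last by ring.
  by rewrite ler_pM2l// exprn_gt0.
move=> J y y1.
pose z k j := h j (y k); pose nz k := Num.sqrt (\sum_j z k j ^+ 2).
(* The vector that norms [z k]; when [nz k] is zero, division by zero makes it zero too. *)
pose xi k j := z k j / nz k.
have s2 k : 0 <= \sum_j z k j ^+ 2 by apply: sumr_ge0 => j _; rewrite sqr_ge0.
have nzE k : nz k = \sum_j z k j * xi k j.
  have -> : \sum_j z k j * xi k j = nz k ^+ 2 / nz k.
    by rewrite sqr_sqrtr// big_distrl/=; apply: eq_bigr => j _; rewrite mulrA -expr2.
  by have [->|n0] := eqVneq (nz k) 0; [rewrite invr0 mulr0|rewrite expr2 mulfK].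
have xi1 k : \sum_j xi k j ^+ 2 <= 1.
  rewrite (eq_bigr (fun j => (nz k) ^- 2 * z k j ^+ 2)); last first.
    by move=> j _; rewrite exprMn exprVn mulrC.
  rewrite -big_distrr/= -[X in _ * X](sqr_sqrtr (s2 k)) -/(nz k).
  have [->|n0] := eqVneq (nz k) 0; first by rewrite expr0n mulr0.
  by rewrite mulVf// expf_neq0.
(* As functions of [k] these are elements of [l_oo]. The weak summability of the [x i], tested on
   the functionals with coordinates [xi k], is what [sum_norm_linfty_le] asks of them after
   scaling. *)
pose phi i k := \sum_j xi k j * coord j (x i).
have phiM k : \sum_i `|phi i k| ^+ P <= M ^+ P.
  apply: le_trans (xM _ (norm_sum_coordf_le (xi1 k))).
  apply: ler_sum => i _; rewrite le_eqVlt; apply/orP; left; apply/eqP; congr (`|_| ^+ _).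
  by rewrite /phi; elim/big_ind2 : _ => // g a g' a' -> ->.
pose w i := \sum_k phi i k *: y k.
have wM : \sum_i `|w i| ^+ P <= (W * M) ^+ P.
  have Mi : 0 <= M^-1 by rewrite invr_ge0 ltW.
  have := sum_norm_linfty_le cotX y1 (phi := fun i k => M^-1 * phi i k).
  have -> : \sum_i `|\sum_k (M^-1 * phi i k) *: y k| ^+ P =
      M ^- P * \sum_i `|w i| ^+ P.
    rewrite big_distrr/=; apply: eq_bigr => i _.
    under eq_bigr do rewrite -scalerA.
    by rewrite -scaler_sumr normrZ ger0_norm// exprMn exprVn.
  rewrite ler_pdivrMl ?exprn_gt0// => wC0; apply: (@le_trans _ _ _ _ _ (wC0 _)).
    move=> k; under eq_bigr do rewrite normrM ger0_norm// exprMn exprVn.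
    by rewrite -big_distrr/= ler_pdivrMl ?exprn_gt0// mulr1.
  rewrite [leRHS]exprMn mulrC ler_wpM2r ?exprn_ge0 ?(ltW M0)//.
  by apply: (@le_trans _ _ W); [rewrite lerDl|rewrite ler_eXnr].
rewrite (eq_bigr (fun k => nz k))//.
have -> : \sum_k nz k = \sum_i t i ^+ Pm * f i (w i).
  transitivity (\sum_k \sum_i t i ^+ Pm * (phi i k * f i (y k))).
    apply: eq_bigr => k _; rewrite nzE /z.
    under eq_bigr do rewrite hE big_distrl/=.
    rewrite exchange_big; apply: eq_bigr => i _.
    rewrite /phi big_distrl big_distrr/=; apply: eq_bigr => j _; by ring.
  rewrite exchange_big; apply: eq_bigr => i _; rewrite /w linear_sum/= big_distrr.
  by apply: eq_bigr => k _; rewrite functionalZ.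
apply: (@le_trans _ _ (\sum_i t i ^+ Pm * `|w i|)).
  apply: ler_sum => i _; rewrite ler_wpM2l ?exprn_ge0 ?normr_ge0//.
  rewrite (le_trans (ler_norm _))// (le_trans (le_opnorm _ _))// ler_piMl//.
  by case: (fP i).
apply: sum_expr_mul_le => //; try by move=> i; exact: normr_ge0.
- by rewrite -PE thE.
- by rewrite -PE.
Qed.

(** Removes the truncation: [N] is chosen for the finite family at hand, and
    [(a + b)^P <= (2a)^P + (2b)^P]. Taking [K1 + 1] keeps [B], hence the admissible error,
    positive. *)
Lemma summing_of_trace_estimate :
  summing_constant P%:R T (8 * (K1 + 1) * W * C).
Proof.
have W0 : 0 < W := lt_le_trans ltr01 W1.
have P0 : 0 < P%:R :> R by rewrite ltr0n.
have K11 : 0 < K1 + 1 by rewrite ltr_wpDl.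
apply/summing_constantP => //.
  by rewrite !mulr_ge0 ?(ltW C0) ?(ltW W0) ?(ltW K11).
move=> n x M M0 xM.
have powP (a : R) : 0 <= a -> a `^ P%:R = a ^+ P by move=> a0; exact: powR_mulrn.
have {}xM (f : bop ell2 R) : `|f| <= 1 -> \sum_i `|f (x i)| ^+ P <= M ^+ P.
  move=> /xM; rewrite powP ?(ltW M0)// (eq_bigr (fun i => `|f (x i)| ^+ P))// => i _.
  by rewrite powP.
pose B := 2 * (K1 + 1) * W * C * M.
have B0 : 0 < B by rewrite !mulr_gt0.
rewrite (eq_bigr (fun i => `|T (x i)| ^+ P)); last by move=> i _; rewrite powP.
rewrite (_ : 8 * _ * W * C * M = 4 * B); last by rewrite /B; ring.
have B40 : 0 <= 4 * B by rewrite mulrC mulr_ge0// ltW.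
rewrite powP//; pose del := B / n.+1%:R / (`|T| + 1).
have T1 : 0 < `|T| + 1 by rewrite ltr_wpDl.
have del0 : 0 < del by rewrite !divr_gt0// ltr0n.
have [N xN] := trunc_cvg_fin x del0.
apply: (@le_trans _ _ (\sum_i ((2 * `|T (trunc N (x i))|) ^+ P + (2 * (B / n.+1%:R)) ^+ P))).
  apply: ler_sum => i _.
  have : `|T (x i)| <= `|T (trunc N (x i))| + B / n.+1%:R.
    rewrite -[x i in leLHS](subrK (trunc N (x i))) linearD addrC.
    rewrite (le_trans (ler_normD _ _))// lerD2l (le_trans (le_opnorm _ _))//.
    apply: (@le_trans _ _ ((`|T| + 1) * del)); last by rewrite mulrC divfK// gt_eqF.
    by rewrite ler_pM ?opnorm_ge0// ?lerDl// ltW.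
  have : 0 <= B / n.+1%:R by rewrite divr_ge0// ltW.
  have := normr_ge0 (T (trunc N (x i))).
  move: (B / _) `|T (trunc _ _)| => b a a0 b0 le_ab.
  have [ab|/ltW ba] := leP a b.
    rewrite -[leLHS]add0r lerD ?exprn_ge0 ?mulr_ge0// lerXn2r ?nnegrE ?mulr_ge0//.
    by rewrite (le_trans le_ab)// mulr_natl mulr2n lerD2r.
  rewrite -[leLHS]addr0 lerD ?exprn_ge0 ?mulr_ge0// lerXn2r ?nnegrE ?mulr_ge0//.
  by rewrite (le_trans le_ab)// mulr_natl mulr2n lerD2l.
rewrite big_split/= sumr_const card_ord.
rewrite (eq_bigr (fun i => 2 ^+ P * `|T (trunc N (x i))| ^+ P)); last first.
  by move=> i _; rewrite exprMn.
rewrite -big_distrr/=.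
have h1 : \sum_i `|T (trunc N (x i))| ^+ P <= B ^+ P.
  apply: le_trans (sum_power_trunc_le N M0 xM) _.
  rewrite lerXn2r ?nnegrE ?(ltW B0) ?mulr_ge0 ?(ltW W0) ?(ltW C0) ?(ltW M0)//.
  by rewrite !ler_wpM2r ?(ltW W0) ?(ltW C0) ?(ltW M0)// ler_wpM2l// lerDl.
have h2 : (2 * (B / n.+1%:R)) ^+ P *+ n <= 2 ^+ P * B ^+ P.
  rewrite exprMn -mulrnAr ler_wpM2l ?exprn_ge0// exprMn -mulrnAr ler_piMr ?exprn_ge0 ?(ltW B0)//.
  rewrite exprVn -mulr_natr mulrC ler_pdivrMr ?exprn_gt0 ?ltr0n// mul1r.
  by rewrite (@le_trans _ _ n.+1%:R) ?ler_nat// ler_eXnr// ler1n.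
apply: le_trans (lerD (ler_wpM2l _ h1) h2) _; first exact: exprn_ge0.
have -> : 2 ^+ P * B ^+ P + 2 ^+ P * B ^+ P = (2 * 2 ^+ P) * B ^+ P by ring.
rewrite [leRHS]exprMn ler_wpM2r ?exprn_ge0 ?(ltW B0)//.
have -> : 4 = 2 * 2 :> R by ring.
by rewrite exprMn ler_wpM2r ?exprn_ge0// ler_eXnr// ler1n.
Qed.

End estimate.
(** The estimate holds for positive [C] only, so admissible constants are shifted, by [1] for
    summability and by [del] for the norms; the latter costs at most [e]. *)
Lemma GL2_property_S : finite_cotype X -> GL2 X -> property_S X.
Proof.
move=> [p p2 cotp] GL.
have [q [K [K0 cotX]]] := cotype_sign_bounded (lt_le_trans (ltr0Sn R 1) p2) cotp.
have [K1 [K10 trK1]] := GL2_trace_le GL.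
exists (2 * q.+1)%:R; first by rewrite ler1n.
set W : R := (9 * q.+1%:R) ^+ (2 * q.+1) * (K ^+ q.+1 + 2) + 1.
have W0 : 0 <= W.
  by rewrite addr_ge0// mulr_ge0 ?exprn_ge0 ?mulr_ge0// addr_ge0 ?exprn_ge0.
have const (T : bop ell2 X) C : 0 < C -> summing_constant 1 (adjoint T) C ->
    summing_constant (2 * q.+1)%:R T (8 * (K1 + 1) * W * C).
  by move=> C0 TC; apply: summing_of_trace_estimate => //; exact: trK1.
exists (8 * (K1 + 1) * W) => T [C0 TC0].
have C1 : summing_constant 1 (adjoint T) (C0 + 1).
  by apply: summing_constant_le TC0; rewrite ?lerDl.
have C10 : 0 <= C0 by case: TC0.
split; first by exists (8 * (K1 + 1) * W * (C0 + 1)); apply: const => //; rewrite ltr_wpDl.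
set k := 8 * (K1 + 1) * W.
have k0 : 0 <= k by rewrite !mulr_ge0// addr_ge0.
apply/lee_addgt0Pr => e e0.
have le (C : R) : summing_constant 1 (adjoint T) C ->
    (summing_norm (2 * q.+1)%:R T <= k%:E * C%:E + e%:E)%E.
  move=> TC; have C_0 : 0 <= C by case: TC.
  pose del := e / (k + 1); have del0 : 0 < del by rewrite divr_gt0 ?ltr_wpDl.
  apply: (@le_trans _ _ (k * (C + del))%:E).
    apply: ereal_inf_lbound; exists (k * (C + del)) => //; apply: const.
      by rewrite ltr_wpDl.
    by apply: summing_constant_le TC; rewrite // lerDl ltW.
  rewrite -EFinM -EFinD lee_fin mulrDr lerD2l /del mulrCA ger_pMr//.
  by rewrite ler_pdivrMr ?ltr_wpDl// mul1r lerDl.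
rewrite -leeBlDr//; set s := summing_norm 1 _.
have s0 : (0 <= s)%E.
  by apply: le_ereal_inf_tmp => _ [E [E0 _] <-]; rewrite lee_fin.
have [k00|kn0] := eqVneq k 0.
  have := le _ TC0; rewrite k00 !mul0e => h.
  by rewrite leeBlDr// .
have kp : 0 < k by rewrite lt_def kn0.
rewrite muleC -lee_pdivrMr//; apply: le_ereal_inf_tmp => _ [C TC <-].
by rewrite lee_pdivrMr// muleC leeBlDr//; exact: le.
Qed.

End GL2_property_S.

(** * Finite cotype from a single strict inequality *)

Section cotype_from_ratio.
Context {R : realType} (X : normedModType R).

Lemma exists_expr_lt (r e : R) : 0 <= r -> r < 1 -> 0 < e -> exists m, r ^+ m < e.
Proof.
move=> r0 r1 e0.
have r1' : `|r| < 1 by rewrite ger0_norm.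
have /cvgrPdist_lt/(_ e e0)[m _ /(_ m (leqnn m))] := cvg_expr r1'.
by rewrite /= sub0r normrN normrX ger0_norm// => h; exists m.
Qed.

Variables (N : nat) (rho : R).
Hypothesis N0 : (0 < N)%N.
Hypothesis rho01 : 0 < rho < 1.
Hypothesis ratio : forall x : 'I_N -> X, \sum_i `|x i| ^+ 2 <= rho * N%:R * rad2 x.

Fixpoint power_index (k : nat) : finType :=
  if k is k'.+1 then ('I_N * power_index k')%type else unit.

Lemma card_power_index k : #|power_index k| = (N ^ k)%N.
Proof. by elim: k => [|k IH] /=; rewrite ?card_unit// card_prod card_ord IH expnS. Qed.

Lemma ratio_power k (x : power_index k -> X) :
  \sum_i `|x i| ^+ 2 <= (rho * N%:R) ^+ k * rad2 x.
Proof.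
have /andP[rho0 _] := rho01.
have rN : 0 <= rho * N%:R by rewrite mulr_ge0// ltW.
elim: k x => [|k IH] x.
  by rewrite expr0 mul1r (bigD1 tt)//= big1 ?addr0 ?le_rad2// => -[].
by rewrite exprS; apply: rad2_prod IH x => //; exact: exprn_ge0.
Qed.

Section levels.
Variables (n : nat) (x : 'I_n -> X).
Hypothesis S0 : 0 < rad2 x.
Let a i := `|x i| ^+ 2.

(** Otherwise [N^(k+2)] of the vectors form a family to which [ratio_power] applies, and it gives
    [rho^(k+1) <= rho^(k+2)]. *)
Lemma card_level_lt k :
  (#|[set i | (rho ^+ k.+1 * rad2 x < a i)%R]%SET| < N ^ k.+2)%N.
Proof.
have /andP[rho0 rho1] := rho01.
rewrite ltnNge -card_power_index; apply/negP => le_card.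
set A := finset _ in le_card.
pose s (p : power_index k.+2) : 'I_n := enum_val (widen_ord le_card (enum_rank p)).
have sI : injective s.
  by move=> p p' /enum_val_inj/(congr1 val)/= /val_inj/enum_rank_inj.
have sA p : rho ^+ k.+1 * rad2 x < a (s p).
  by have := enum_valP (widen_ord le_card (enum_rank p)); rewrite inE.
have := ratio_power (x \o s).
have : (rho * N%:R) ^+ k.+2 * rad2 (x \o s) <= (rho * N%:R) ^+ k.+2 * rad2 x.
  by rewrite ler_wpM2l ?exprn_ge0 ?mulr_ge0 ?(ltW rho0)//; exact: rad2_inj.
have : \sum_(p : power_index k.+2) rho ^+ k.+1 * rad2 x <= \sum_p a (s p).
  by apply: ler_sum => p _; exact/ltW/sA.
rewrite sumr_const card_power_index => h1 h2 h3.
have := le_trans h1 (le_trans h3 h2).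
have Nk : 0 < N%:R ^+ k.+2 :> R by rewrite exprn_gt0// ltr0n.
have -> : rho ^+ k.+1 * rad2 x *+ N ^ k.+2 = N%:R ^+ k.+2 * (rho ^+ k.+1 * rad2 x).
  by rewrite -natrX mulr_natl.
have -> : (rho * N%:R) ^+ k.+2 * rad2 x = N%:R ^+ k.+2 * (rho ^+ k.+2 * rad2 x).
  by rewrite exprMn mulrAC mulrC.
rewrite ler_pM2l// ler_pM2r//.
by rewrite [leRHS]exprS ler_pMl ?exprn_gt0// leNgt rho1.
Qed.

Variable s : nat.
Hypothesis s0 : (0 < s)%N.
Hypothesis Ns : N%:R * rho ^+ s <= 2^-1.

(** Relative to [rad2 x], the layer from [rho^(m+1)] to [rho^m] has fewer than [N^(m+2)] members of
    size at most [rho^m]; its contribution is at most [N^2 (N rho^s)^m], and [Ns] makes this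
    geometric. *)
Lemma sum_levels_le m :
  \sum_(i | rho ^+ m * rad2 x < a i) a i ^+ s <=
  N%:R ^+ 2 * rad2 x ^+ s * \sum_(k < m) 2 ^- k.
Proof.
have /andP[rho0 rho1] := rho01.
elim: m => [|m IH].
  rewrite big_ord0 mulr0 big_pred0// => i; apply/negbTE; rewrite -leNgt expr0 mul1r.
  exact: le_rad2.
rewrite (bigID (fun i => rho ^+ m * rad2 x < a i))/= big_ord_recr/= mulrDr lerD//.
  apply: le_trans IH; rewrite le_eqVlt; apply/orP; left; apply/eqP.
  apply: eq_bigl => i; apply: andb_idl; apply: le_lt_trans.
  by rewrite ler_pM2r// exprS ger_pMl ?exprn_gt0// ltW.
apply: (@le_trans _ _
  (\sum_(i in [set i | (rho ^+ m.+1 * rad2 x < a i)%R]%SET) rho ^+ (m * s) * rad2 x ^+ s)).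
  rewrite [leRHS](bigID (fun i => rho ^+ m * rad2 x < a i))/= -[leLHS]add0r lerD//.
    apply: sumr_ge0 => i _; apply: mulr_ge0; apply: exprn_ge0; exact: ltW.
  rewrite (eq_bigl (fun i => (i \in [set i | (rho ^+ m.+1 * rad2 x < a i)%R]%SET) &&
    ~~ (rho ^+ m * rad2 x < a i))); last by move=> i; rewrite inE.
  apply: ler_sum => i /andP[_]; rewrite -leNgt => ai.
  rewrite exprM -exprMn lerXn2r ?nnegrE ?sqr_ge0//.
  by apply: mulr_ge0; [rewrite exprn_ge0// ltW|exact: ltW].
rewrite sumr_const -[X in X <= _]mulr_natl.
apply: (@le_trans _ _ ((N ^ m.+2)%:R * (rho ^+ (m * s) * rad2 x ^+ s))).
  rewrite ler_wpM2r//; first by apply: mulr_ge0; apply: exprn_ge0; exact: ltW.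
  rewrite ler_nat.
  exact/ltnW/card_level_lt.
rewrite natrX -addn2 exprD.
rewrite (_ : _ * _ = N%:R ^+ 2 * rad2 x ^+ s * (N%:R ^+ m * rho ^+ (m * s))); last by ring.
rewrite ler_wpM2l//; first by apply: mulr_ge0; apply: exprn_ge0; rewrite // ltW.
by rewrite mulnC exprM -exprMn -exprVn lerXn2r ?nnegrE ?mulr_ge0 ?exprn_ge0 ?invr_ge0 ?(ltW rho0)//.
Qed.

Lemma sum_power_rad2_le : \sum_i a i ^+ s <= 2 * N%:R ^+ 2 * rad2 x ^+ s.
Proof.
have /andP[rho0 rho1] := rho01.
have /choice[m mP] : forall i, exists m, a i = 0 \/ rho ^+ m * rad2 x < a i.
  move=> i; have [->|ai0] := eqVneq (a i) 0; first by exists 0%N; left.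
  have ap : 0 < a i by rewrite lt_def ai0 sqr_ge0.
  have [m mi] := exists_expr_lt (ltW rho0) rho1 (divr_gt0 ap S0).
  by exists m; right; rewrite -ltr_pdivlMr.
pose M := (\max_i m i)%N.
rewrite (bigID (fun i => rho ^+ M * rad2 x < a i))/= [X in _ + X]big1 ?addr0; last first.
  move=> i; have [->|] := mP i; first by rewrite expr0n gtn_eqF.
  move=> lt; rewrite (le_lt_trans _ lt)// ler_pM2r// ler_wiXn2l ?(ltW rho0) ?(ltW rho1)//.
  exact: leq_bigmax.
rewrite (le_trans (sum_levels_le M))// mulrC -mulrA ler_wpM2r ?geometric_half_le//.
by apply: mulr_ge0; apply: exprn_ge0; rewrite // ltW.
Qed.

End levels.
(** The exponent is [2 s] because the layers concern squared norms. As [K >= 1], [K] also bounds its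
    own [q]-th root. *)
Lemma ratio_finite_cotype : finite_cotype X.
Proof.
have /andP[rho0 rho1] := rho01.
have NR : 0 < N%:R :> R by rewrite ltr0n.
have e0 : 0 < 2^-1 / N%:R :> R by rewrite divr_gt0.
have [t ht] := exists_expr_lt (ltW rho0) rho1 e0.
pose s := t.+1.
have Ns : N%:R * rho ^+ s <= 2^-1.
  rewrite mulrC -ler_pdivlMr// (le_trans _ (ltW ht))// exprS ger_pMl ?exprn_gt0//.
  exact: ltW.
pose q : R := (2 * s)%:R.
have q0 : 0 < q by rewrite ltr0n.
exists q; first by rewrite ler_nat leq_pmulr.
pose K : R := 2 * N%:R ^+ 2.
have K1 : 1 <= K.
  rewrite -[leLHS]mulr1; apply: ler_pM => //; first by rewrite ler1n.
  by apply: exprn_ege1; rewrite ler1n.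
exists K => n x.
have -> : 2 ^- n * \sum_(e : {ffun 'I_n -> bool})
    `|\sum_(i < n) (-1) ^+ e i *: x i| ^+ 2 = rad2 x.
  by rewrite /rad2 /rmean card_ord.
have r0 := rad2_ge0 x.
rewrite powR_root_le ?sum_powR_ge0 ?mulr_ge0 ?sqrtr_ge0 ?exprn_ge0//.
rewrite powR_mulrn ?mulr_ge0 ?sqrtr_ge0 ?exprn_ge0//.
rewrite (eq_bigr (fun i => (`|x i| ^+ 2) ^+ s)); last first.
  by move=> i _; rewrite powR_mulrn// exprM.
rewrite exprMn [X in _ * X]exprM sqr_sqrtr//.
have [z|rn0] := eqVneq (rad2 x) 0.
  rewrite z expr0n mulr0 big1// => i _.
  have := le_rad2 x i; rewrite z => h.
  suff -> : `|x i| ^+ 2 = 0 by rewrite expr0n.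
  by apply/eqP; rewrite eq_le h sqr_ge0.
have S0 : 0 < rad2 x by rewrite lt_def rn0.
rewrite (le_trans (sum_power_rad2_le S0 (ltn0Sn t) Ns))//.
rewrite ler_wpM2r ?exprn_ge0// -/K ler_eXnr//.
Qed.

End cotype_from_ratio.

(** * Gaussian variables *)

Lemma integral_cst_probability d (Omega : measurableType d) (R : realType)
    (mu : probability Omega R) (c : R) : (\int[mu]__ c%:E = c%:E)%E.
Proof.
rewrite (integral_cst mu measurableT c%:E) -[RHS]mule1; congr (_ * _)%E.
exact: probability_setT.
Qed.

Lemma measurable_superlevel d (Omega : measurableType d) (R : realType)
    (f : Omega -> R) (s : R) :
  measurable_fun setT f -> measurable [set x | s < f x].
Proof.
move=> mf; rewrite (_ : [set x | _] = setT `&` f @^-1` `]s, +oo[%classic); first exact: mf.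
by apply/seteqP; split=> x /=; rewrite in_itv/= andbT// => -[].
Qed.

Lemma measurable_sfun_cvg d (Omega : measurableType d) (R : realType) (h : Omega -> R) :
  measurable_fun setT h -> exists s : {sfun Omega >-> R}^nat,
    forall t, s k t @[k --> \oo] --> h t.
Proof.
move=> mh; have mEh : measurable_fun setT (EFin \o h) by exact/measurable_EFinP.
have [s sh] := approximation_sfun measurableT mEh.
exists s => t; have := sh t I; move=> /fine_cvg; exact.
Qed.

Section weighted_images.
Local Open Scope ereal_scope.
Context d1 (M1 : measurableType d1) d2 (M2 : measurableType d2) (R : realType).
Variables (mu1 : {measure set M1 -> \bar R}) (mu2 : {measure set M2 -> \bar R}).
Variables (X1 : M1 -> R) (X2 : M2 -> R) (W1 : M1 -> R) (W2 : M2 -> R).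
Hypotheses (mX1 : measurable_fun setT X1) (mX2 : measurable_fun setT X2).
Hypotheses (mW1 : measurable_fun setT W1) (mW2 : measurable_fun setT W2).
Hypotheses (W10 : forall x, (0 <= W1 x)%R) (W20 : forall x, (0 <= W2 x)%R).
Hypothesis eqW : forall A, measurable A ->
  \int[mu1]_(x in X1 @^-1` A) (W1 x)%:E = \int[mu2]_(x in X2 @^-1` A) (W2 x)%:E.

(** On empty fibres [c] is unconstrained, hence the maximum with zero. *)
Let int_sfun d (M : measurableType d) (mu : {measure set M -> \bar R}) (X : M -> R)
    (W : M -> R) (P : finType) (kap : R -> P) (c : P -> R) (h : R -> R) :
  measurable_fun setT X -> measurable_fun setT W -> (forall x, (0 <= W x)%R) ->
  (forall p, measurable (kap @^-1` [set p])) -> (forall x, h x = c (kap x)) ->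
  (forall x, (0 <= h x)%R) -> measurable_fun setT h ->
  \int[mu]_x (h (X x) * W x)%:E =
  \sum_p (Num.max (c p) 0)%:E * \int[mu]_(x in X @^-1` (kap @^-1` [set p])) (W x)%:E.
Proof.
move=> mX mW W0 mkap hE h0 mh.
have mk p : measurable ((kap \o X) @^-1` [set p]).
  by rewrite -[X in measurable X]setTI; exact: (mX measurableT _ (mkap p)).
rewrite -(sum_integral_preimage _ mk); first last.
- by move=> x; rewrite lee_fin mulr_ge0.
- apply/measurable_EFinP; apply: measurable_funM => //.
  exact: (measurableT_comp mh).
apply: eq_bigr => p _; rewrite -ge0_integralZl//; first last.
- by rewrite lee_fin le_max lexx orbT.
- by move=> x _; rewrite lee_fin.
- exact/measurable_funTS/measurable_EFinP.
- exact: mk.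
apply: eq_integral => x; rewrite inE /= => kx; rewrite -EFinM; congr (_ * _)%:E.
by rewrite hE kx; apply/esym/max_idPl; rewrite -kx -hE.
Qed.

(** [eqW] says that the measures with densities [W1] and [W2] have the same image on the line;
    simple functions and monotone convergence extend this to [f]. Both the passage to the normal
    density and the product formula for independent variables are instances. *)
Lemma ge0_integral_weighted_image (f : R -> R) :
  measurable_fun setT f -> (forall x, (0 <= f x)%R) ->
  \int[mu1]_x (f (X1 x) * W1 x)%:E = \int[mu2]_x (f (X2 x) * W2 x)%:E.
Proof.
move=> mf f0.
have mEf : measurable_fun setT (EFin \o f) by exact/measurable_EFinP.
pose h := nnsfun_approx measurableT mEf.
have hcvg d (M : measurableType d) (mu : {measure set M -> \bar R}) (X : M -> R)
    (W : M -> R) : measurable_fun setT X -> measurable_fun setT W ->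
    (forall x, (0 <= W x)%R) ->
    \int[mu]_x (h n (X x) * W x)%:E @[n --> \oo] --> \int[mu]_x (f (X x) * W x)%:E.
  move=> mX mW W0.
  have E x : (f (X x) * W x)%:E = limn (fun n => (h n (X x) * W x)%:E).
    have hf : EFin \o h^~ (X x) @ \oo --> (f (X x))%:E.
      by apply: (cvg_nnsfun_approx measurableT mEf) => // y _; rewrite lee_fin f0.
    apply/esym/cvg_lim => //; rewrite EFinM.
    by under eq_fun do rewrite EFinM; exact: cvgeZr.
  under [X in _ --> X]eq_integral do rewrite E.
  apply: cvg_monotone_convergence => //.
  - move=> n; apply/measurable_EFinP; apply: measurable_funM => //.
    by apply: (measurableT_comp (measurable_funPT (h n))).
  - by move=> n x _; rewrite lee_fin mulr_ge0.
  - move=> x _ m n mn; rewrite lee_fin ler_wpM2r//.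
    by apply/lefP; exact: nd_nnsfun_approx.
have hE n : \int[mu1]_x (h n (X1 x) * W1 x)%:E = \int[mu2]_x (h n (X2 x) * W2 x)%:E.
  have [P [kap [c [mkap kc]]]] := sfun_partition (fun _ : 'I_1 => (h n : {sfun R >-> R})).
  have kc0 := kc ord0.
  rewrite (int_sfun _ mX1 mW1 W10 mkap kc0)// (int_sfun _ mX2 mW2 W20 mkap kc0)//.
  by apply: eq_bigr => p _; rewrite eqW.
have := hcvg _ _ mu1 X1 W1 mX1 mW1 W10; rewrite (funext hE) => lim1.
exact: (cvg_unique _ lim1 (hcvg _ _ mu2 X2 W2 mX2 mW2 W20)).
Qed.

End weighted_images.

Section gaussian_sequences.
Context d (Omega : measurableType d) (R : realType) (mu : probability Omega R).
Variable g : nat -> {RV mu >-> R}.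
Hypothesis hg : gaussian_sequence g.

Let g_indep : independent g. Proof. by case: hg. Qed.

Lemma mRV (X : {RV mu >-> R}) : measurable_fun setT X.
Proof. exact: measurable_funPT. Qed.

Lemma independent_events N (A : nat -> set R) : (forall i, measurable (A i)) ->
  mu (\bigcap_(i in `I_N) (g i @^-1` A i)) = (\prod_(i < N) mu (g i @^-1` A i))%E.
Proof.
move=> mA; pose J : {fset nat} := [fset x in iota 0 N]%fset.
have JE : [set` J] = `I_N.
  by apply/seteqP; split=> x /=; rewrite !inE mem_iota.
rewrite -JE g_indep// -(big_mkord predT (fun i => mu (g i @^-1` A i))).
apply: perm_big; apply: uniq_perm => [||x]; rewrite ?fset_uniq ?iota_uniq//.
by rewrite !inE /index_iota subn0.
Qed.

(** Indicators are replaced by the [phi i] one index at a time. With the set at [k] left free, the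
    induction hypothesis says that the product of the other factors, as a density, changes the law
    of [g k] only by the constant [c]; so the indicator may be exchanged for [phi k]. *)
Lemma independent_prod N (phi : nat -> R -> R) :
  (forall i, measurable_fun setT (phi i)) -> (forall i x, 0 <= phi i x) ->
  (forall i, \int[mu]_t (phi i (g i t))%:E \is a fin_num)%E ->
  (\int[mu]_t (\prod_(i < N) phi i (g i t))%:E =
   \prod_(i < N) \int[mu]_t (phi i (g i t))%:E)%E.
Proof.
move=> mphi phi0 phi_fin.
pose mixed k (A : nat -> set R) i : R -> R := if (i < k)%N then phi i else \1_(A i).
suff H k : (k <= N)%N -> forall A : nat -> set R, (forall i, measurable (A i)) ->
    (\int[mu]_t (\prod_(i < N) mixed k A i (g i t))%:E =
     \prod_(i < N) \int[mu]_t (mixed k A i (g i t))%:E)%E.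
  have := H N (leqnn N) (fun=> setT) (fun=> measurableT).
  rewrite /mixed; under eq_integral do under eq_bigr do rewrite ltn_ord.
  by under [X in _ = X -> _]eq_bigr do rewrite ltn_ord.
have mixed_meas m A i : (forall i, measurable (A i)) -> measurable_fun setT (mixed m A i).
  by move=> mA; rewrite /mixed; case: ifP => // _; exact: measurable_indic.
have mixed_ge0 m A i x : 0 <= mixed m A i x by rewrite /mixed; case: ifP.
elim: k => [_ A mA|k IH kN A mA].
  rewrite /mixed /=.
  have E i : (\int[mu]_t (\1_(A i) (g i t))%:E = mu (g i @^-1` A i))%E.
    have := integral_indic mu measurableT (measurable_funPTI (g i) (mA i)).
    by rewrite setIT => <-; apply: eq_integral => t _; rewrite !indicE.
  under eq_bigr do rewrite E; rewrite -independent_events//.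
  have mI : measurable (\bigcap_(i in `I_N) (g i @^-1` A i)).
    by apply: fin_bigcap_measurable => // i _; exact: measurable_funPTI.
  have := integral_indic mu measurableT mI; rewrite setIT => <-.
  apply: eq_integral => t _; congr EFin; rewrite indicE.
  have [h|/existsNP[i /not_implyP[iN]]] := pselect (forall i, (i < N)%N -> A i (g i t)).
    rewrite mem_set; last by move=> i /= iN; exact: h.
    by rewrite big1// => i _; rewrite indicE mem_set//; exact: h.
  move=> nA; rewrite memNset; last by move=> /(_ i iN).
  by rewrite (bigD1 (Ordinal iN))//= indicE memNset// mul0r.
pose ok := Ordinal kN.
pose W t := \prod_(i < N | i != ok) mixed k.+1 A i (g i t).
have mW : measurable_fun setT W.
  have -> : W = (fun t => \prod_(i < N)
      (fun i t => if i != ok then mixed k.+1 A i (g i t) else 1) i t).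
    by apply/funext => t; rewrite /W big_mkcond.
  apply: measurable_prod => i _; case: (i != ok) => //.
  by apply: measurableT_comp => //; exact: mixed_meas.
have W0 t : 0 <= W t by apply: prodr_ge0.
have mixE i B : i != k -> mixed k (fun j => if j == k then B else A j) i = mixed k.+1 A i.
  by move=> ik; rewrite /mixed ltnS [(i <= k)%N]leq_eqVlt (negPf ik).
have mixk B : mixed k (fun j => if j == k then B else A j) k = \1_B.
  by rewrite /mixed ltnn eqxx.
pose c := (\prod_(i < N | i != ok) \int[mu]_t (mixed k.+1 A i (g i t))%:E)%E.
have fin_mix i : (\int[mu]_t (mixed k.+1 A i (g i t))%:E \is a fin_num)%E.
  rewrite /mixed; case: ifP => // _.
  have := integral_indic mu measurableT (measurable_funPTI (g i) (mA i)).
  rewrite setIT => E.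
  have -> : (\int[mu]_t (\1_(A i) (g i t))%:E = mu (g i @^-1` A i))%E.
    by rewrite -E; apply: eq_integral => t _; rewrite !indicE.
  exact: fin_num_measure (measurable_funPTI (g i) (mA i)).
have c_fin : c \is a fin_num by apply: prode_fin_num.
have c0 : (0 <= c)%E.
  by apply: prode_ge0 => i _; apply: integral_ge0 => t _; rewrite lee_fin.
have step B : measurable B ->
    (\int[mu]_(t in g k @^-1` B) (W t)%:E =
     \int[mu]_(t in g k @^-1` B) (fine c)%:E)%E.
  move=> mB; pose A' j := if j == k then B else A j.
  have mA' i : measurable (A' i) by rewrite /A'; case: ifP.
  have := IH (ltnW kN) A' mA'.
  rewrite (bigD1 ok)//= mixk.
  under [X in (_ * X)%E]eq_bigr => i ik do rewrite mixE//.
  rewrite -/c => E.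
  rewrite integral_cst//; last exact: measurable_funPTI.
  rewrite fineK// muleC.
  have := integral_indic mu measurableT (measurable_funPTI (g k) mB).
  rewrite setIT => <-.
  rewrite (_ : \int[mu]_x (\1_(g k @^-1` B) x)%:E = \int[mu]_t (\1_B (g k t))%:E)%E.
    rewrite -E [LHS]integral_mkcond; apply: eq_integral => t _.
    rewrite (bigD1 ok)//= mixk; under eq_bigr => i ik do rewrite mixE//.
    rewrite -/(W t) patchE indicE; case: ifPn => [/set_mem tB|/negP tB].
      by rewrite mem_set// mul1r.
    by rewrite memNset ?mul0r// => tB'; apply: tB; exact: mem_set.
  by apply: eq_integral => t _; rewrite !indicE.
have mixkk : mixed k.+1 A k = phi k by rewrite /mixed leqnn.
rewrite [RHS](bigD1 ok)//= mixkk -/c.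
transitivity (\int[mu]_t (phi k (g k t) * W t)%:E)%E.
  by apply: eq_integral => t _; rewrite (bigD1 ok)//= mixkk.
rewrite (ge0_integral_weighted_image (mRV (g k)) (mRV (g k)) mW
  (measurable_cst (fine c)) W0 (fun=> fine_ge0 c0) step (mphi k) (phi0 k)).
under eq_integral do rewrite EFinM /=.
rewrite ge0_integralZr ?fineK//.
- by apply/measurable_EFinP; apply: measurableT_comp => //; exact: mphi.
- by move=> t _; rewrite lee_fin.
Qed.

End gaussian_sequences.

Section gaussian_law.
Context d (Omega : measurableType d) (R : realType) (mu : probability Omega R).

Section one_variable.
Variable X : {RV mu >-> R}.
Hypothesis gX : standard_gaussian X.

Lemma ge0_integral_gaussian (f : R -> R) :
  measurable_fun setT f -> (forall x, 0 <= f x) ->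
  (\int[mu]_t (f (X t))%:E =
   \int[lebesgue_measure]_x (f x * normal_pdf 0 1 x)%:E)%E.
Proof.
move=> mf f0.
transitivity (\int[mu]_t (f (X t) * cst 1 t)%:E)%E.
  by apply: eq_integral => t _ /=; rewrite mulr1.
rewrite (@ge0_integral_weighted_image _ _ _ _ _ mu lebesgue_measure X id (cst 1)
  (normal_pdf 0 1))//.
- exact: measurable_normal_pdf.
- by move=> x; exact: normal_pdf_ge0.
- move=> A mA; rewrite -[LHS]/(\int[mu]_(x in X @^-1` A) cst 1%E x)%E.
  rewrite integral_cst//; last exact: measurable_funPTI.
  by rewrite mul1e -[LHS]/(distribution mu X A) gX.
Qed.

(** Completing the square. *)
Lemma normal_pdf_shift (a x : R) :
  expR (a * x) * normal_pdf 0 1 x = expR (a ^+ 2 / 2) * normal_pdf a 1 x.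
Proof.
rewrite !normal_pdfE ?oner_neq0// mulrCA [RHS]mulrCA; congr (_ * _).
by rewrite /normal_fun -!expRD; congr expR; field.
Qed.

Lemma integral_expR_gaussian (a : R) :
  (\int[mu]_t (expR (a * X t))%:E = (expR (a ^+ 2 / 2))%:E)%E.
Proof.
rewrite (@ge0_integral_gaussian (fun x => expR (a * x))); last 2 first.
- by apply: measurableT_comp => //; exact: measurable_funM.
- by move=> x; exact: expR_ge0.
under eq_integral do rewrite normal_pdf_shift EFinM.
rewrite ge0_integralZl//; last first.
- by move=> x _; rewrite lee_fin normal_pdf_ge0.
- by apply/measurable_EFinP; exact: measurable_normal_pdf.
by rewrite integral_normal_pdf ?mule1// oner_neq0.
Qed.

(** If the tail were null, [X <= s] almost surely would bound the exponential moment
    [expR (a^2 / 2)] by [expR (a * s)], which fails for [a > 2 s]. *)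
Lemma gaussian_tail_gt0 (s : R) : 0 <= s -> (0 < mu [set t | s < `|X t|]%R)%E.
Proof.
move=> s0; rewrite lt_def measure_ge0 andbT; apply/eqP => tail0.
have mtail : measurable [set t | s < `|X t|].
  by apply: measurable_superlevel; exact: measurableT_comp.
pose a := 2 * s + 1.
have a0 : 0 < a by rewrite ltr_wpDl ?mulr_ge0.
have : (\int[mu]_t (expR (a * X t))%:E <= \int[mu]__ (expR (a * s))%:E)%E.
  apply: ae_ge0_le_integral => //.
  - apply/measurable_EFinP; apply: measurableT_comp => //.
    exact: measurable_funM.
  exists [set t | s < `|X t|]; split => // t /= /not_implyP[_].
  move=> /negP; rewrite lee_fin ler_expR -ltNge ltr_pM2l// => sX.
  exact: lt_le_trans (ler_norm _).
rewrite integral_expR_gaussian integral_cst_probability lee_fin ler_expR.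
rewrite leNgt => /negP; apply; rewrite expr2 -mulrA ltr_pM2l// /a; lra.
Qed.

(** The density is even. Separate positive and negative parts keep all integrands nonnegative. *)
Lemma gaussian_truncated_mean0 (s : R) : 0 <= s ->
  (\int[mu]_t (Num.max (X t) 0 * (`|X t| <= s)%R%:R)%:E =
   \int[mu]_t (Num.max (- X t) 0 * (`|X t| <= s)%R%:R)%:E)%E.
Proof.
move=> s0.
have mI : measurable_fun setT (fun x : R => (`|x| <= s)%R%:R : R).
  rewrite (_ : (fun x : R => _) = \1_(`[- s, s]%classic)); first exact: measurable_indic.
  apply/funext => x; rewrite indicE; congr (nat_of_bool _)%:R.
  by apply/idP/idP => [h|]; [rewrite inE /= in_itv/= -ler_norml|
     rewrite inE /= in_itv/= -ler_norml].
have mX0 : measurable_fun setT (fun x : R => Num.max x 0 * (`|x| <= s)%R%:R).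
  by apply: measurable_funM => //; exact: measurable_maxr.
have mX1 : measurable_fun setT (fun x : R => Num.max (- x) 0 * (`|x| <= s)%R%:R).
  by apply: measurable_funM => //; apply: measurable_maxr => //; exact: measurable_oppr.
have pos (y : R) (b : bool) : 0 <= Num.max y 0 * b%:R.
  by rewrite mulr_ge0// le_max lexx orbT.
rewrite (ge0_integral_gaussian mX0)// (ge0_integral_gaussian mX1)//.
pose G (x : R) := - x * normal_pdf 0 1 x.
have pdfN x : normal_pdf 0 1 (- x) = normal_pdf 0 1 x :> R.
  by rewrite !normal_pdfE ?oner_neq0// /normal_fun !subr0 sqrrN.
transitivity (\int[lebesgue_measure]_(x in `[0%R, s]) ((G \o -%R) x)%:E)%E.
  rewrite [RHS]integral_mkcond; apply: eq_integral => x _; rewrite patchE.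
  rewrite /G /= opprK pdfN; case: ifPn => [/set_mem|/negP nx].
    rewrite /= in_itv/= => /andP[x0 xs]; rewrite ger0_norm// xs mulr1.
    by rewrite (max_idPl _).
  congr EFin; have [x0|x0] := leP x 0; first by rewrite !mul0r.
  rewrite gtr0_norm//; case: leP => [xs|_]; last by rewrite mulr0 mul0r.
  by exfalso; apply: nx; rewrite inE /= in_itv/= (ltW x0).
rewrite -integration_by_substitution_oppr//; last first.
  apply: continuous_subspaceT => x; apply: cvgM; first exact: cvgN.
  by apply: continuous_normal_pdf; exact: oner_neq0.
rewrite [LHS]integral_mkcond; apply: eq_integral => x _; rewrite patchE /G oppr0.
case: ifPn => [/set_mem|/negP nx].
  rewrite /= in_itv/= => /andP[x0 xs]; rewrite ler0_norm// lerNl x0 mulr1.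
  by rewrite (max_idPl _)// oppr_ge0.
congr EFin; have [x0|x0] := leP (- x) 0; first by rewrite !mul0r.
rewrite ltr0_norm -?oppr_gt0//; case: leP => [xs|_]; last by rewrite mulr0 mul0r.
by exfalso; apply: nx; rewrite inE /= in_itv/= lerNl xs/= -oppr_ge0 ltW.
Qed.

End one_variable.

End gaussian_law.

(** * Strongly measurable functions and their [L_2] norm *)

Section strongly_measurable_functions.
Context d (Omega : measurableType d) (R : realType).
Variables (mu : {measure set Omega -> \bar R}) (X : normedModType R).

Lemma partition_measurable (P : finType) (kap : Omega -> P) (B : set P) :
  (forall p, measurable (kap @^-1` [set p])) -> measurable (kap @^-1` B).
Proof.
move=> mkap; rewrite (_ : kap @^-1` B = \bigcup_(p in B) (kap @^-1` [set p])).
  by apply: fin_bigcup_measurable => // p _; exact: mkap.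
by apply/seteqP; split=> [t Bt|t [p Bp /= ->]//]; exists (kap t).
Qed.

Lemma partition_simple (P : finType) (kap : Omega -> P) (Phi : P -> X) :
  (forall p, measurable (kap @^-1` [set p])) -> simple_function (Phi \o kap).
Proof.
move=> mkap; split.
  apply: (@sub_finite_set _ _ (range Phi)); last exact: finite_image.
  by move=> _ [t _ <-]; exists (kap t).
by move=> x; rewrite comp_preimage; exact: partition_measurable.
Qed.

(** [X] carries no sigma-algebra; measurability comes from the finitely many pairs of values. *)
Lemma simple_measurable (s1 s2 : Omega -> X) (phi : X -> X -> R) :
  simple_function s1 -> simple_function s2 ->
  measurable_fun setT (fun t => phi (s1 t) (s2 t)).
Proof.
move=> [f1 m1] [f2 m2] _ B mB; rewrite setTI.
have -> : (fun t => phi (s1 t) (s2 t)) @^-1` B =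
  \bigcup_(a in range s1) \bigcup_(b in [set b | range s2 b /\ B (phi a b)])
     (s1 @^-1` [set a] `&` s2 @^-1` [set b]).
  apply/seteqP; split=> [t Bt|t [a _ [b [_ Bab]] [/= sa sb]]].
    exists (s1 t); first by exists t.
    by exists (s2 t) => //; split => //; exists t.
  by rewrite /preimage /= sa sb.
apply: fin_bigcup_measurable => // a _; apply: fin_bigcup_measurable => [|b _].
  by apply: sub_finite_set f2 => b [].
exact: measurableI.
Qed.

Lemma strongly_measurable_norm_sub (U V : Omega -> X) :
  strongly_measurable U -> strongly_measurable V ->
  measurable_fun setT (fun t => `|U t - V t|).
Proof.
move=> [s [ss sU]] [r [sr rV]].
apply: (measurable_fun_cvg (h := fun n t => `|s n t - r n t|)) => // [n|t _].
  exact: (simple_measurable (fun a b => `|a - b|)).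
by apply: cvg_norm; apply: cvgB; [exact: sU|exact: rV].
Qed.

Lemma simple_function_cst (x : X) : simple_function (fun _ : Omega => x).
Proof.
split; first by apply: (@sub_finite_set _ _ [set x]) => // _ [t _ <-].
move=> y; have [->|xy] := pselect (x = y).
  by rewrite (_ : _ @^-1` _ = setT)//; apply/seteqP; split.
by rewrite (_ : _ @^-1` _ = set0)//; apply/seteqP; split.
Qed.

Lemma strongly_measurable_norm (U : Omega -> X) :
  strongly_measurable U -> measurable_fun setT (fun t => `|U t|).
Proof.
move=> mU; have m0 : strongly_measurable (fun _ : Omega => 0 : X).
  by exists (fun _ _ => 0); split=> [n|t]; [exact: simple_function_cst|exact: cvg_cst].
by have := strongly_measurable_norm_sub mU m0; under eq_fun do rewrite subr0.
Qed.

Lemma strongly_measurable_sum n (h : 'I_n -> Omega -> R) (y : 'I_n -> X) :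
  (forall i, measurable_fun setT (h i)) ->
  strongly_measurable (fun t => \sum_i h i t *: y i).
Proof.
move=> mh.
have /choice[s sP] := fun i => measurable_sfun_cvg (mh i).
exists (fun k t => \sum_i s i k t *: y i); split=> [k|t].
  have [P [kap [c [mkap kc]]]] := sfun_partition (fun i => s i k).
  rewrite (_ : (fun t => _) = (fun p => \sum_i c i p *: y i) \o kap).
    exact: partition_simple.
  by apply/funext => t /=; apply: eq_bigr => i _; rewrite kc.
elim: (index_enum _) => [|i r IH].
  by under eq_fun do rewrite big_nil; rewrite big_nil; exact: cvg_cst.
under eq_fun do rewrite big_cons; rewrite big_cons.
by apply: cvgD IH; apply: cvgZ; [exact: sP|exact: cvg_cst].
Qed.

Lemma L2_normE (U : Omega -> X) :
  L2_norm mu U = ((\int[mu]_t (`|U t| ^+ 2)%:E) `^ 2^-1)%E.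
Proof.
rewrite /L2_norm unlock; congr (_ `^ _)%E; apply: eq_integral => t _ /=.
by rewrite -[2]/(2%:R) powR_mulrn// normr_id.
Qed.

Lemma L2_norm_triangle (U V : Omega -> X) :
  strongly_measurable U -> strongly_measurable V ->
  (L2_norm mu U <= L2_norm mu (fun t => U t - V t)%R + L2_norm mu V)%E.
Proof.
move=> mU mV.
have m1 := strongly_measurable_norm_sub mU mV; have m2 := strongly_measurable_norm mV.
have mUn := strongly_measurable_norm mU.
pose f t := `|U t - V t|; pose h t := `|V t|.
have l2 : (1 <= 2%:E :> \bar R)%E by rewrite lee1n.
apply: le_trans (eminkowski mu m1 m2 l2).
rewrite L2_normE unlock; apply: gt0_ler_poweR => //.
- by rewrite in_itv/= leey integral_ge0// => t _; rewrite lee_fin exprn_ge0.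
- by rewrite in_itv/= leey integral_ge0// => t _; rewrite poweR_ge0.
apply: ge0_le_integral => //.
- by apply/measurable_EFinP; apply: measurable_funX.
- apply/measurable_EFinP; apply: (@measurableT_comp _ _ _ _ _ _ (@powR R ^~ 2)) => //.
  by apply: measurableT_comp => //; exact: measurable_funD.
move=> t _ /=; rewrite lee_fin -[2]/(2%:R) powR_mulrn// lerXn2r ?nnegrE//.
rewrite [leRHS]ger0_norm ?addr_ge0// -[U t in leLHS](subrK (V t)).
exact: ler_normD.
Qed.

End strongly_measurable_functions.

(** * GAP implies finite cotype *)

Section L2_limits.
Context d (Omega : measurableType d) (R : realType).
Variables (mu : {measure set Omega -> \bar R}) (X : normedModType R).

Lemma L2_limP (u : nat -> Omega -> X) S : L2_cvg mu u S -> L2_cvg mu u (L2_lim mu u).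
Proof. by move=> uS; apply: (getPex (P := [set S | L2_cvg mu u S])); exists S. Qed.

Lemma L2_norm_subC (U V : Omega -> X) :
  L2_norm mu (fun t => U t - V t) = L2_norm mu (fun t => V t - U t).
Proof.
by rewrite !L2_normE; under eq_integral do rewrite distrC.
Qed.

Lemma L2_norm_lim_le (u : nat -> Omega -> X) S C :
  (forall n, strongly_measurable (u n)) -> L2_cvg mu u S ->
  (forall n, L2_norm mu (u n) <= C)%E -> (L2_norm mu S <= C)%E.
Proof.
move=> mu_ [mS uS] uC; apply/lee_addgt0Pr => e e0.
have /fine_cvgP[] := uS => -[N1 _ fin] /cvgrPdist_le/(_ e e0)[N2 _ le_e].
pose N := maxn N1 N2.
have := le_e N (leq_maxr _ _); have := fin N (leq_maxl _ _).
rewrite /= sub0r normrN => finN le.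
apply: le_trans (L2_norm_triangle mu mS (mu_ N)) _; rewrite addeC leeD//.
by rewrite L2_norm_subC -(fineK finN) lee_fin (le_trans (ler_norm _)).
Qed.

(** The chosen limit is known only up to null sets; the triangle inequality compares norms without
    identifying functions. *)
Lemma L2_norm_eventually_le (u : nat -> Omega -> X) S F n :
  strongly_measurable F -> L2_cvg mu u S ->
  (forall N, (n <= N)%N -> u N = F) -> (L2_norm mu F <= L2_norm mu S)%E.
Proof.
move=> mF [mS uS] uF; apply/lee_addgt0Pr => e e0.
have /fine_cvgP[] := uS => -[N1 _ fin] /cvgrPdist_le/(_ e e0)[N2 _ le_e].
pose N := maxn n (maxn N1 N2).
have := le_e N _; have := fin N _.
rewrite /= sub0r normrN uF ?leq_maxl// => finN le.
have {}finN := finN (leq_trans (leq_maxl _ _) (leq_maxr _ _)).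
have {}le := le (leq_trans (leq_maxr _ _) (leq_maxr _ _)).
apply: le_trans (L2_norm_triangle mu mF mS) _; rewrite addeC leeD//.
by rewrite -(fineK finN) lee_fin (le_trans (ler_norm _)).
Qed.

End L2_limits.

Section gaussian_lower_bound.
Context d (Omega : measurableType d) (R : realType) (mu : probability Omega R).
Variable g : nat -> {RV mu >-> R}.
Hypothesis hg : gaussian_sequence g.
Local Notation P A := (fine (normal_prob (0 : R) 1 A)).

Lemma gaussian_event i (A : set R) : measurable A ->
  mu (g i @^-1` A) = (P A)%:E.
Proof.
move=> mA; rewrite fineK; last exact: fin_num_measure.
by case: hg => _ /(_ i)/(_ A mA).
Qed.

Lemma integral_gaussian_indic i (A : set R) : measurable A ->
  (\int[mu]_t (\1_A (g i t))%:E = (P A)%:E)%E.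
Proof.
move=> mA; rewrite -(gaussian_event i mA).
have := integral_indic mu measurableT (measurable_funPTI (g i) mA).
by rewrite setIT => <-; apply: eq_integral => t _; rewrite !indicE.
Qed.

Variables (s : R) (sigma : R).
Hypothesis s0 : 0 <= s.

Let small : set R := [set x | `|x| <= s].
Let large : set R := [set x | s < sigma * x].

Let msmall : measurable small.
Proof.
rewrite (_ : small = `[- s, s]%classic)//.
by apply/seteqP; split=> x; rewrite /small/= in_itv/= ler_norml.
Qed.

Let mlarge : measurable large.
Proof.
by apply: measurable_superlevel; exact: measurable_funM.
Qed.

Let truncated_mean (a : R) i :
  (\int[mu]_t (Num.max (a * g i t) 0 * \1_small (g i t))%:E =
   \int[mu]_t (Num.max (- (a * g i t)) 0 * \1_small (g i t))%:E)%E.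
Proof.
have indE x : \1_small x = (`|x| <= s)%R%:R :> R.
  by rewrite indicE; congr (nat_of_bool _)%:R; apply/idP/idP; rewrite inE.
wlog a0 : a / 0 <= a.
  move=> H; have [/H//|/ltW a0] := leP 0 a.
  have := H (- a); rewrite oppr_ge0 => /(_ a0).
  under eq_integral do rewrite mulNr; under [X in _ = X -> _]eq_integral do rewrite mulNr opprK.
  by [].
have E (b : R) : (\int[mu]_t (Num.max (a * (b * g i t)) 0 * \1_small (g i t))%:E =
    a%:E * \int[mu]_t (Num.max (b * g i t) 0 * (`|g i t| <= s)%R%:R)%:E)%E.
  rewrite -ge0_integralZl//.
  - apply: eq_integral => t _; rewrite indE -EFinM [in RHS]mulrA; congr (_ * _)%:E.
    by rewrite maxr_pMr// mulr0.
  - apply/measurable_EFinP; apply: measurable_funM.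
      by apply: measurable_maxr => //; exact: measurable_funM.
    rewrite (_ : (fun t => _) = \1_small \o g i).
      exact: measurableT_comp (measurable_indic msmall) (mRV (g i)).
    by apply/funext => t; rewrite /= indE.
  - by move=> t _; rewrite lee_fin mulr_ge0// le_max lexx orbT.
transitivity (\int[mu]_t (Num.max (a * (1 * g i t)) 0 * \1_small (g i t))%:E)%E.
  by apply: eq_integral => t _; rewrite mul1r.
transitivity (\int[mu]_t (Num.max (a * (-1 * g i t)) 0 * \1_small (g i t))%:E)%E; last first.
  by apply: eq_integral => t _; rewrite mulN1r mulrN.
rewrite !E; congr (_ * _)%E.
transitivity (\int[mu]_t (Num.max (g i t) 0 * (`|g i t| <= s)%R%:R)%:E)%E.
  by apply: eq_integral => t _; rewrite mul1r.
rewrite (gaussian_truncated_mean0 (hg.2 i) s0).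
by apply: eq_integral => t _; rewrite mulN1r.
Qed.

Section fixed_index.
Variables (n : nat) (i : 'I_n).

Let psi (j : nat) : R -> R := if j == i then \1_large else \1_small.

Let mpsi j : measurable_fun setT (psi j).
Proof. by rewrite /psi; case: ifP => _; exact: measurable_indic. Qed.

Let psi0 j x : 0 <= psi j x.
Proof. by rewrite /psi; case: ifP. Qed.

(** Indicator of the event that [sigma * g i] exceeds [s] while the other variables stay in
    [[-s, s]]; the product form suits [independent_prod]. *)
Definition level_indicator t := \prod_(j < n) psi j (g j t).

Let int_psi j : (\int[mu]_t (psi j (g j t))%:E =
  (if j == i then P large else P small)%:E)%E.
Proof. by rewrite /psi; case: ifP => _; rewrite integral_gaussian_indic. Qed.

Lemma integral_event : (\int[mu]_t (level_indicator t)%:E = (P large * P small ^+ n.-1)%:E)%E.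
Proof.
rewrite independent_prod//; last by move=> j; rewrite int_psi.
rewrite (bigD1 i)//= int_psi eqxx EFinM; congr (_ * _)%E.
rewrite (eq_bigr (fun=> (P small)%:E)); last first.
  by move=> j /negPf ji; rewrite int_psi -[in X in X == _]/(val j) val_eqE ji.
by rewrite prodEFin; congr EFin; rewrite prodr_const cardC1 card_ord.
Qed.

Let integral_side (a : R) (j : 'I_n) : j != i ->
  (\int[mu]_t (Num.max (a * g j t) 0 * level_indicator t)%:E =
   \int[mu]_t (Num.max (- (a * g j t)) 0 * level_indicator t)%:E)%E /\
  (\int[mu]_t (Num.max (a * g j t) 0 * level_indicator t)%:E \is a fin_num)%E.
Proof.
move=> ji.
have ji' : (val j == val i) = false by rewrite val_eqE; exact/negbTE.
pose phi b (l : nat) x := (if l == j then Num.max (b * x) 0 else 1) * psi l x.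
have mphi b l : measurable_fun setT (phi b l).
  rewrite /phi; apply: measurable_funM => //; case: (l == j) => //.
  by apply: measurable_maxr => //; exact: measurable_funM.
have phi0 b l x : 0 <= phi b l x.
  by rewrite mulr_ge0//; case: ifP => // _; rewrite le_max lexx orbT.
have psij : psi j = \1_small by rewrite /psi ji'.
have int_phi b (l : nat) : l != j -> (\int[mu]_t (phi b l (g l t))%:E =
    \int[mu]_t (psi l (g l t))%:E)%E.
  by move=> /negPf lj; apply: eq_integral => t _; rewrite /phi lj mul1r.
have phi_fin b (l : nat) : (\int[mu]_t (phi b l (g l t))%:E \is a fin_num)%E.
  have [->|lj] := eqVneq l (val j); last by rewrite int_phi// int_psi.
  rewrite ge0_fin_numE; last by apply: integral_ge0 => t _; rewrite lee_fin.
  apply: (@le_lt_trans _ _ (\int[mu]__ (`|b| * s)%:E)%E).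
    apply: ge0_le_integral => //.
    - by move=> t _; rewrite lee_fin.
    - by apply/measurable_EFinP; apply: measurableT_comp => //; exact: mphi.
    move=> t _; rewrite lee_fin /phi eqxx psij indicE.
    case: (boolP (_ \in _)) => [|_]; last by rewrite mulr0 mulr_ge0.
    rewrite inE /small /= mulr1 => gs; rewrite ge_max mulr_ge0// andbT.
    by rewrite (le_trans (ler_norm _))// normrM ler_wpM2l.
  by rewrite integral_cst_probability ltry.
have prodE b t : Num.max (b * g j t) 0 * level_indicator t = \prod_(l < n) phi b l (g l t).
  rewrite /level_indicator (bigD1 j)//= [RHS](bigD1 j)//= /phi eqxx mulrA; congr (_ * _).
  by apply: eq_bigr => l lj; rewrite -[in X in X == _]/(val l) val_eqE (negPf lj) mul1r.
have intE b : (\int[mu]_t (Num.max (b * g j t) 0 * level_indicator t)%:E =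
    \int[mu]_t (Num.max (b * g j t) 0 * \1_small (g j t))%:E *
    \prod_(l < n | l != j) \int[mu]_t (psi l (g l t))%:E)%E.
  under eq_integral do rewrite prodE.
  rewrite independent_prod// (bigD1 j)//=; congr (_ * _)%E.
    by apply: eq_integral => t _; rewrite /phi eqxx psij.
  by apply: eq_bigr => l lj; rewrite int_phi.
split; last first.
  under eq_integral do rewrite prodE.
  by rewrite independent_prod//; apply: prode_fin_num.
under [RHS]eq_integral do rewrite -mulNr.
rewrite !intE; congr (_ * _)%E; rewrite truncated_mean.
by apply: eq_integral => t _; rewrite mulNr.
Qed.

Let mev : measurable_fun setT level_indicator.
Proof.
apply: measurable_prod => j _; apply: measurableT_comp => //; exact: mpsi.
Qed.

Lemma level_indicator_ge0 t : 0 <= level_indicator t. Proof. exact: prodr_ge0. Qed.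

Lemma level_indicator01 t : level_indicator t = 0 \/ (level_indicator t = 1 /\ forall j : 'I_n,
  if j == i then s < sigma * g j t else `|g j t| <= s).
Proof.
have [h|/existsNP[j nj]] := pselect (forall j : 'I_n,
    if j == i then s < sigma * g j t else `|g j t| <= s).
  right; split=> //; rewrite /level_indicator big1// => j _; have := h j.
  rewrite /psi -[in X in X == _]/(val j) val_eqE; case: ifP => _ hj.
    by rewrite indicE mem_set.
  by rewrite indicE mem_set.
left; rewrite /level_indicator (bigD1 j)//= /psi; move: nj.
rewrite -[in X in X == _]/(val j) val_eqE; case: ifP => _ nj.
  by rewrite indicE memNset ?mul0r.
by rewrite indicE memNset ?mul0r.
Qed.

(** On the event the [i]-th term of [sigma * sum_j c_j g_j] is at least [s c_i], and the other terms
    have mean zero by symmetry. The cancellation uses their positive and negative parts, added to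
    the two sides of a pointwise inequality. *)
Lemma integral_event_lower (c : 'I_n -> R) (N : Omega -> R) :
  measurable_fun setT N -> (forall t, 0 <= N t) ->
  (forall t, sigma * \sum_j c j * g j t <= N t) -> 0 <= c i ->
  ((s * c i * (P large * P small ^+ n.-1))%:E <= \int[mu]_t (N t * level_indicator t)%:E)%E.
Proof.
move=> mN N0 cN ci0.
pose a j := if j == i then 0 else sigma * c j.
pose Gp j t := Num.max (a j * g j t) 0 * level_indicator t.
pose Gn j t := Num.max (- (a j * g j t)) 0 * level_indicator t.
have max0 (x : R) : 0 <= Num.max x 0 by rewrite le_max lexx orbT.
have mGp j : measurable_fun setT (Gp j).
  apply: measurable_funM => //; apply: measurable_maxr => //.
  exact: measurable_funM.
have mGn j : measurable_fun setT (Gn j).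
  apply: measurable_funM => //; apply: measurable_maxr => //.
  by apply: measurableT_comp => //; exact: measurable_funM.
have Gp0 j t : 0 <= Gp j t by rewrite mulr_ge0// level_indicator_ge0.
have Gn0 j t : 0 <= Gn j t by rewrite mulr_ge0// level_indicator_ge0.
have side j : (\int[mu]_t (Gp j t)%:E = \int[mu]_t (Gn j t)%:E)%E /\
    (\int[mu]_t (Gp j t)%:E \is a fin_num)%E.
  have [ji|ji] := eqVneq j i; last exact: integral_side.
  have Z t : Gp j t = 0 /\ Gn j t = 0.
    by rewrite /Gp /Gn /a ji eqxx mul0r oppr0 maxxx mul0r.
  split; first by apply: eq_integral => t _; rewrite (Z t).1 (Z t).2.
  by rewrite integral0_eq// => t _; rewrite (Z t).1.
have pw t : s * c i * level_indicator t + \sum_j Gp j t <= N t * level_indicator t + \sum_j Gn j t.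
  rewrite -lerBlDr -addrA -sumrB.
  have -> : \sum_j (Gp j t - Gn j t) = (\sum_j a j * g j t) * level_indicator t.
    rewrite big_distrl; apply: eq_bigr => j _; rewrite /Gp /Gn -mulrBl; congr (_ * _).
    by move: (a j * g j t) => x; case: (leP x 0); case: (leP (- x) 0); lra.
  rewrite -mulrDl; have [->|[-> h]] := level_indicator01 t; first by rewrite !mulr0.
  rewrite !mulr1; apply: le_trans (cN t); rewrite [in leRHS](bigD1 i)//= mulrDr.
  rewrite (bigD1 i)//= {1}/a eqxx mul0r add0r lerD//.
    have := h i; rewrite eqxx => /ltW hi.
    by rewrite mulrCA mulrC ler_wpM2l.
  rewrite big_distrr/= le_eqVlt; apply/orP; left; apply/eqP; apply: eq_bigr => j /negPf ji.
  by rewrite /a ji mulrA.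
have sumint (G : 'I_n -> Omega -> R) : (forall j, measurable_fun setT (G j)) ->
    (forall j t, 0 <= G j t) ->
    (\int[mu]_t (\sum_j G j t)%:E = \sum_j \int[mu]_t (G j t)%:E)%E.
  move=> mG G0; rewrite -ge0_integral_sum//.
  - by apply: eq_integral => t _; rewrite sumEFin.
  - by move=> j; exact/measurable_EFinP.
  - by move=> j t _; rewrite lee_fin.
have fin : (\sum_j \int[mu]_t (Gp j t)%:E \is a fin_num)%E.
  by apply/sum_fin_numP => j _ _; case: (side j).
have scev0 t : 0 <= s * c i * level_indicator t by rewrite mulr_ge0 ?level_indicator_ge0 ?mulr_ge0.
have Nev0 t : 0 <= N t * level_indicator t by rewrite mulr_ge0 ?level_indicator_ge0.
have mS (G : 'I_n -> Omega -> R) : (forall j, measurable_fun setT (G j)) ->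
    measurable_fun setT (fun t => \sum_j G j t).
  by move=> mG; exact: measurable_sum.
have splitI (u v : Omega -> R) : measurable_fun setT u -> measurable_fun setT v ->
    (forall t, 0 <= u t) -> (forall t, 0 <= v t) ->
    (\int[mu]_t (u t + v t)%:E = \int[mu]_t (u t)%:E + \int[mu]_t (v t)%:E)%E.
  move=> mu_ mv u0 v0; rewrite -ge0_integralD//.
  - by move=> t _; rewrite lee_fin.
  - exact/measurable_EFinP.
  - by move=> t _; rewrite lee_fin.
  - exact/measurable_EFinP.
have sG0 (G : 'I_n -> Omega -> R) t : (forall j t, 0 <= G j t) -> 0 <= \sum_j G j t.
  by move=> G0; apply: sumr_ge0.
have le_int : (\int[mu]_t (s * c i * level_indicator t + \sum_j Gp j t)%:E <=
    \int[mu]_t (N t * level_indicator t + \sum_j Gn j t)%:E)%E.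
  apply: ge0_le_integral => //.
  - by move=> t _; rewrite lee_fin addr_ge0 ?sG0.
  - apply/measurable_EFinP; apply: measurable_funD; last exact: mS.
    exact: measurable_funM.
  - apply/measurable_EFinP; apply: measurable_funD; last exact: mS.
    exact: measurable_funM.
  - by move=> t _; rewrite lee_fin; exact: pw.
have msc : measurable_fun setT (fun t => s * c i * level_indicator t) by exact: measurable_funM.
have mNe : measurable_fun setT (fun t => N t * level_indicator t) by exact: measurable_funM.
have eqW_le (x y : \bar R) : x = y -> (x <= y)%E by move=> ->.
have e1 := splitI _ _ msc (mS _ mGp) scev0 (fun t => sG0 _ t Gp0).
have e2 := splitI _ _ mNe (mS _ mGn) Nev0 (fun t => sG0 _ t Gn0).
have {e1 e2}le_int := le_trans (le_trans (eqW_le _ _ (esym e1)) le_int) (eqW_le _ _ e2).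
move: le_int; rewrite !sumint// (eq_bigr _ (fun j _ => esym (side j).1)) leeD2rE//.
suff -> : (\int[mu]_t (s * c i * level_indicator t)%:E =
  (s * c i * (P large * P small ^+ n.-1))%:E)%E by [].
under eq_integral do rewrite EFinM.
rewrite ge0_integralZl//; first by rewrite integral_event -EFinM.
- exact/measurable_EFinP.
- by move=> t _; rewrite lee_fin level_indicator_ge0.
- by rewrite lee_fin mulr_ge0.
Qed.

End fixed_index.

(** The events are disjoint: each determines the one index whose variable is large. *)
Lemma sum_level_indicator_le n t : `|sigma| <= 1 ->
  \sum_(i < n) level_indicator i t <= 1.
Proof.
move=> sigma1.
have [h|/existsNP[i ni]] := pselect (forall i : 'I_n, level_indicator i t = 0).
  by rewrite big1.
have [//|[ei hi]] := level_indicator01 i t.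
rewrite (bigD1 i)//= ei big1 ?addr0// => j ji.
have [//|[_ hj]] := level_indicator01 j t.
exfalso; have := hj i; rewrite eq_sym (negPf ji) leNgt => /negP; apply.
have := hi i; rewrite eqxx => /lt_le_trans; apply.
by rewrite (le_trans (ler_norm _))// normrM ler_piMl.
Qed.

(** The norm is integrated over the disjoint events; on the [i]-th one a functional norming [x i]
    reduces it to scalar coefficients. *)
Lemma gaussian_norm_lower (X : normedModType R) n (x : 'I_n -> X) : `|sigma| <= 1 ->
  ((s * \sum_i `|x i| * (P large * P small ^+ n.-1))%:E <=
   \int[mu]_t `|\sum_(i < n) g i t *: x i|%:E)%E.
Proof.
move=> sigma1; pose N t := `|\sum_(i < n) g i t *: x i|.
have mN : measurable_fun setT N.
  by apply: strongly_measurable_norm; apply: strongly_measurable_sum => i; exact: mRV.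
have mlev i : measurable_fun setT (level_indicator (i : 'I_n)).
  apply: measurable_prod => j _; apply: measurableT_comp => //.
  by case: ifP => _; exact: measurable_indic.
apply: (@le_trans _ _ (\sum_(i < n) \int[mu]_t (N t * level_indicator i t)%:E)%E).
  rewrite big_distrr/= -sumEFin; apply: lee_sum => i _.
  have [f [f1 fx]] := norming_functional (x i).
  rewrite mulrA -fx; apply: (integral_event_lower (c := fun j => f (x j))) => //.
  - by move=> t; exact: normr_ge0.
  - move=> t; rewrite (_ : \sum_j _ = f (\sum_(j < n) g j t *: x j)); last first.
      by rewrite linear_sum/=; apply: eq_bigr => j _; rewrite functionalZ mulrC.
    rewrite (le_trans (ler_norm _))// normrM (le_trans (ler_wpM2r _ sigma1))// mul1r.
    by rewrite (le_trans (le_opnorm _ _))// ler_piMl.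
  - by rewrite fx.
have Nl0 (i : 'I_n) t : (0 <= (N t * level_indicator i t)%:E)%E.
  by rewrite lee_fin; apply: mulr_ge0; [exact: normr_ge0|exact: level_indicator_ge0].
rewrite -ge0_integral_sum//.
- apply: ge0_le_integral => //.
  - by move=> t _; apply: sume_ge0.
  - apply: emeasurable_sum => i; apply/measurable_EFinP; exact: measurable_funM.
  - exact/measurable_EFinP.
  - move=> t _; rewrite sumEFin lee_fin -big_distrr/=; apply: ler_piMr; first exact: normr_ge0.
    exact: (@sum_level_indicator_le n t sigma1).
- by move=> i; apply/measurable_EFinP; exact: measurable_funM.
Qed.
End gaussian_lower_bound.

Section gaussian_level.
Context d (Omega : measurableType d) (R : realType) (mu : probability Omega R).
Variable g : nat -> {RV mu >-> R}.
Hypothesis hg : gaussian_sequence g.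
Local Notation P A := (fine (normal_prob (0 : R) 1 A)).

(** One of the two half-lines carries at least half of the tail; [sigma] is its sign. *)
Lemma gaussian_tail_side (s : R) : 0 <= s ->
  exists sigma tail : R, [/\ `|sigma| <= 1, 0 < tail <= 1,
    P [set x | `|x| <= s] = 1 - tail & tail / 2 <= P [set x | s < sigma * x]].
Proof.
move=> s0; pose N : probability _ R := normal_prob (0 : R) 1.
pose tail : set R := [set x | s < `|x|].
have mtail : measurable tail by apply: measurable_superlevel; exact: normr_measurable.
have mside (sigma : R) : measurable [set x | s < sigma * x].
  by apply: measurable_superlevel; exact: measurable_funM.
have finN A : measurable A -> N A = (fine (N A))%:E.
  by move=> mA; rewrite fineK//; exact: fin_num_measure.
have tail0 : 0 < fine (N tail).
  rewrite -lte_fin -finN//; have := gaussian_tail_gt0 (hg.2 0%N) s0.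
  by have := hg.2 0%N tail mtail; rewrite /distribution/= /pushforward => <-.
have tail1 : fine (N tail) <= 1.
  by rewrite -lee_fin -finN// probability_le1.
have small : P [set x | `|x| <= s] = 1 - fine (N tail).
  have -> : [set x | `|x| <= s] = ~` tail.
    by apply/seteqP; split=> x; rewrite /tail/= leNgt => /negP.
  rewrite [normal_prob _ _ _](probability_setC N mtail) fineB//; exact: fin_num_measure.
have cover : fine (N tail) <= fine (N [set x | s < 1 * x]) + fine (N [set x | s < -1 * x]).
  have [mp mn] := (mside 1, mside (-1)).
  rewrite -lee_fin EFinD -!finN//.
  apply: (@le_trans _ _ (N ([set x | s < 1 * x] `|` [set x | s < -1 * x]))); last exact: measureU2.
  apply: le_measure; rewrite ?inE//; first exact: measurableU.
  move=> x /=; rewrite /tail/= mul1r mulN1r; case: (ger0P x) => _; [by left|by right].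
have [h|h] := leP (fine (N tail) / 2) (fine (N [set x | s < 1 * x])).
  by exists 1, (fine (N tail)); rewrite normr1 tail0.
exists (-1), (fine (N tail)); rewrite normrN1 tail0; split=> //.
move: h cover; rewrite /N; lra.
Qed.

(* [n] is the inverse of the Gaussian tail beyond [s]: one expects a single
   coefficient beyond [s] among [n], and that one is isolated by the others
   staying below [s] with probability bounded away from [0]. *)
Lemma gaussian_level (s : R) : 0 <= s ->
  exists2 n, (0 < n)%N & forall (X : normedModType R) (x : 'I_n -> X),
    ((s / (8 * n%:R) * \sum_i `|x i|)%:E <=
     \int[mu]_t `|\sum_(i < n) g i t *: x i|%:E)%E.
Proof.
move=> s0; have [sigma [tail [sigma1 /andP[tail0 tail1] small large]]] := gaussian_tail_side s0.
(* This gives [m tail <= 1/2 <= (m+1) tail]. The first inequality yields [(1 - tail)^m >= 1/2] by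
   Bernoulli, the second [tail / 4 >= 1 / (8 n)] for [n = m + 1], the origin of the [8]. *)
pose m := Num.truncn (2 * tail)^-1.
have t20 : 0 < (2 * tail)^-1 by rewrite invr_gt0 mulr_gt0.
have /andP[m1 m2] := truncn_itv (ltW t20).
rewrite -/m in m1 m2.
exists m.+1 => // X x; apply: le_trans (gaussian_norm_lower hg s0 x sigma1).
rewrite -mulr_suml lee_fin -[leLHS]mulrA; apply: (ler_wpM2l s0).
rewrite mulrC; apply: ler_wpM2l; first exact: sumr_ge0.
rewrite {}small; move: large; move: (fine _) => l large.
have tE : (2 * tail)^-1 * tail = 2^-1 by field; lra.
have mt : m%:R * tail <= 2^-1 by rewrite -tE; apply: ler_wpM2r => //; exact: ltW.
have mt' : 2^-1 <= m.+1%:R * tail by rewrite -tE; apply: ler_wpM2r; exact: ltW.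
have B : 2^-1 <= (1 - tail) ^+ m.
  case: (m) mt => [|k] mt; first by rewrite expr0; lra.
  have t1 : 0 <= 1 - tail by lra.
  have := bernoulli_expr k t1 ler01; rewrite !expr1n mulr1.
  by apply: le_trans; lra.
apply: (@le_trans _ _ (tail / 2 * 2^-1)); last first.
  by apply: ler_pM => //; rewrite ?divr_ge0// ltW.
rewrite invfM mulrC ler_pdivrMl; last by rewrite ltr0n.
lra.
Qed.

End gaussian_level.

Lemma L2_norm_le d (Omega : measurableType d) (R : realType)
    (mu : {measure set Omega -> \bar R}) (X : normedModType R) (U : Omega -> X) (C : R) :
  0 <= C ->
  (L2_norm mu U <= C%:E)%E <-> (\int[mu]_t (`|U t| ^+ 2)%:E <= (C ^+ 2)%:E)%E.
Proof.
move=> C0; rewrite L2_normE.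
have : (0 <= \int[mu]_t (`|U t| ^+ 2)%:E)%E.
  by apply: integral_ge0 => t _; rewrite lee_fin exprn_ge0.
case: (integral _ _ _) => [r||//] r0; last first.
  by rewrite poweRyr ?invr_eq0// !leye_eq.
by rewrite poweR_EFin !lee_fin powR_root_le// powR_mulrn.
Qed.

(** Cauchy-Schwarz on a probability space, from [f <= f^2 / (2D) + D / 2]; [D = C + e] is positive
    even if [C = 0]. *)
Lemma integral_le_sqr d (Omega : measurableType d) (R : realType)
    (mu : probability Omega R) (f : Omega -> R) (C : R) :
  measurable_fun setT f -> (forall t, 0 <= f t) -> 0 <= C ->
  (\int[mu]_t (f t ^+ 2)%:E <= (C ^+ 2)%:E)%E -> (\int[mu]_t (f t)%:E <= C%:E)%E.
Proof.
move=> mf f0 C0 IU; apply/lee_addgt0Pr => e e0.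
have mf2 : measurable_fun setT (fun t => f t ^+ 2) by exact: measurable_funX.
pose D := C + e; have D0 : 0 < D by rewrite /D; lra.
have c0 : 0 <= (2 * D)^-1 by rewrite invr_ge0 mulr_ge0// ltW.
apply: (@le_trans _ _ (\int[mu]_t ((2 * D)^-1 * f t ^+ 2 + D / 2)%:E)%E).
  apply: ge0_le_integral => //.
  - by move=> t _; rewrite lee_fin.
  - exact/measurable_EFinP.
  - apply/measurable_EFinP; apply: measurable_funD => //; exact: measurable_funM.
  move=> t _; rewrite lee_fin -subr_ge0.
  rewrite (_ : _ - _ = (2 * D)^-1 * (f t - D) ^+ 2); last by field; lra.
  by rewrite mulr_ge0 ?sqr_ge0.
under eq_integral do rewrite EFinD EFinM.
rewrite ge0_integralD//=; last 3 first.
- by move=> t _; rewrite -EFinM lee_fin; apply: mulr_ge0 => //; exact: sqr_ge0.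
- by apply/measurable_EFinP; exact: measurable_funM.
- by move=> t _; rewrite lee_fin divr_ge0// ltW.
rewrite ge0_integralZl//; last 2 first.
- exact/measurable_EFinP.
- by move=> t _; rewrite lee_fin sqr_ge0.
rewrite integral_cst_probability.
apply: (@le_trans _ _ ((2 * D)^-1%:E * (C ^+ 2)%:E + (D / 2)%:E)%E).
  by apply: leeD2r; apply: lee_wpmul2l.
rewrite -EFinM -!EFinD lee_fin -/D -lerBrDr ler_pdivrMl ?mulr_gt0//.
rewrite (_ : 2 * D * (D - D / 2) = D ^+ 2); last by field.
by apply: lerXn2r; rewrite ?nnegrE//; [exact: ltW|rewrite /D lerDl ltW].
Qed.

Lemma integral_norm_le_L2_norm d (Omega : measurableType d) (R : realType)
    (mu : probability Omega R) (X : normedModType R) (U : Omega -> X) (C : R) :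
  strongly_measurable U -> 0 <= C -> (L2_norm mu U <= C%:E)%E ->
  (\int[mu]_t `|U t|%:E <= C%:E)%E.
Proof.
move=> /strongly_measurable_norm mU C0 /(L2_norm_le mu U C0); exact: integral_le_sqr.
Qed.

Section GAP.
Context d (Omega : measurableType d) (R : realType) (mu : probability Omega R).
Variables (g : nat -> {RV mu >-> R}) (X : normedModType R).

Definition gaussian_sum (T : bop (ell2 R) X) N t :=
  \sum_(n < N) g n t *: T (ell2_basis R n).

Lemma gaussian_sum_opsum n (x : 'I_n -> X) N : (n <= N)%N ->
  gaussian_sum (opsum x) N = fun t => \sum_(i < n) g i t *: x i.
Proof.
move=> nN; apply/funext => t; rewrite /gaussian_sum.
pose f k := g k t *: opsum x (ell2_basis R k).
rewrite -(big_mkord xpredT f) (big_cat_nat _ _ (n := n))//= [X in _ + X]big_nat_cond.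
rewrite [X in _ + X]big1 ?addr0 ?big_mkord; last first.
  by move=> k /andP[/andP[nk _] _]; rewrite /f opsum_basis insubF ?scaler0// ltnNge nk.
by apply: eq_bigr => i _; rewrite /f opsum_basis valK.
Qed.

(** The partial sums are constant from [n] on, so an [L_2] limit exists and the chosen one has at
    least the same norm. *)
Lemma L2_norm_gaussian_le_ell_norm n (x : 'I_n -> X) :
  (L2_norm mu (fun t => \sum_(i < n) g i t *: x i)%R <= ell_norm g (opsum x))%E.
Proof.
pose F t := \sum_(i < n) g i t *: x i.
have mF : strongly_measurable F by apply: strongly_measurable_sum => i; exact: mRV.
have F_lim : L2_cvg mu (gaussian_sum (opsum x)) F.
  split=> //; apply: cvg_near_cst; exists n => // N nN /=.
  rewrite L2_normE gaussian_sum_opsum// integral0_eq ?poweR0r ?invr_eq0//.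
  by move=> t _; rewrite /F subrr normr0 expr0n.
apply: (L2_norm_eventually_le (n := n) mF (L2_limP F_lim)) => N nN.
exact: gaussian_sum_opsum.
Qed.

Lemma GAP_finite_cotype : gaussian_sequence g -> GAP g X -> finite_cotype X.
Proof.
move=> hg [K HK]; pose K1 := `|K| + 1.
have K10 : 0 < K1 by rewrite /K1 ltr_pwDr.
(* At this level the lower bound gives [(4 K1 / n) sum_i |x_i| <= 2 K1 r], that is
   [sum_i |x_i| <= (n / 2) r]; since each [|x_i| <= r], the ratio is [1/2]. *)
have s0 : 0 <= 32 * K1 by rewrite mulr_ge0// ltW.
have [n n0 Hn] := gaussian_level hg s0.
have nR : 0 < n%:R :> R by rewrite ltr0n.
apply: (@ratio_finite_cotype _ _ n 2^-1) => //; first by apply/andP; split; lra.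
move=> x; pose r := Num.sqrt (rad2 x).
have r0 : 0 <= r by exact: sqrtr_ge0.
have r2 : rad2 x = r ^+ 2 by rewrite sqr_sqrtr// rad2_ge0.
have xr i : `|x i| <= r by rewrite -ler_sqr ?nnegrE// -r2 le_rad2.
have ellr : (ell_norm g (opsum x) <= (K1 * (2 * r))%:E)%E.
  apply: le_trans (HK _ (opsum_finite_rank x)) _.
  have sn : (summing_norm 1 (adjoint (opsum x)) <= (2 * r)%:E)%E.
    by apply: ereal_inf_lbound; exists (2 * r) => //; exact: adjoint_opsum_summing.
  have sn0 : (0 <= summing_norm 1 (adjoint (opsum x)))%E.
    by apply: le_ereal_inf_tmp => _ [E [E0 _] <-]; rewrite lee_fin.
  apply: (@le_trans _ _ (K1%:E * summing_norm 1 (adjoint (opsum x)))%E).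
    by apply: lee_wpmul2r => //; rewrite lee_fin /K1 (le_trans (ler_norm K))// lerDl.
  by rewrite EFinM; apply: lee_wpmul2l => //; rewrite lee_fin ltW.
have mF : strongly_measurable (fun t => \sum_(i < n) g i t *: x i).
  by apply: strongly_measurable_sum => i; exact: mRV.
have C0 : 0 <= K1 * (2 * r) by rewrite !mulr_ge0// ltW.
have := integral_norm_le_L2_norm mF C0 (le_trans (L2_norm_gaussian_le_ell_norm x) ellr).
move=> /(le_trans (Hn X x)); rewrite lee_fin.
have -> : 32 * K1 / (8 * n%:R) = K1 * (4 / n%:R) by field; lra.
rewrite -[leLHS]mulrA ler_pM2l// mulrAC ler_pdivrMr// => sum_le.
apply: (@le_trans _ _ (r * \sum_i `|x i|)).
  by rewrite big_distrr/=; apply: ler_sum => i _; rewrite expr2 ler_wpM2r.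
rewrite r2 expr2 mulrA [leRHS]mulrC; apply: (ler_wpM2l r0).
lra.
Qed.

End GAP.

(** * (S) implies GAP *)

Section gaussian_moments.
Context d (Omega : measurableType d) (R : realType) (mu : probability Omega R).
Variable g : nat -> {RV mu >-> R}.
Hypothesis hg : gaussian_sequence g.

Lemma measurable_gaussian_comb (a : nat -> R) N :
  measurable_fun setT (fun t => \sum_(i < N) a i * g i t).
Proof. by apply: measurable_sum => i; exact: measurable_funM. Qed.

Lemma integral_expR_gaussian_comb (a : nat -> R) N :
  (\int[mu]_t (expR (\sum_(i < N) a i * g i t))%:E =
   (expR ((\sum_(i < N) a i ^+ 2) / 2))%:E)%E.
Proof.
under eq_integral do rewrite expR_sum.
rewrite (independent_prod hg N (phi := fun i x => expR (a i * x))).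
- rewrite (eq_bigr (fun i : 'I_N => (expR (a i ^+ 2 / 2))%:E)); last first.
    by move=> i _; rewrite integral_expR_gaussian//; exact: hg.2.
  by rewrite prodEFin -expR_sum mulr_suml.
- by move=> i; apply: measurableT_comp => //; exact: measurable_funM.
- by move=> i x; exact: expR_ge0.
- by move=> i; rewrite integral_expR_gaussian//; exact: hg.2.
Qed.

Lemma expr_le_expR q (x : R) : `|x| ^+ q.+1 <= q.+1`!%:R * (expR x + expR (- x)).
Proof.
have f0 : 0 < q.+1`!%:R :> R by rewrite ltr0n fact_gt0.
apply: (@le_trans _ _ (q.+1`!%:R * expR `|x|)).
  rewrite -ler_pdivrMl// mulrC; apply: le_trans (expR_ge1Dxn q (normr_ge0 x)).
  by rewrite lerDr.
rewrite (ler_pM2l f0); case: (ger0P x) => _; rewrite ?lerDl ?lerDr ?expR_ge0//.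
Qed.

Definition moment_bound q : R := q.+1`!%:R * (2 * expR 1).

Lemma moment_bound_ge0 q : 0 <= moment_bound q.
Proof. by rewrite /moment_bound !mulr_ge0 ?expR_ge0. Qed.

(** Coefficients are normalised to square sum at most one; then [|x|^(q+1) <= (q+1)! (e^x + e^-x)],
    and the exponential moments are at most [e^(1/2)]. *)
Lemma gaussian_comb_moment q (a : nat -> R) N s : 0 <= s ->
  \sum_(i < N) a i ^+ 2 <= s ^+ 2 ->
  (\int[mu]_t (`|\sum_(i < N) a i * g i t| ^+ q.+1)%:E <=
   (moment_bound q * s ^+ q.+1)%:E)%E.
Proof.
move=> s0; have [-> as0|sn0 as2] := eqVneq s 0.
  rewrite expr0n mulr0 integral0_eq// => t _; rewrite big1 ?normr0 ?expr0n// => i _.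
  suff -> : a i = 0 by rewrite mul0r.
  apply/eqP; rewrite -sqrf_eq0 eq_le sqr_ge0 andbT; move: as0; rewrite expr0n/=.
  apply: le_trans; rewrite (bigD1 i)//= lerDl; apply: sumr_ge0 => j _; exact: sqr_ge0.
have {sn0}s_gt0 : 0 < s by rewrite lt_def sn0.
pose b i := s^-1 * a i.
have b1 : \sum_(i < N) b i ^+ 2 <= 1.
  rewrite (eq_bigr (fun i : 'I_N => s ^- 2 * a i ^+ 2)); last by move=> i _; rewrite exprMn exprVn.
  by rewrite -mulr_sumr ler_pdivrMl ?exprn_gt0// mulr1.
have ab t : \sum_(i < N) a i * g i t = s * \sum_(i < N) b i * g i t.
  by rewrite mulr_sumr; apply: eq_bigr => i _; rewrite /b !mulrA divff ?mul1r ?gt_eqF.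
have mE (c : R) : measurable_fun setT (fun t => expR (c * \sum_(i < N) b i * g i t)).
  apply: measurableT_comp => //; apply: measurable_funM => //.
  exact: measurable_gaussian_comb.
pose c := s ^+ q.+1 * q.+1`!%:R.
have c0 : 0 <= c by rewrite mulr_ge0// exprn_ge0.
apply: (@le_trans _ _ (\int[mu]_t (c%:E *
   ((expR (1 * \sum_(i < N) b i * g i t))%:E + (expR (-1 * \sum_(i < N) b i * g i t))%:E)))%E).
  apply: ge0_le_integral => //.
  - apply/measurable_EFinP; apply: measurable_funX; apply: measurableT_comp => //.
    exact: measurable_gaussian_comb.
  - apply: emeasurable_funM => //; apply: emeasurable_funD; exact/measurable_EFinP.
  move=> t _; rewrite -EFinD -EFinM lee_fin ab mul1r mulN1r normrM (ger0_norm s0) exprMn.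
  rewrite /c -mulrA; apply: ler_wpM2l; [exact: exprn_ge0|exact: expr_le_expR].
rewrite ge0_integralZl//; last 2 first.
- apply: emeasurable_funD; exact/measurable_EFinP.
- by move=> t _; rewrite -EFinD lee_fin addr_ge0 ?expR_ge0.
rewrite ge0_integralD//; [|exact/measurable_EFinP|exact/measurable_EFinP].
have side (e : R) : e ^+ 2 = 1 ->
    (\int[mu]_t (expR (e * \sum_(i < N) b i * g i t))%:E <= (expR 1)%:E)%E.
  move=> e1; under eq_integral do rewrite mulr_sumr.
  under eq_integral do under eq_bigr do rewrite mulrA.
  rewrite (integral_expR_gaussian_comb (fun i => e * b i)) lee_fin ler_expR.
  under eq_bigr do rewrite exprMn e1 mul1r.
  move: b1; set z := (\sum_(_ < _) _); lra.
apply: (@le_trans _ _ (c%:E * ((expR 1)%:E + (expR 1)%:E))%E).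
  by apply: lee_wpmul2l => //; apply: leeD; apply: side; rewrite ?sqrrN expr1n.
rewrite -EFinD -EFinM lee_fin /c /moment_bound mulrC; set z := expR 1; lra.
Qed.

End gaussian_moments.

(** Fatou's lemma for pointwise limits. *)
Lemma integral_cvg_le d (Omega : measurableType d) (R : realType)
    (mu : {measure set Omega -> \bar R}) (F : nat -> Omega -> R) (f : Omega -> R) (B : \bar R) :
  (forall k, measurable_fun setT (F k)) -> (forall k t, 0 <= F k t) ->
  (forall t, F k t @[k --> \oo] --> f t) ->
  (forall k, (\int[mu]_t (F k t)%:E <= B)%E) -> (\int[mu]_t (f t)%:E <= B)%E.
Proof.
move=> mF F0 Ff FB.
have lim t : limn_einf (fun k => (F k t)%:E) = (f t)%:E.
  have c : (F k t)%:E @[k --> \oo] --> (f t)%:E.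
    by apply: cvg_EFin; [exact: nearW|exact: Ff].
  by rewrite (cvg_limn_einf_sup c).1.
under eq_integral do rewrite -lim.
apply: le_trans (fatou mu measurableT _ _) _.
- by move=> k; exact/measurable_EFinP.
- by move=> k t _; rewrite lee_fin.
rewrite limn_einf_lim; apply: lime_le; first exact: is_cvg_einfs.
by apply: nearW => k; apply: le_trans (FB k); apply: ereal_inf_lbound; exists k => /=.
Qed.

Lemma powR_root_expr (R : realType) (a : R) q : 0 <= a ->
  (a `^ (q.+1%:R)^-1) ^+ q.+1 = a.
Proof.
by move=> a0; rewrite -powR_mulrn ?powR_ge0// -powRrM mulVf ?pnatr_eq0// powRr1.
Qed.

Lemma expr_add1_le (R : realDomainType) (a : R) q : 0 <= a ->
  (a + 1) ^+ q <= 2 ^+ q * (a ^+ q + 1).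
Proof.
move=> a0; have [a1|/ltW a1] := leP a 1.
  apply: (@le_trans _ _ (2 ^+ q)); first by apply: lerXn2r; rewrite ?nnegrE; lra.
  by rewrite ler_peMr ?exprn_ge0// lerDr exprn_ge0.
apply: (@le_trans _ _ ((2 * a) ^+ q)); first by apply: lerXn2r; rewrite ?nnegrE; lra.
by rewrite exprMn ler_wpM2l ?exprn_ge0// lerDl.
Qed.

(** * Transfer of moments through summing operators *)

Section moments_of_summing_image.
Context d (Omega : measurableType d) (R : realType) (mu : probability Omega R).

Lemma integral_partition (P : finType) (kap : Omega -> P) (phi : P -> R) :
  (forall p, measurable (kap @^-1` [set p])) -> (forall p, 0 <= phi p) ->
  (\int[mu]_t (phi (kap t))%:E =
   (\sum_p fine (mu (kap @^-1` [set p])) * phi p)%:E)%E.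
Proof.
move=> mkap phi0.
have mphi : measurable_fun setT (fun t => (phi (kap t))%:E).
  apply/measurable_EFinP => _ A mA; rewrite setTI.
  rewrite (_ : _ @^-1` A = kap @^-1` [set p | A (phi p)]) //.
  exact: partition_measurable.
rewrite -(sum_integral_preimage mu mkap mphi) => [|t]; last by rewrite lee_fin.
rewrite -sumEFin; apply: eq_bigr => p _.
rewrite EFinM fineK; last by apply: fin_num_measure.
rewrite muleC -integral_cst//; apply: eq_integral => t.
by rewrite inE/= => ->.
Qed.

Variables (X Y : normedModType R) (T : bop Y X) (q : nat) (rho : R).
Hypothesis HT : summing_constant q.+1%:R T rho.

(** The values of the simple function, weighted by the [(q+1)]-th roots of the masses of their
    pieces, form a finite family for which both sides of the summing inequality are integrals. *)
Lemma sfun_summing_le N (e : 'I_N -> Y) (s : 'I_N -> {sfun Omega >-> R}) (B : R) :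
  0 < B ->
  (forall f : bop Y R, `|f| <= 1 ->
    (\int[mu]_t (`|\sum_i s i t * f (e i)| ^+ q.+1)%:E <= B%:E)%E) ->
  (\int[mu]_t (`|(\sum_i s i t *: T (e i))%R| ^+ q.+1)%:E <= (rho ^+ q.+1 * B)%:E)%E.
Proof.
move=> B0 HB; have [P [kap [c [mkap kc]]]] := sfun_partition s.
pose w p := fine (mu (kap @^-1` [set p])).
have w0 p : 0 <= w p by rewrite /w fine_ge0.
pose r p := w p `^ (q.+1%:R)^-1.
have r0 p : 0 <= r p by exact: powR_ge0.
have rq p : r p ^+ q.+1 = w p by exact: powR_root_expr.
pose x p := r p *: \sum_i c i p *: e i.
pose M := B `^ (q.+1%:R)^-1.
have M0 : 0 < M by exact: powR_gt0.
have MB : M ^+ q.+1 = B by apply: powR_root_expr; exact: ltW.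
have rho0 : 0 <= rho by case: HT.
have q0 : 0 < q.+1%:R :> R by rewrite ltr0n.
have weak (f : bop Y R) : `|f| <= 1 -> \sum_p `|f (x p)| `^ q.+1%:R <= M `^ q.+1%:R.
  move=> f1; rewrite powR_mulrn ?(ltW M0)// MB -lee_fin.
  apply: le_trans (HB f f1).
  pose phi p := `|\sum_i c i p * f (e i)| ^+ q.+1.
  have -> : (\int[mu]_t (`|\sum_i s i t * f (e i)| ^+ q.+1)%:E =
      \int[mu]_t (phi (kap t))%:E)%E.
    apply: eq_integral => t _; congr (`|_| ^+ _)%:E.
    by apply: eq_bigr => i _; rewrite kc.
  rewrite (integral_partition mkap) => [|p]; last exact: exprn_ge0.
  rewrite lee_fin; apply: ler_sum => p _.
  rewrite powR_mulrn// /x functionalZ normrM (ger0_norm (r0 p)) exprMn rq.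
  rewrite linear_sum/= -/(w p) le_eqVlt; apply/orP; left; apply/eqP.
  by congr (_ * `|_| ^+ _); apply: eq_bigr => i _; rewrite functionalZ.
have := summing_constant_fin q0 HT M0 weak.
rewrite powR_mulrn ?mulr_ge0 ?(ltW M0)// exprMn MB => le.
apply: le_trans (_ : (_ <= (\sum_p `|T (x p)| `^ q.+1%:R)%:E)%E) _; last by rewrite lee_fin.
pose phi p := `|\sum_i c i p *: T (e i)| ^+ q.+1.
have -> : (\int[mu]_t (`|(\sum_i s i t *: T (e i))%R| ^+ q.+1)%:E =
    \int[mu]_t (phi (kap t))%:E)%E.
  apply: eq_integral => t _; congr (`|_| ^+ _)%:E.
  by apply: eq_bigr => i _; rewrite kc.
rewrite (integral_partition mkap) => [|p]; last exact: exprn_ge0.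
rewrite lee_fin; apply: ler_sum => p _.
rewrite powR_mulrn// /x linearZ normrZ (ger0_norm (r0 p)) exprMn rq.
rewrite linear_sum/= -/(w p) le_eqVlt; apply/orP; left; apply/eqP.
by congr (_ * `|_| ^+ _); apply: eq_bigr => i _; rewrite linearZ.
Qed.

(* Outside the event where all the [h i] are approximated within [1 / N] the
   simple functions are set to [0], so that no functional sees them exceed
   the [h i] by more than [1]. *)
Lemma summing_moment_le N (e : 'I_N -> Y) (h : 'I_N -> Omega -> R) (B : R) :
  0 <= B -> (forall i, measurable_fun setT (h i)) -> (forall i, `|e i| <= 1) ->
  (forall f : bop Y R, `|f| <= 1 ->
    (\int[mu]_t (`|\sum_i h i t * f (e i)| ^+ q.+1)%:E <= B%:E)%E) ->
  (\int[mu]_t (`|(\sum_i h i t *: T (e i))%R| ^+ q.+1)%:E <=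
   (rho ^+ q.+1 * (2 ^+ q.+1 * (B + 1)))%:E)%E.
Proof.
move=> B0 mh e1 HB.
have /choice[s sP] := fun i => measurable_sfun_cvg (mh i).
pose D k := [set t | forall i, `|s i k t - h i t| * N%:R <= 1].
have mD k : measurable (D k).
  rewrite (_ : D k = \bigcap_(i in [set: 'I_N]) [set t | `|s i k t - h i t| * N%:R <= 1]).
    apply: fin_bigcap_measurable => // i _.
    rewrite (_ : [set t | _] = setT `&` (fun t => `|s i k t - h i t| * N%:R) @^-1` `]-oo, 1%R]).
      have m : measurable_fun setT (fun t => `|s i k t - h i t| * N%:R).
        apply: measurable_funM => //; apply: measurableT_comp => //.
        exact: measurable_funB.
      exact: m.
    by apply/seteqP; split=> t /=; rewrite in_itv//= => -[].
  by apply/seteqP; split=> [t Dt i _|t Dt i]; exact: Dt.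
pose v k i : {sfun Omega >-> R} := (indic_sfun _ (mD k) * s i k)%R.
have vE k i t : v k i t = \1_(D k) t * s i k t by [].
have vh k t (b : 'I_N -> R) : (forall i, `|b i| <= 1) ->
    `|\sum_i v k i t * b i| <= `|\sum_i h i t * b i| + 1.
  move=> b1; have [Dt|Dt] := pselect (D k t); last first.
    rewrite big1 ?normr0 ?addr_ge0// => i _.
    by rewrite vE indicE memNset// !mul0r.
  rewrite -lerBlDl; apply: le_trans (lerB_dist _ _) _.
  rewrite -sumrB (le_trans (ler_norm_sum _ _ _))//.
  apply: (@le_trans _ _ (\sum_(i < N) N%:R^-1)).
    apply: ler_sum => i _; rewrite -mulrBl normrM vE indicE mem_set// mul1r.
    have NR : 0 < N%:R :> R by rewrite ltr0n (leq_ltn_trans _ (ltn_ord i)).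
    rewrite -[leRHS]mulr1; apply: ler_pM => //.
    by rewrite -[leRHS]mul1r ler_pdivlMr//; exact: Dt.
  rewrite sumr_const card_ord -[_ *+ N]mulr_natr.
  by have [->|N0] := posnP N; rewrite ?mulr0// mulVf ?pnatr_eq0 -?lt0n.
have B'0 : 0 < 2 ^+ q.+1 * (B + 1) by rewrite mulr_gt0 ?exprn_gt0// ltr_wpDl.
apply: (integral_cvg_le (F := fun k t => `|\sum_i v k i t *: T (e i)| ^+ q.+1)).
- move=> k; apply: measurable_funX; apply: strongly_measurable_norm.
  by apply: strongly_measurable_sum => i.
- by move=> k t; exact: exprn_ge0.
(* The precision [1 / (N+1)] also covers [N = 0]. *)
- move=> t; have D_near : \forall k \near \oo, D k t.
    apply: filter_forall => i; have /cvgrPdist_le/(_ N.+1%:R^-1) := sP i t.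
    rewrite invr_gt0 ltr0n => /(_ isT); apply: filterS => k /=.
    rewrite distrC -[leRHS]mul1r ler_pdivlMr ?ltr0n//; apply: le_trans.
    by rewrite ler_wpM2l// ler_nat.
  suff c : `|\sum_i v k i t *: T (e i)| @[k --> \oo] --> `|\sum_i h i t *: T (e i)|.
    exact: (cvg_comp _ _ c (@exprn_continuous R q.+1 _)).
  apply: cvg_norm; elim: (index_enum _) => [|i r IH].
    by under eq_fun do rewrite big_nil; rewrite big_nil; exact: cvg_cst.
  under eq_fun do rewrite big_cons; rewrite big_cons.
  apply: cvgD IH; apply: cvgZ; last exact: cvg_cst.
  apply: cvg_trans (sP i t); apply: near_eq_cvg; apply: filterS D_near => k Dt.
  by rewrite vE indicE mem_set ?mul1r.
- move=> k; apply: sfun_summing_le => // f f1.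
  have fe i : `|f (e i)| <= 1.
    rewrite (le_trans (le_opnorm f _))// -[leRHS]mulr1.
    by apply: ler_pM; [exact: opnorm_ge0|exact: normr_ge0|exact: f1|exact: e1].
  have mhf : measurable_fun setT (fun t => (`|\sum_i h i t * f (e i)| ^+ q.+1)%:E).
    apply/measurable_EFinP; apply: measurable_funX; apply: measurableT_comp => //.
    by apply: measurable_sum => i; exact: measurable_funM.
  apply: (@le_trans _ _ (\int[mu]_t ((2 ^+ q.+1)%:E *
     ((`|\sum_i h i t * f (e i)| ^+ q.+1)%:E + 1))%E)%E).
    apply: ge0_le_integral => //.
    - apply/measurable_EFinP; apply: measurable_funX; apply: measurableT_comp => //.
      by apply: measurable_sum => i; exact: measurable_funM.
    - apply: emeasurable_funM => //; apply: emeasurable_funD => //; exact: mhf.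
    move=> t _; rewrite -EFinD -EFinM lee_fin; apply: le_trans (expr_add1_le _ _) => //.
    by apply: lerXn2r; rewrite ?nnegrE ?addr_ge0//; exact: vh.
  rewrite ge0_integralZl//; last 2 first.
  - by apply: emeasurable_funD => //; exact: mhf.
  - by move=> t _; rewrite adde_ge0// lee_fin exprn_ge0.
  rewrite ge0_integralD//.
  rewrite integral_cst_probability.
  rewrite EFinM EFinD; apply: lee_wpmul2l; rewrite ?lee_fin ?exprn_ge0//.
  by apply: leeD2r; exact: HB.
Qed.

End moments_of_summing_image.

(** * Completeness of scalar [L_2] and convergence of Gaussian series *)

Section L2_completeness.
Context d (Omega : measurableType d) (R : realType) (mu : probability Omega R).

Variable U : nat -> Omega -> R.
Hypothesis mU : forall N, measurable_fun setT (U N).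
Hypothesis cauchyU : forall e : R, 0 < e -> exists N0, forall N M,
  (N0 <= N)%N -> (N <= M)%N -> (\int[mu]_t ((U M t - U N t) ^+ 2)%:E <= e%:E)%E.

(** The Riesz-Fischer argument: a subsequence with jumps at most [2^-k] in norm converges wherever
    the sum of its jumps is finite, and Fatou's lemma passes the Cauchy estimate to the limit. *)
Lemma L2_complete : exists2 h : Omega -> R, measurable_fun setT h &
  forall e : R, 0 < e -> exists N0, forall N, (N0 <= N)%N ->
    (\int[mu]_t ((U N t - h t) ^+ 2)%:E <= e%:E)%E.
Proof.
have h2 k : 0 < 2 ^- k :> R by rewrite invr_gt0 exprn_gt0.
have /choice[N0 N0P] : forall k, exists N0, forall N M, (N0 <= N)%N -> (N <= M)%N ->
    (\int[mu]_t ((U M t - U N t) ^+ 2)%:E <= ((2 ^- k) ^+ 2)%:E)%E.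
  by move=> k; apply: cauchyU; rewrite exprn_gt0.
(* Adding up the thresholds makes the subsequence strictly increasing, whence also [k <= n k]. *)
pose n k := (\sum_(j < k.+1) (N0 j + 1))%N.
have n_ge k : (N0 k <= n k)%N.
  by rewrite /n big_ord_recr/= (leq_trans (leq_addr 1 _) (leq_addl _ _)).
have n_mono k : (n k < n k.+1)%N.
  by rewrite /n [in X in (_ < X)%N]big_ord_recr/= addnA addn1 ltnS leq_addr.
have n_id k : (k <= n k)%N.
  by elim: k => // k IH; apply: leq_ltn_trans IH (n_mono k).
pose u k := U (n k).
pose dif := telescope u.
pose W t := (\sum_(0 <= k <oo) `|dif k t|%:E)%E.
have mdif k : measurable_fun setT (dif k).
  exact: (measurable_funB (mU (n k.+1)) (mU (n k))).
have mdifE k : measurable_fun setT (fun t => `|dif k t|%:E).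
  by apply/measurable_EFinP; exact: measurableT_comp.
have mW : measurable_fun setT W by exact: ge0_emeasurable_sum.
have W0 t : (0 <= W t)%E by apply: nneseries_ge0 => k _ _; rewrite lee_fin.
have intW : (\int[mu]_t W t <= 2%:E)%E.
  rewrite integral_nneseries//.
  apply: lime_le.
    by apply: is_cvg_nneseries => k _ _; apply: integral_ge0 => t _; rewrite lee_fin.
  apply: nearW => m; apply: (@le_trans _ _ (\sum_(0 <= k < m) (2 ^- k)%:E)%E).
    apply: lee_sum => k _; apply: integral_le_sqr => //; first exact: measurableT_comp.
    under eq_integral do rewrite real_normK ?num_real//.
    exact: (N0P k _ _ (n_ge k) (ltnW (n_mono k))).
  by rewrite sumEFin lee_fin big_mkord geometric_half_le.
pose E : set Omega := [set t | W t \is a fin_num].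
have mE : measurable E by rewrite -[E]setTI; exact: emeasurable_fin_num.
have E1 : mu (~` E) = 0%E.
  have : mu.-integrable setT W.
    apply/integrableP; split=> //; under eq_integral do rewrite gee0_abs//.
    exact: le_lt_trans intW (ltry _).
  move=> /(integrable_ae measurableT)[B [mB B0 sub]].
  apply: (subset_measure0 _ mB _ B0); first exact: measurableC.
  by move=> t nEt; apply: sub => /(_ I).
have cvg_u t : E t -> cvgn (u ^~ t).
  move=> Et.
  have cs : cvgn (series (fun k => dif k t)).
    apply: normed_cvg; apply: nondecreasing_is_cvgn.
      by apply: nondecreasing_series => k *; exact: normr_ge0.
    exists (fine (W t)) => _ [m _ <-]; rewrite -lee_fin fineK//.
    rewrite /series/= -sumEFin; apply: nneseries_lim_ge => k _ _; by rewrite lee_fin.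
  rewrite (_ : u ^~ t = (fun k => u 0%N t + series (fun k => dif k t) k)).
    by apply: is_cvgD => //; exact: is_cvg_cst.
  by apply/funext => k; exact: (eq_sum_telescope (fun k => u k t)).
(* Putting the sequence to zero on the null set outside [E] makes it converge everywhere, so that
   its limit is measurable. *)
pose v k t := \1_E t * u k t.
have mv k : measurable_fun setT (v k) by apply: measurable_funM => //; exact: mU.
have cvg_v t : cvgn (v ^~ t).
  have [Et|Et] := pselect (E t).
    by rewrite /v indicE mem_set//; under eq_fun do rewrite mul1r; exact: cvg_u.
  by rewrite /v indicE memNset//; under eq_fun do rewrite mul0r; exact: is_cvg_cst.
pose h t := limn (v ^~ t).
have mh : measurable_fun setT h by apply: (measurable_fun_cvg mv) => t _; exact: cvg_v.
exists h => // e e0; have [K KP] := cauchyU e0; exists K => N KN.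
have -> : (\int[mu]_t ((U N t - h t) ^+ 2)%:E = \int[mu]_t ((\1_E t * U N t - h t) ^+ 2)%:E)%E.
  have negl (f : Omega -> R) : measurable_fun setT f ->
      (\int[mu]_t (f t ^+ 2)%:E = \int[mu]_(t in setT `\` ~` E) (f t ^+ 2)%:E)%E.
    move=> mf; apply: ge0_negligible_integral => //; first exact: measurableC.
    - by apply/measurable_EFinP; exact: measurable_funX.
    - by move=> t _; rewrite lee_fin sqr_ge0.
  rewrite (negl (fun t => U N t - h t)); last exact: measurable_funB.
  rewrite (negl (fun t => \1_E t * U N t - h t)); last first.
    by apply: measurable_funB => //; exact: measurable_funM.
  apply: eq_integral => t; rewrite inE => -[_ /contrapT Et].
  by rewrite indicE mem_set// mul1r.
apply: (integral_cvg_le (F := fun k t => (\1_E t * U N t - v (k + N)%N t) ^+ 2)).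
- move=> k; apply: measurable_funX; apply: measurable_funB => //.
  exact: measurable_funM.
- by move=> k t; exact: sqr_ge0.
- move=> t; suff c : \1_E t * U N t - v (k + N)%N t @[k --> \oo] --> \1_E t * U N t - h t.
    exact: (cvg_comp _ _ c (@exprn_continuous R 2 _)).
  apply: cvgB; first exact: cvg_cst.
  by rewrite (cvg_shiftn N (v ^~ t)); exact: cvg_v.
move=> k; apply: le_trans (KP N (n (k + N)) KN _); last first.
  by rewrite (leq_trans _ (n_id _))// leq_addl.
apply: ge0_le_integral => //.
- by move=> t _; rewrite lee_fin sqr_ge0.
- apply/measurable_EFinP; apply: measurable_funX; apply: measurable_funB => //.
  exact: measurable_funM.
- by apply/measurable_EFinP; apply: measurable_funX; exact: measurable_funB.
move=> t _; rewrite lee_fin /v -mulrBr indicE -sqrrN -mulrN opprB exprMn.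
by case: (_ \in _); rewrite ?expr1n ?mul1r// expr0n mul0r sqr_ge0.
Qed.

End L2_completeness.

(** The definition of finite rank gives coefficients point by point; Hahn-Banach makes them
    continuous. A functional norming the first vector splits off its direction, and induction
    handles the other vectors, corrected by their components along it. *)
Lemma span_functionals (R : realType) (X : normedModType R) n (y : 'I_n -> X) :
  exists (psi : 'I_n -> bop X R) (z : 'I_n -> X), forall c : 'I_n -> R,
    let v := \sum_i c i *: y i in v = \sum_i psi i v *: z i.
Proof.
elim: n y => [|n IH] y.
  by exists (fun=> 0), (fun=> 0) => c /=; rewrite !big_ord0.
have [phi [_ phiy]] := norming_functional (y ord0).
(* If the first vector is zero, so is [lam], by division by zero. *)
pose lam (x : X) := (phi (y ord0))^-1 * phi x.
have [psi [z psiz]] := IH (fun i => y (lift ord0 i) - lam (y (lift ord0 i)) *: y ord0).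
pose Psi i : bop X R := if unlift ord0 i is Some j
  then psi j - (psi j (y ord0) * (phi (y ord0))^-1) *: phi else (phi (y ord0))^-1 *: phi.
exists Psi, (fun i => if unlift ord0 i is Some j then z j else y ord0) => c v.
have lam_sum : lam v *: y ord0 = \sum_i (c i * lam (y i)) *: y ord0.
  rewrite -scaler_suml /lam /v linear_sum/= mulr_sumr; congr (_ *: _).
  by apply: eq_bigr => i _; rewrite functionalZ mulrCA.
have lam0 : lam (y ord0) *: y ord0 = y ord0.
  rewrite /lam phiy; have [->|y0] := eqVneq (y ord0) 0; first by rewrite scaler0.
  by rewrite mulVf ?scale1r ?normr_eq0.
have vE : v - lam v *: y ord0 =
    \sum_i c (lift ord0 i) *: (y (lift ord0 i) - lam (y (lift ord0 i)) *: y ord0).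
  rewrite lam_sum /v -sumrB big_ord_recl -scalerA lam0 subrr add0r.
  by apply: eq_bigr => i _; rewrite scalerBr scalerA.
have /= := psiz (fun i => c (lift ord0 i)); rewrite -vE => h.
rewrite big_ord_recl {1}/Psi unlift_none.
have -> : \sum_(i < n) Psi (lift ord0 i) v *:
      (if unlift ord0 (lift ord0 i) is Some j then z j else y ord0)
    = \sum_i psi i (v - lam v *: y ord0) *: z i.
  apply: eq_bigr => i _; rewrite /Psi liftK; congr (_ *: _).
  rewrite linearB/= functionalZ /lam.
  rewrite -[LHS]/(psi i v - (psi i (y ord0) * (phi (y ord0))^-1) * phi v); ring.
by rewrite -h -[((_^-1 *: phi) v)]/(lam v) addrC subrK.
Qed.

Lemma finite_rank_functionals (R : realType) (Y X : normedModType R) (T : bop Y X) :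
  finite_rank T -> exists n (f : 'I_n -> bop Y R) (z : 'I_n -> X),
    forall u, T u = \sum_i f i u *: z i.
Proof.
move=> [n [y Ty]]; have [psi [z psiz]] := span_functionals y.
exists n, (fun i => bop_comp (psi i) T), z => u.
by have [c Tc] := Ty u; have := psiz c; rewrite /= -Tc.
Qed.

Section limit_of_gaussian_sums.
Context d (Omega : measurableType d) (R : realType) (mu : probability Omega R).
Variable g : nat -> {RV mu >-> R}.
Hypothesis hg : gaussian_sequence g.

(** The second moment of the block from [N] to [M] is at most a constant times the sum of [a_i^2]
    over it, an increment of a bounded monotone sequence. *)
Lemma gaussian_series_L2_cvg (a : nat -> R) (A : R) :
  (forall N, \sum_(i < N) a i ^+ 2 <= A) ->
  exists2 h : Omega -> R, measurable_fun setT h &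
  forall e : R, 0 < e -> exists N0, forall N, (N0 <= N)%N ->
    (\int[mu]_t ((\sum_(i < N) a i * g i t - h t) ^+ 2)%:E <= e%:E)%E.
Proof.
move=> aA; apply: L2_complete => [N|e e0]; first exact: measurable_gaussian_comb.
pose v N := \sum_(i < N) a i ^+ 2.
have v_sup : has_sup (range v).
  by split; [exists (v 0%N), 0%N|exists A => _ [N _ <-]; exact: aA].
pose C := moment_bound R 1 + 1.
have C0 : 0 < C by rewrite ltr_wpDl ?moment_bound_ge0.
have [_ [N0 _ <-] hN0] := sup_adherent (divr_gt0 e0 C0) v_sup.
exists N0 => N M NN0 NM.
have v_mono : {homo v : n m / (n <= m)%N >-> n <= m}.
  apply: homo_leq; [exact: lexx|exact: le_trans|move=> n].
  by rewrite /v big_ord_recr lerDl sqr_ge0.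
have vM : v M <= sup (range v) by apply: sup_upper_bound => //; exists M.
pose b i := if (i < N)%N then 0 else a i.
have splitM (F : nat -> R) : \sum_(i < M) (if (i < N)%N then 0 else F i) =
    \sum_(i < M) F i - \sum_(i < N) F i.
  rewrite -(big_mkord xpredT (fun i => if (i < N)%N then 0 else F i)) -!(big_mkord xpredT F).
  rewrite [X in _ = X - _](big_cat_nat _ _ (n := N))//= [X in _ = X - _]addrC addrK.
  rewrite (big_cat_nat _ _ (n := N))//=.
  rewrite big_nat_cond big1 ?add0r; last by move=> i /andP[/andP[_ ->]].
  rewrite big_nat_cond [RHS]big_nat_cond; apply: eq_bigr => i /andP[/andP[Ni _] _].
  by rewrite ltnNge Ni.
pose s := Num.sqrt (v M - v N).
have s2 : s ^+ 2 = v M - v N by rewrite sqr_sqrtr// subr_ge0 v_mono.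
have bs : \sum_(i < M) b i ^+ 2 <= s ^+ 2.
  rewrite s2 /v -(splitM (fun i => a i ^+ 2)); apply: ler_sum => i _; rewrite /b.
  by case: ifP => // _; rewrite expr0n.
have := gaussian_comb_moment hg 1 (sqrtr_ge0 _) bs.
have -> : (\int[mu]_t (`|\sum_(i < M) b i * g i t| ^+ 2)%:E =
    \int[mu]_t ((\sum_(i < M) a i * g i t - \sum_(i < N) a i * g i t) ^+ 2)%:E)%E.
  apply: eq_integral => t _; rewrite real_normK ?num_real//; congr (_ ^+ 2)%:E.
  rewrite -(splitM (fun i => a i * g i t)); apply: eq_bigr => i _; rewrite /b.
  by case: ifP => // _; rewrite mul0r.
move/le_trans; apply; rewrite lee_fin s2.
have vMN : 0 <= v M - v N by rewrite subr_ge0 v_mono.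
apply: (@le_trans _ _ (C * (v M - v N))); first by rewrite ler_wpM2r// lerDl.
rewrite mulrC -ler_pdivlMr//; have := v_mono _ _ NN0; lra.
Qed.

Variable X : normedModType R.

(** Needed for [L2_lim] to be a limit at all. Continuous coordinates of the range reduce it to
    finitely many scalar series, and Cauchy-Schwarz accounts for [K]. *)
Lemma finite_rank_L2_cvg (T : bop (ell2 R) X) : finite_rank T ->
  exists S, L2_cvg mu (gaussian_sum g T) S.
Proof.
move=> /finite_rank_functionals[n [f [z Tz]]].
have /choice[h hP] : forall i, exists h : Omega -> R, measurable_fun setT h /\
    forall e : R, 0 < e -> exists N0, forall N, (N0 <= N)%N ->
    (\int[mu]_t ((\sum_(k < N) f i (ell2_basis R k) * g k t - h t) ^+ 2)%:E <= e%:E)%E.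
  move=> i; have [h mh hP] := gaussian_series_L2_cvg
    (a := fun k => f i (ell2_basis R k)) (functional_basis_le (f i)).
  by exists h.
pose S t := \sum_i h i t *: z i.
have mS : strongly_measurable S by apply: strongly_measurable_sum => i; case: (hP i).
pose U i N t := \sum_(k < N) f i (ell2_basis R k) * g k t.
have mU i N : measurable_fun setT (U i N).
  exact: (measurable_gaussian_comb g (fun k => f i (ell2_basis R k))).
have gaussE N t : gaussian_sum g T N t - S t = \sum_i (U i N t - h i t) *: z i.
  rewrite /gaussian_sum /S (eq_bigr (fun k : 'I_N =>
    \sum_i (f i (ell2_basis R k) * g k t) *: z i)); last first.
    by move=> k _; rewrite Tz scaler_sumr; apply: eq_bigr => i _; rewrite scalerA mulrC.
  rewrite exchange_big -sumrB; apply: eq_bigr => i _.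
  by rewrite -scaler_suml scalerBl.
pose K := 1 + \sum_i `|z i| ^+ 2.
have z0 : 0 <= \sum_i `|z i| ^+ 2 by apply: sumr_ge0 => i _; exact: sqr_ge0.
have K0 : 0 < K by rewrite ltr_wpDr.
have mUh i N : measurable_fun setT (fun t => (K * (U i N t - h i t) ^+ 2)%:E).
  apply/measurable_EFinP; apply: measurable_funM => //; apply: measurable_funX.
  by apply: measurable_funB => //; case: (hP i).
have Uh0 i N t : (0 <= (K * (U i N t - h i t) ^+ 2)%:E)%E.
  by rewrite lee_fin mulr_ge0 ?sqr_ge0// ltW.
have L2_le e : 0 < e -> exists N0, forall N, (N0 <= N)%N ->
    (L2_norm mu (fun t => gaussian_sum g T N t - S t)%R <= e%:E)%E.
  move=> e0; have ei0 : 0 < e ^+ 2 / (n.+1%:R * K) by rewrite divr_gt0 ?exprn_gt0// mulr_gt0.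
  have /choice[N0 N0P] := fun i => (hP i).2 _ ei0.
  exists (\max_i N0 i) => N NN0; apply/L2_norm_le; first exact: ltW.
  apply: (@le_trans _ _ (\sum_i (\int[mu]_t (K * (U i N t - h i t) ^+ 2)%:E))%E).
    rewrite -ge0_integral_sum//.
    - apply: ge0_le_integral => //.
      - apply/measurable_EFinP; apply: measurable_funX.
        have -> : (fun t => `|gaussian_sum g T N t - S t|) =
            (fun t => `|\sum_i (U i N t - h i t) *: z i|) by apply/funext => t; rewrite gaussE.
        apply: strongly_measurable_norm; apply: strongly_measurable_sum => i.
        by apply: measurable_funB => //; case: (hP i).
      - exact: emeasurable_sum.
      move=> t _; rewrite sumEFin lee_fin gaussE -mulr_sumr.
      apply: (@le_trans _ _ ((\sum_i `|U i N t - h i t| * `|z i|) ^+ 2)).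
        apply: lerXn2r; rewrite ?nnegrE//; first by apply: sumr_ge0 => i _; rewrite mulr_ge0.
        by rewrite (le_trans (ler_norm_sum _ _ _))//; apply: ler_sum => i _; rewrite normrZ.
      apply: (le_trans (sum_mul_sqr_le (fun i => `|U i N t - h i t|) (fun i => `|z i|))).
      rewrite mulrC.
      apply: ler_pM => //; [by apply: sumr_ge0 => i _; exact: sqr_ge0|by rewrite lerDr|].
      by apply: ler_sum => i _; rewrite real_normK ?num_real.
  have intK i : (\int[mu]_t (K * (U i N t - h i t) ^+ 2)%:E <= (e ^+ 2 / n.+1%:R)%:E)%E.
    under eq_integral do rewrite EFinM.
    rewrite ge0_integralZl//; last 3 first.
    - apply/measurable_EFinP; apply: measurable_funX.
      by apply: measurable_funB => //; case: (hP i).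
    - by move=> t _; rewrite lee_fin sqr_ge0.
    - by rewrite lee_fin ltW.
    rewrite (_ : e ^+ 2 / n.+1%:R = K * (e ^+ 2 / (n.+1%:R * K))).
      rewrite EFinM; apply: lee_wpmul2l; first by rewrite lee_fin ltW.
      by apply: N0P; rewrite (leq_trans _ NN0)// leq_bigmax.
    by rewrite invfM mulrCA [K * _]mulrCA divff ?mulr1// gt_eqF.
  apply: (@le_trans _ _ (\sum_(i < n) (e ^+ 2 / n.+1%:R)%:E)%E); first exact: lee_sum.
  rewrite sumEFin lee_fin sumr_const card_ord -[leLHS]mulr_natr -[leLHS]mulrA.
  apply: ler_piMr; first exact: sqr_ge0.
  by rewrite mulrC ler_pdivrMr// mul1r ler_nat.
exists S; split=> //; apply/fine_cvgP; split.
  have [N0 N0P] := L2_le 1 ltr01; exists N0 => // N NN0.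
  rewrite ge0_fin_numE; first exact: le_lt_trans (N0P N NN0) (ltry _).
  exact: Lnorm_ge0.
apply/cvgrPdist_le => e e0; have [N0 N0P] := L2_le e e0; exists N0 => // N NN0 /=.
have L0 : (0 <= L2_norm mu (fun t => gaussian_sum g T N t - S t)%R)%E by exact: Lnorm_ge0.
have := N0P N NN0; move: L0; case: (L2_norm _ _) => //= r; rewrite !lee_fin => r0.
by rewrite sub0r normrN ger0_norm.
Qed.

(** Moments of order [q + 1] pass through [T], and [S^2 <= rho^2 + rho^2 (S / rho)^(q+1)] since
    [q + 1 >= 2]. *)
Lemma gaussian_sum_L2_le (T : bop (ell2 R) X) q rho : (0 < q)%N -> 0 < rho ->
  summing_constant q.+1%:R T rho -> forall N,
  (L2_norm mu (gaussian_sum g T N) <=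
   ((1 + 2 ^+ q.+1 * (moment_bound R q + 1)) * rho)%:E)%E.
Proof.
move=> q0 rho0 HT N; set B := 2 ^+ q.+1 * _.
have B0 : 0 <= B by rewrite mulr_ge0 ?exprn_ge0// addr_ge0 ?moment_bound_ge0.
pose S t := `|gaussian_sum g T N t|.
have S_moment : (\int[mu]_t (S t ^+ q.+1)%:E <= (rho ^+ q.+1 * B)%:E)%E.
  apply: (summing_moment_le HT (e := fun i : 'I_N => ell2_basis R i) (h := fun i => g i)).
  - exact: moment_bound_ge0.
  - by move=> i; exact: mRV.
  - move=> i; have := norm_sum_basis (fun j => (j == i)%:R : R).
    rewrite (bigD1 i)//= [in RHS](bigD1 i)//= eqxx scale1r !big1 ?addr0.
    - by rewrite expr1n => e1; rewrite -(expr_le1 (n := 2))// e1.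
    - by move=> j /negPf ->; rewrite expr0n.
    - by move=> j /negPf ->; rewrite scale0r.
  - move=> f f1; have := gaussian_comb_moment hg q ler01 (N := N)
      (a := fun i => f (ell2_basis R i)).
    rewrite !expr1n mulr1 => h; apply: le_trans (h _).
      by under eq_integral do under eq_bigr do rewrite mulrC.
    by rewrite (le_trans (functional_basis_le f N))// expr_le1.
have mS : measurable_fun setT S.
  by apply: strongly_measurable_norm; apply: strongly_measurable_sum => i; exact: mRV.
have r0 : 0 < rho ^+ q.+1 by rewrite exprn_gt0.
have c0 : 0 <= rho ^+ 2 / rho ^+ q.+1 by rewrite divr_ge0 ?exprn_ge0 ?(ltW rho0).
apply/L2_norm_le; first by rewrite mulr_ge0 ?addr_ge0 ?(ltW rho0).
apply: (@le_trans _ _ (\int[mu]_t ((rho ^+ 2)%:E +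
  (rho ^+ 2 / rho ^+ q.+1)%:E * (S t ^+ q.+1)%:E))%E).
  apply: ge0_le_integral => //.
  - by apply/measurable_EFinP; exact: measurable_funX.
  - apply: emeasurable_funD => //; apply: emeasurable_funM => //.
    by apply/measurable_EFinP; exact: measurable_funX.
  move=> t _; rewrite -EFinM -EFinD lee_fin -/(S t).
  have S0 : 0 <= S t by exact: normr_ge0.
  have [le|/ltW le] := leP (S t) rho.
    apply: (@le_trans _ _ (rho ^+ 2)); first by apply: lerXn2r; rewrite ?nnegrE// ltW.
    by rewrite lerDl; apply: mulr_ge0 => //; exact: exprn_ge0.
  apply: (@le_trans _ _ (rho ^+ 2 / rho ^+ q.+1 * S t ^+ q.+1)); last by rewrite lerDr sqr_ge0.
  rewrite [leRHS]mulrAC ler_pdivlMr//.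
  have [k ->] : exists k, q.+1 = (2 + k)%N by case: (q) q0 => // k _; exists k.
  rewrite !exprD [leLHS]mulrCA; apply: ler_wpM2l; first exact: sqr_ge0.
  by apply: ler_wpM2l; [exact: sqr_ge0|apply: lerXn2r; rewrite ?nnegrE// ltW].
have mSq : measurable_fun setT (fun t => (S t ^+ q.+1)%:E).
  by apply/measurable_EFinP; exact: measurable_funX.
have Sq0 t : (0 <= (S t ^+ q.+1)%:E)%E by rewrite lee_fin; apply: exprn_ge0; exact: normr_ge0.
rewrite ge0_integralD//; last 3 first.
- by move=> t _; rewrite lee_fin sqr_ge0.
- by move=> t _; apply: mule_ge0; [rewrite lee_fin|exact: Sq0].
- exact: emeasurable_funM.
rewrite ge0_integralZl// integral_cst_probability.
apply: (@le_trans _ _ ((rho ^+ 2)%:E + (rho ^+ 2 / rho ^+ q.+1)%:E * (rho ^+ q.+1 * B)%:E)%E).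
  by apply: leeD2l; apply: lee_wpmul2l.
rewrite -EFinM -EFinD lee_fin mulrA divfK ?gt_eqF// exprMn -[X in X + _]mul1r [_ * B]mulrC -mulrDl.
by apply: ler_wpM2r; rewrite ?sqr_ge0// expr2 ler_peMr ?addr_ge0 ?lerDl.
Qed.

(** The exponent is raised to a natural number [q + 1 >= 2] at the price of a factor [2]; [K + 1]
    leaves room for the strict inequality in [property_SpP], and [eta] covers the admissible
    constant zero. *)
Lemma property_S_GAP : property_S X -> GAP g X.
Proof.
move=> [p p1 HX]; have [K K0 HK] := property_SpP (le_trans ler01 p1) HX.
have [q [q0 pq]] : exists q, (0 < q)%N /\ p <= q.+1%:R.
  exists (Num.truncn p).+1; split=> //.
  by rewrite (le_trans (ltW (truncnS_gt p)))// ler_nat.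
pose c := 1 + 2 ^+ q.+1 * (moment_bound R q + 1).
have c0 : 0 < c by rewrite ltr_wpDr// mulr_ge0 ?exprn_ge0// addr_ge0 ?moment_bound_ge0.
exists (c * (2 * (K + 1))) => T Tfin.
have k0 : 0 < c * (2 * (K + 1)) by rewrite !mulr_gt0// ltr_wpDl.
have [S0 S0P] := finite_rank_L2_cvg Tfin; have SP := L2_limP S0P.
have le C : 0 < C -> summing_constant 1 (adjoint T) C ->
    (ell_norm g T <= (c * (2 * (K + 1)) * C)%:E)%E.
  move=> C0 TC.
  have KC : K * C < (K + 1) * C by rewrite mulrDl mul1r ltrDl.
  have T2 := summing_constant_exponent p1 pq (HK _ _ _ TC KC).
  have rho0 : 0 < 2 * ((K + 1) * C) by rewrite !mulr_gt0// ltr_wpDl.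
  have := gaussian_sum_L2_le q0 rho0 T2; rewrite -/c => bound.
  rewrite -!mulrA; apply: (L2_norm_lim_le _ SP bound) => N.
  by apply: strongly_measurable_sum => i; exact: mRV.
rewrite muleC -lee_pdivrMr//; apply: le_ereal_inf_tmp => _ [C TC <-].
have [C0 _] := TC; rewrite lee_pdivrMr// -EFinM mulrC; apply/lee_addgt0Pr => e e0.
pose eta := e / (c * (2 * (K + 1))).
have eta0 : 0 < eta by rewrite divr_gt0.
have := le (C + eta) (ltr_wpDl C0 eta0) (summing_constant_le ler01 _ TC).
rewrite lerDl (ltW eta0) => /(_ isT); rewrite mulrDr EFinD.
by rewrite [X in (_ <= _ + X%:E)%E](_ : _ = e)// /eta mulrC divfK ?gt_eqF.
Qed.

End limit_of_gaussian_sums.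

Theorem theorem1p3 (R : realType) (X : completeNormedModType R)
    (d : measure_display) (Omega : measurableType d) (mu : probability Omega R)
    (g : nat -> {RV mu >-> R}) (hg : gaussian_sequence g) :
  [/\ (property_S X -> GAP g X),
      (forall p : R, 1 <= p -> property_Sp X p -> cotype X (Num.max 2 p)),
      (GAP g X -> finite_cotype X) &
      (finite_cotype X -> GL2 X -> property_S X /\ GAP g X)].
Proof.
split.
- exact: property_S_GAP.
- exact: property_Sp_cotype.
- exact: GAP_finite_cotype.
- move=> cX GX; have SX := GL2_property_S cX GX; split=> //.
  exact: property_S_GAP.
Qed.
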